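(* Let $w$ be the solution of the closed-loop system described in the context, and suppose that assumptions (A1) and (A2) of the context hold. Let $0\le\alpha\le\frac12\min\{\nu,\delta,c_0+w_d,c_1+w_d\}$ be such that $\beta=\min\{\nu-2\alpha,\delta-2\alpha,c_0+w_d-2\alpha,c_1+w_d-2\alpha\}>0$. Then there is a constant $C>0$, independent of $t$ and $w_0$, such that for all $t>0$ $$\frac{\nu}{2}\|w_x(t)\|^2+E(t)+e^{-2\alpha t}\int_0^te^{2\alpha s}\|w_t(s)\|^2ds\le Ce^{-2\alpha t}\|w_0\|_1^2\,e^{C\|w_0\|^2},$$ where $$E(t)=\sum_{i=0}^1\Big((c_i+w_d)w^2(i,t)+\frac{1}{9c_i}w^4(i,t)\Big).$$
   Context: Notation: $(\cdot,\cdot)$ and $\|\cdot\|$ are the inner product and norm of $L^2(0,1)$; $\|\cdot\|_m$ is the norm of the Sobolev space $H^m(0,1)$; $\||f|\|:=\sqrt{\|f_x\|^2+f^2(0)+f^2(1)}$. Parameters: $\nu,\rho,\delta,c_0,c_1>0$ and $w_d\ge 0$ are constants. $C$ is a generic positive constant. Closed-loop system: for $x\in(0,1)$, $t>0$, $$w_t-\nu w_{xx}+ww_x+w_dw_x=\rho z_x,\qquad z_t+\delta z=w_x,$$ $w_x(0,t)=v_0(t)$, $w_x(1,t)=v_1(t)$, $w(x,0)=w_0(x)$, $z(x,0)=0$, so that $z(x,t)=\int_0^te^{-\delta(t-s)}w_x(x,s)\,ds$, with feedback laws $$v_0(t)=\tfrac1\nu\Big((c_0+w_d)w(0,t)+\tfrac{2}{9c_0}w^3(0,t)-\rho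 z(0,t)\Big),\qquad v_1(t)=-\tfrac1\nu\Big((c_1+w_d)w(1,t)+\tfrac{2}{9c_1}w^3(1,t)+\rho z(1,t)\Big).$$ Weak form: for all $\phi\in H^1(0,1)$, $$(w_t,\phi)+\nu(w_x,\phi_x)+w_d(w_x,\phi)+(ww_x,\phi)+\rho(z,\phi_x)+\sum_{i=0}^1\Big((c_i+w_d)w(i,t)+\tfrac{2}{9c_i}w^3(i,t)\Big)\phi(i)=0,\quad w(\cdot,0)=w_0.$$ Assumption (A1): $w_0\in H^3(0,1)$ and the compatibility conditions $w_{0x}(0)=v_0(0)$, $w_{0x}(1)=v_1(0)$, $w_{0xt}(0)=v_{0t}(0)$, $w_{0xt}(1)=v_{1t}(0)$ hold at $t=0$ (here $w_{0xt}(i)$ means $w_{xt}(i,0)$). Assumption (A2): for $w_0\in H^3(0,1)$ there is a unique weak solution $w$ and it satisfies, with a positive constant $C$, $\|w\|_2^2+\|w_t\|_1^2+\|z\|^2+\int_0^t(\||w(s)|\|^2+\|w_t(s)\|_2^2+\|z(s)\|^2)ds\le C\|w_0\|_3^2$. *)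

(* Defs.v *)
From HB Require Import structures.
From mathcomp Require Import all_boot all_order all_algebra.
From mathcomp Require Import all_classical all_reals all_analysis.
Set Implicit Arguments.
Unset Strict Implicit.
Unset Printing Implicit Defensive.
Import Order.TTheory GRing.Theory Num.Theory.
Import numFieldNormedType.Exports.
Local Open Scope ring_scope.
Local Open Scope classical_set_scope.

Section sobolev.
Context {R : realType}.
Local Notation mu := (@lebesgue_measure R).
Implicit Types f g : R -> R.

Definition L2 f : Prop :=
  measurable_fun (`]0, 1[ : set R) f /\
  mu.-integrable `]0, 1[ (fun x => ((f x) ^+ 2)%:E).

Definition inner f g : R := \int[mu]_(x in `]0, 1[) (f x * g x).

Definition L2norm f : R := Num.sqrt (inner f f).

Definition test_function f : Prop :=
  [/\ forall x, derivable f x 1, continuous (derive1 f) &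
      exists a b : R, [/\ 0 < a, b < 1 & forall x, ~~ (a <= x <= b) -> f x = 0]].

Definition weak_derivative f g : Prop :=
  forall phi, test_function phi -> inner f (derive1 phi) = - inner g phi.

(* f is the continuous representative on [0, 1] of an element of H^m(0, 1).
   In dimension one that representative is absolutely continuous, together
   with its derivatives of order < m, so that its weak derivatives are given
   almost everywhere by the pointwise derivatives (derive1 takes the value 0
   where the difference quotient diverges). Requiring these to be weak
   derivatives rules out functions such as Cantor's. *)
Definition sobolev (m : nat) f : Prop :=
  [/\ (0 < m)%N -> {within `[0, 1], continuous f},
      forall k, (k <= m)%N -> L2 (derive1n k f) &
      forall k, (k < m)%N -> weak_derivative (derive1n k f) (derive1n k.+1 f)].

Definition sobolev_norm (m : nat) f : R :=
  Num.sqrt (\sum_(k < m.+1) (L2norm (derive1n k f)) ^+ 2).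

(* boundary values of functions that are only considered inside ]0, 1[, such
   as the derivative of an element of H^2(0, 1) *)
Definition trace0 f : R := lim (f x @[x --> 0^'+]).
Definition trace1 f : R := lim (f x @[x --> 1^'-]).

End sobolev.

(* Space-time functions are written u t x, time first. *)
Section space_time.
Context {R : realType}.
Local Notation mu := (@lebesgue_measure R).
Implicit Types u : R -> R -> R.

Definition dx u (t x : R) : R := derive1 (u t) x.
Definition dt u (t x : R) : R := derive1 (fun s => u s x) t.

(* u belongs to L^2(0, T; H^m(0, 1)) for all T > 0; A is a set of full measure
   of times at which u t is in H^m(0, 1). *)
Definition L2loc_sobolev (m : nat) u : Prop :=
  exists A : set R,
    [/\ measurable A /\ A `<=` `]0, +oo[, mu (`]0, +oo[ `\` A) = 0%E,
        forall t, A t -> sobolev m (u t),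
        forall k, (k <= m)%N ->
          measurable_fun (A `*` `]0, 1[ : set (R * R))
            (fun p : R * R => derive1n k (u p.1) p.2) &
        forall T, 0 < T ->
          (\int[mu]_(t in A `&` `]0%R, T[)
              ((sobolev_norm m (u t)) ^+ 2)%:E < +oo)%E].

(* u belongs to C([0, +oo[; H^1(0, 1)) *)
Definition continuous_sobolev1 u : Prop :=
  [/\ forall t, 0 <= t -> sobolev 1 (u t),
      measurable_fun (`[0, +oo[ `*` `]0, 1[ : set (R * R))
        (fun p : R * R => dx u p.1 p.2) &
      forall t, 0 <= t -> forall k, (k <= 1)%N ->
        (fun s => L2norm (fun x => derive1n k (u s) x - derive1n k (u t) x))
          @ within `[0, +oo[ (nbhs t) --> (0 : R)].

(* dt u is the time derivative of u, in L^2(0, T; L^2(0, 1)) for all T > 0 *)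
Definition time_derivative_L2loc u : Prop :=
  [/\ measurable_fun (`]0, +oo[ `*` `]0, 1[ : set (R * R))
        (fun p : R * R => dt u p.1 p.2),
      forall T, 0 < T ->
        (\int[mu]_(t in `]0%R, T[) \int[mu]_(x in `]0%R, 1%R[)
            ((dt u t x) ^+ 2)%:E < +oo)%E &
      forall t, 0 <= t -> {ae mu, forall x, 0 < x < 1 ->
        u t x = u 0 x + \int[mu]_(s in `[0, t]) dt u s x}].

Definition right_derivative0 (g : R -> R) (d : R) : Prop :=
  (g h - g 0) / h @[h --> 0^'+] --> d.

Definition triple_norm (f : R -> R) : R :=
  Num.sqrt (L2norm (derive1 f) ^+ 2 + f 0 ^+ 2 + f 1 ^+ 2).

End space_time.

Section closed_loop.
Context {R : realType}.
Local Notation mu := (@lebesgue_measure R).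
Variables (nu rho delta c0 c1 wd : R).
Implicit Types w : R -> R -> R.

Definition memory (g : R -> R) (t : R) : R :=
  \int[mu]_(s in `[0, t]) (expR (- delta * (t - s)) * g s).

(* z, the solution of z_t + delta z = w_x, z(., 0) = 0 *)
Definition zof w (t x : R) : R := memory (fun s => dx w s x) t.

Definition flux (c a : R) : R := (c + wd) * a + 2 / (9 * c) * a ^+ 3.

(* In v0 and v1 the value of z at an endpoint is computed from the boundary
   value of w_x. *)
Definition v0 w (t : R) : R :=
  nu^-1 * (flux c0 (w t 0) - rho * memory (fun s => trace0 (dx w s)) t).
Definition v1 w (t : R) : R :=
  - nu^-1 * (flux c1 (w t 1) + rho * memory (fun s => trace1 (dx w s)) t).

Definition weak_form w (t : R) (phi : R -> R) : Prop :=
  inner (dt w t) phi + nu * inner (dx w t) (derive1 phi)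
  + wd * inner (dx w t) phi + inner (fun x => w t x * dx w t x) phi
  + rho * inner (zof w t) (derive1 phi)
  + flux c0 (w t 0) * phi 0 + flux c1 (w t 1) * phi 1 = 0.

Definition weak_solution (w0 : R -> R) w : Prop :=
  [/\ continuous_sobolev1 w, time_derivative_L2loc w,
      {ae mu, forall t, 0 < t ->
        forall phi, sobolev 1 phi -> weak_form w t phi} &
      forall x, 0 <= x <= 1 -> w 0 x = w0 x].

Definition assumption_A1 (w0 : R -> R) w : Prop :=
  [/\ sobolev 3 w0,
      trace0 (derive1 w0) = v0 w 0,
      trace1 (derive1 w0) = v1 w 0,
      exists d, right_derivative0 (fun t => trace0 (dx w t)) d /\
                right_derivative0 (v0 w) d &
      exists d, right_derivative0 (fun t => trace1 (dx w t)) d /\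
                right_derivative0 (v1 w) d].

Definition a_priori_bound (K : R) (w0 : R -> R) w (t : R) : Prop :=
  ((sobolev_norm 2 (w t) ^+ 2 + sobolev_norm 1 (dt w t) ^+ 2
    + L2norm (zof w t) ^+ 2)%:E
   + \int[mu]_(s in `[0%R, t])
       (triple_norm (w s) ^+ 2 + sobolev_norm 2 (dt w s) ^+ 2
        + L2norm (zof w s) ^+ 2)%:E
   <= (K * sobolev_norm 3 w0 ^+ 2)%:E)%E.

(* w, w_t in L^2(0, T; H^2(0, 1)) makes the norms in the bound meaningful for
   almost every t. The constant K may depend on w0. *)
Definition assumption_A2 (w0 : R -> R) w : Prop :=
  [/\ weak_solution w0 w,
      forall w', weak_solution w0 w' ->
        forall t x, 0 <= t -> 0 <= x <= 1 -> w' t x = w t x,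
      L2loc_sobolev 2 w, L2loc_sobolev 2 (dt w) &
      exists2 K, 0 < K &
        {ae mu, forall t, 0 < t -> a_priori_bound K w0 w t}].

Definition boundary_energy w (t : R) : R :=
  ((c0 + wd) * w t 0 ^+ 2 + (9 * c0)^-1 * w t 0 ^+ 4) +
  ((c1 + wd) * w t 1 ^+ 2 + (9 * c1)^-1 * w t 1 ^+ 4).

End closed_loop.

Definition min4 {R : realType} (a b c d : R) : R :=
  Num.min (Num.min a b) (Num.min c d).

(* Main.v *)
Require Import Defs.
From HB Require Import structures.
From mathcomp Require Import all_boot all_order all_algebra.
From mathcomp Require Import all_classical all_reals all_analysis.
From mathcomp Require Import measurable_realfun ring lra.
Set Implicit Arguments.
Unset Strict Implicit.
Unset Printing Implicit Defensive.
Import Order.TTheory GRing.Theory Num.Theory.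
Import numFieldNormedType.Exports.
Local Open Scope ring_scope.
Local Open Scope classical_set_scope.

(** Two energy identities, obtained by testing the weak form with [w] and with
    [w_t], are closed by Gronwall's lemma.

    Testing with [w], the cubic boundary feedback absorbs the convection term,
    since [(w w_x, w) = (w(1)^3 - w(0)^3) / 3] and
    [|b|^3 / 3 <= c b^2 / 2 + b^4 / (18 c)], while [rho (z, w_x)] equals
    [rho (z, z_t + delta z)] and so contributes [rho |z|^2] to the energy.  With
    the Poincare inequality [|w|^2 <= |w_x|^2 + w(0)^2 + w(1)^2], the weight
    [e^(2 alpha t)] costs less than what is dissipated, so that
    [e^(2 alpha t) (|w|^2 + rho |z|^2)] and the time integral of the weighted
    dissipation are both at most [|w0|^2] ([first_energy_estimate]).

    Testing with [w_t], the quantity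
    [e^(2 alpha t) (nu |w_x|^2 + E + 2 rho (z, w_x))] satisfies a differential
    inequality whose right-hand side is, up to the weight, at most a multiple of
    the dissipation of the first estimate plus the contribution [4 h |w_x|^2] of
    the term [w w_x], with [h = |w_x|^2 + w(0)^2 + w(1)^2]
    ([second_energy_estimate]).  As [h] is integrable in time with integral at
    most [|w0|^2 / beta], Gronwall's lemma yields the factor [e^(C |w0|^2)]
    ([energy_decay]).  Agmon's inequality bounds the quartic boundary terms at
    time 0 by a multiple of [|w0|_1^2 e^(|w0|^2)] ([initial_estimate]).

    These computations differentiate [|w|^2], [|w_x|^2], [|z|^2], [(z, w_x)] and
    powers of the boundary values in time, although the solution is only
    absolutely continuous in time.  The calculus used here works with curves in
    [L^2(0, 1)] that are primitives, in the weak sense, of integrable curves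
    ([acpath]); its product rule [acpath_inner] rests on a bisection argument
    ([nonincreasing_of_increments]): a function whose increments are at most a
    multiple of the square of those of a continuous monotone function is
    nonincreasing.  The same argument gives Gronwall's lemma, and constant curves
    give the scalar product rule [acM].

    That [w] and [w_x] are such curves comes from the given time derivative
    ([acpath_of_ae]) and from commuting the time derivative with the weak space
    derivative ([acpath_weak_derivative]).  Boundary values are continuous
    functionals of the pair [(w, w_x)] ([trace_left], [trace_right]), so they
    inherit absolute continuity ([ac_trace]); this uses that elements of [H^1]
    are primitives of their derivatives ([sobolev1_ac]). *)

(** * Integrable real functions and the space L^2(0, 1) *)

Section real_integrals.
Context d (T : measurableType d) (R : realType).
Variable mu : {measure set T -> \bar R}.
Implicit Types (D : set T) (f g : T -> R).

Definition rintegrable D f := mu.-integrable D (EFin \o f).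

Lemma ae_imply (P Q : T -> Prop) : {ae mu, forall x, P x} ->
  (forall x, P x -> Q x) -> {ae mu, forall x, Q x}.
Proof. by move=> aeP PQ; apply: filterS aeP. Qed.

Lemma ae_and (P Q : T -> Prop) : {ae mu, forall x, P x} ->
  {ae mu, forall x, Q x} -> {ae mu, forall x, P x /\ Q x}.
Proof. by move=> aeP aeQ; apply: filterI. Qed.

Lemma rintegrable_measurable D f : rintegrable D f -> measurable_fun D f.
Proof. by move=> /measurable_int /measurable_EFinP. Qed.

Lemma le_rintegrable D f g : measurable D -> measurable_fun D f ->
  (forall x, D x -> `|f x| <= g x) -> rintegrable D g -> rintegrable D f.
Proof.
move=> mD mf fg ig; apply: (@le_integrable _ _ _ mu D mD _ (EFin \o g)) => //.
  exact/measurable_EFinP.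
move=> x Dx /=; rewrite lee_fin; apply: le_trans (fg _ Dx) _; exact: ler_norm.
Qed.

Lemma rintegrableD D f g : measurable D -> rintegrable D f ->
  rintegrable D g -> rintegrable D (fun x => f x + g x).
Proof. by move=> mD intf intg; exact: (integrableD mD intf intg). Qed.

Lemma rintegrableB D f g : measurable D -> rintegrable D f ->
  rintegrable D g -> rintegrable D (fun x => f x - g x).
Proof. by move=> mD intf intg; exact: (integrableB mD intf intg). Qed.

Lemma rintegrableZ D k f : measurable D -> rintegrable D f ->
  rintegrable D (fun x => k * f x).
Proof. by move=> mD intf; exact: (integrableZl mD k intf). Qed.

Lemma rintegrable_norm D f : measurable D -> rintegrable D f ->
  rintegrable D (fun x => `|f x|).
Proof. by move=> mD intf; exact: (integrable_norm intf). Qed.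

Lemma rintegrableS D E f : measurable E -> measurable D -> E `<=` D ->
  rintegrable D f -> rintegrable E f.
Proof. by move=> mE mD ED; exact: (integrableS mD mE ED). Qed.

Lemma eq_rintegrable D f g : measurable D -> (forall x, D x -> f x = g x) ->
  rintegrable D f -> rintegrable D g.
Proof.
move=> mD fg; apply: eq_integrable => //= x /[!inE] Dx /=; by rewrite fg.
Qed.

Lemma rintegrable_cst D k : measurable D -> (mu D < +oo)%E ->
  rintegrable D (fun=> k).
Proof.
move=> mD Doo; apply: measurable_bounded_integrable => //.
by exists `|k|; split; [exact: num_real|move=> M kM x _; exact: ltW].
Qed.

Lemma Rintegral_ae_eq D f g : measurable D -> measurable_fun D f ->
  measurable_fun D g -> {ae mu, forall x, D x -> f x = g x} ->
  Rintegral mu D f = Rintegral mu D g.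
Proof.
move=> mD mf mg fg; congr fine; apply: ae_eq_integral => //.
- exact/measurable_EFinP.
- exact/measurable_EFinP.
- by apply: filterS fg => x fg Dx; rewrite fg.
Qed.

Lemma ae_rintegrable D f g : measurable D -> measurable_fun D g ->
  {ae mu, forall x, D x -> f x = g x} -> rintegrable D f -> rintegrable D g.
Proof.
move=> mD mg fg intf; have mf := rintegrable_measurable intf.
apply/integrableP; split; first exact/measurable_EFinP.
move/integrableP : intf => [_]; apply: le_lt_trans.
rewrite le_eqVlt; apply/orP; left; apply/eqP; apply: ge0_ae_eq_integral => //.
- by apply: measurableT_comp => //; exact/measurable_EFinP.
- by apply: measurableT_comp => //; exact/measurable_EFinP.
- by apply: filterS fg => x fg Dx /=; rewrite fg.
Qed.

(** The functions [f] and [min f g] are equal almost everywhere, and the second is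
    below [g] everywhere. *)
Lemma Rintegral_ae_le D f g : measurable D -> rintegrable D f ->
  rintegrable D g -> {ae mu, forall x, D x -> f x <= g x} ->
  Rintegral mu D f <= Rintegral mu D g.
Proof.
move=> mD intf intg fg.
have mf := rintegrable_measurable intf; have mg := rintegrable_measurable intg.
pose h x := Num.min (f x) (g x).
have mh : measurable_fun D h by exact: measurable_minr.
have fh : {ae mu, forall x, D x -> f x = h x}.
  by apply: filterS fg => x fg Dx; rewrite /h min_l // fg.
have inth := ae_rintegrable mD mh fh intf.
rewrite (Rintegral_ae_eq mD mf mh fh); apply: le_Rintegral => // x Dx.
by rewrite /h ge_min lexx orbT.
Qed.

Lemma EFin_Rintegral D f : measurable D -> rintegrable D f ->
  (\int[mu]_(x in D) (f x)%:E)%E = (Rintegral mu D f)%:E.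
Proof. by move=> mD intf; rewrite /Rintegral fineK //; exact: integrable_fin_num. Qed.

Lemma rintegrable_lty D f : measurable D -> measurable_fun D f ->
  (forall x, D x -> 0 <= f x) ->
  (\int[mu]_(x in D) (f x)%:E < +oo)%E -> rintegrable D f.
Proof.
move=> mD mf f0 foo; apply/integrableP; split; first exact/measurable_EFinP.
apply: le_lt_trans foo; rewrite le_eqVlt; apply/orP; left; apply/eqP.
apply: eq_integral => x /[!inE] Dx /=; by rewrite ger0_norm // f0.
Qed.

End real_integrals.
Arguments ae_imply {d T R mu P Q}.
Arguments ae_and {d T R mu P Q}.

Section L2_theory.
Context {R : realType}.
Local Notation mu := (@lebesgue_measure R).
Implicit Types f g h : R -> R.

Local Notation I := (`]0, 1[ : set R).

Lemma L2_sq f : L2 f -> rintegrable mu I (fun x => f x ^+ 2).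
Proof. by case. Qed.

Lemma L2_measurable f : L2 f -> measurable_fun I f.
Proof. by case. Qed.

Lemma L2_mul f g : L2 f -> L2 g -> rintegrable mu I (fun x => f x * g x).
Proof.
move=> f2 g2; apply: (@le_rintegrable _ _ _ mu I _ (fun x => f x ^+ 2 + g x ^+ 2)) => //.
- by apply: measurable_funM; exact: L2_measurable.
- move=> x _; rewrite ler_norml; apply/andP; split; nra.
- by apply: rintegrableD => //; exact: L2_sq.
Qed.

Lemma L2Z k f : L2 f -> L2 (fun x => k * f x).
Proof.
move=> f2; split; first by apply: measurable_funM => //; exact: L2_measurable.
apply: (@eq_rintegrable _ _ _ mu I (fun x => k ^+ 2 * f x ^+ 2)) => //.
  by move=> x _; rewrite exprMn.
by apply: rintegrableZ => //; exact: L2_sq.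
Qed.

Lemma L2D f g : L2 f -> L2 g -> L2 (fun x => f x + g x).
Proof.
move=> f2 g2; split; first by apply: measurable_funD; exact: L2_measurable.
apply: (@eq_rintegrable _ _ _ mu I (fun x => f x ^+ 2 + 2 * (f x * g x) + g x ^+ 2)) => //.
  by move=> x _; ring.
apply: rintegrableD => //; last exact: L2_sq.
apply: rintegrableD => //; first exact: L2_sq.
by apply: rintegrableZ => //; exact: L2_mul.
Qed.

Lemma L2B f g : L2 f -> L2 g -> L2 (fun x => f x - g x).
Proof.
move=> f2 g2; have -> : (fun x => f x - g x) = (fun x => f x + -1 * g x).
  by apply/funext => x; rewrite mulN1r.
by apply: L2D => //; exact: L2Z.
Qed.

Lemma mu_I : mu I = 1%:E.
Proof. by rewrite lebesgue_measure_itv /= lte_fin ltr01 oppr0 adde0. Qed.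

Lemma mu_I_lty : (mu I < +oo)%E.
Proof. by rewrite mu_I ltry. Qed.

Lemma fine_mu_I : fine (mu I) = 1.
Proof. by rewrite mu_I. Qed.

Lemma L2_cst (k : R) : L2 (fun=> k).
Proof.
split; first exact: measurable_cst.
by apply: rintegrable_cst => //; exact: mu_I_lty.
Qed.

Lemma L2_rintegrable f : L2 f -> rintegrable mu I f.
Proof.
move=> f2; apply: (eq_rintegrable _ _ (L2_mul f2 (L2_cst 1))) => //.
by move=> x _; rewrite mulr1.
Qed.

Lemma L2_bounded f g k : measurable_fun I f -> (forall x, I x -> `|f x| <= k) ->
  L2 g -> L2 (fun x => f x * g x).
Proof.
move=> mf fk g2.
split; first by apply: measurable_funM => //; exact: L2_measurable.
apply: (@le_rintegrable _ _ _ mu I _ (fun x => k ^+ 2 * g x ^+ 2)) => //.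
- by apply: measurable_funX; apply: measurable_funM => //; exact: L2_measurable.
- move=> x Ix; rewrite exprMn normrM !normrX; apply: ler_pM => //.
    by rewrite lerXn2r ?nnegrE // ?fk // (le_trans _ (fk _ Ix)).
  by rewrite real_normK ?num_real.
- by apply: rintegrableZ => //; exact: L2_sq.
Qed.

Lemma innerC f g : inner f g = inner g f.
Proof. by rewrite /inner; congr Rintegral; apply/funext => x; rewrite mulrC. Qed.

Lemma ae_inner f g h : L2 f -> L2 g -> L2 h ->
  {ae mu, forall x, I x -> f x = g x} -> inner f h = inner g h.
Proof.
move=> f2 g2 h2 fg; apply: Rintegral_ae_eq => //.
- by apply: measurable_funM => //; exact: L2_measurable.
- by apply: measurable_funM => //; exact: L2_measurable.
- by apply: (ae_imply fg) => x {}fg Ix; rewrite fg.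
Qed.

Lemma innerDl f g h : L2 f -> L2 g -> L2 h ->
  inner (fun x => f x + g x) h = inner f h + inner g h.
Proof.
move=> f2 g2 h2; rewrite /inner -RintegralD //; try exact: L2_mul.
by apply: eq_Rintegral => x _; rewrite mulrDl.
Qed.

Lemma innerBl f g h : L2 f -> L2 g -> L2 h ->
  inner (fun x => f x - g x) h = inner f h - inner g h.
Proof.
move=> f2 g2 h2; rewrite /inner -RintegralB //; try exact: L2_mul.
by apply: eq_Rintegral => x _; rewrite mulrBl.
Qed.

Lemma innerZl k f h : L2 f -> L2 h ->
  inner (fun x => k * f x) h = k * inner f h.
Proof.
move=> f2 h2; rewrite /inner -RintegralZl //; try exact: L2_mul.
by apply: eq_Rintegral => x _; rewrite mulrA.
Qed.

Lemma innerDr f g h : L2 f -> L2 g -> L2 h ->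
  inner h (fun x => f x + g x) = inner h f + inner h g.
Proof. by move=> f2 g2 h2; rewrite innerC innerDl // !(innerC h). Qed.

Lemma innerBr f g h : L2 f -> L2 g -> L2 h ->
  inner h (fun x => f x - g x) = inner h f - inner h g.
Proof. by move=> f2 g2 h2; rewrite innerC innerBl // !(innerC h). Qed.

Lemma innerZr k f h : L2 f -> L2 h ->
  inner h (fun x => k * f x) = k * inner h f.
Proof. by move=> f2 h2; rewrite innerC innerZl // (innerC h). Qed.

Lemma inner0l f : inner (fun=> 0) f = 0.
Proof.
rewrite /inner; under eq_Rintegral do rewrite mul0r.
by rewrite Rintegral_cst // mul0r.
Qed.

Lemma inner_ge0 f : 0 <= inner f f.
Proof. by apply: Rintegral_ge0 => x _; rewrite -expr2 sqr_ge0. Qed.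

Lemma L2normK f : L2norm f ^+ 2 = inner f f.
Proof. by rewrite /L2norm sqr_sqrtr // inner_ge0. Qed.

Lemma L2norm_ge0 f : 0 <= L2norm f.
Proof. exact: sqrtr_ge0. Qed.

(** The quadratic polynomial [a |-> |f - a g|^2] is nonnegative; when [g] has norm 0
    it is affine, and [a] is chosen to make it equal to -1 unless [(f, g) = 0]. *)
Lemma cauchy_schwarz f g : L2 f -> L2 g ->
  `|inner f g| <= L2norm f * L2norm g.
Proof.
move=> f2 g2; rewrite -(@ler_pXn2r _ 2) ?nnegrE ?mulr_ge0 ?L2norm_ge0 //.
rewrite exprMn !L2normK real_normK ?num_real //.
set p := inner f g; set F := inner f f; set G := inner g g.
have quad a : 0 <= F - 2 * a * p + a ^+ 2 * G.
  have := inner_ge0 (fun x => f x - a * g x).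
  rewrite innerBl ?innerBr ?innerZl ?innerZr //; try exact: L2Z.
  - by rewrite -/F -/G (innerC g f) -/p => H; apply: le_trans H _; lra.
  - by apply: L2B => //; exact: L2Z.
have F0 : 0 <= F by exact: inner_ge0.
have G0 : 0 <= G by exact: inner_ge0.
have [G00|Gn0] := eqVneq G 0.
  have [->|p0] := eqVneq p 0; first by rewrite expr0n /= mulr_ge0.
  (* this value of a makes the affine function of a equal to -1 *)
  have := quad ((F + 1) / (2 * p)).
  have -> : 2 * ((F + 1) / (2 * p)) * p = F + 1 by field.
  rewrite G00; lra.
have Gp : 0 < G by rewrite lt_neqAle eq_sym Gn0.
have := quad (p / G).
have -> : F - 2 * (p / G) * p + (p / G) ^+ 2 * G = (F * G - p ^+ 2) / G by field.
by rewrite pmulr_lge0 ?invr_gt0 // subr_ge0.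
Qed.

Lemma L2norm_cst (k : R) : L2norm (fun=> k) = `|k|.
Proof.
rewrite /L2norm /inner Rintegral_cst //.
by rewrite [fine _]fine_mu_I mulr1 -expr2 sqrtr_sqr.
Qed.

Lemma inner_cst (p q : R) : inner (fun=> p) (fun=> q) = p * q.
Proof. by rewrite /inner Rintegral_cst // [fine _]fine_mu_I mulr1. Qed.

Lemma le_L2norm f k : 0 <= k -> inner f f <= k ^+ 2 -> L2norm f <= k.
Proof.
by move=> k0 H; rewrite -(@ler_pXn2r _ 2) ?nnegrE ?L2norm_ge0 // L2normK.
Qed.

Lemma ler_L2normD f g : L2 f -> L2 g ->
  L2norm (fun x => f x + g x) <= L2norm f + L2norm g.
Proof.
move=> f2 g2; apply: le_L2norm; first by rewrite addr_ge0 ?L2norm_ge0.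
rewrite innerDl ?innerDr //; try exact: L2D.
rewrite sqrrD !L2normK (innerC g f).
by have := le_trans (ler_norm _) (cauchy_schwarz f2 g2); lra.
Qed.

Lemma eq_L2norm f g : (forall x, I x -> f x = g x) -> L2norm f = L2norm g.
Proof.
by move=> fg; rewrite /L2norm /inner; congr Num.sqrt; apply: eq_Rintegral => x;
  rewrite inE => Ix; rewrite fg.
Qed.

End L2_theory.

(** * Absolutely continuous functions on [0, T] *)

Section absolute_continuity.
Context {R : realType}.
Local Notation mu := (@lebesgue_measure R).
Implicit Types (F G f g M : R -> R) (T : R).

(** Cutting an interval at the point where [M] takes the mean of its two end values
    halves the bound on the increment of [Phi], because squares of increments
    of [M] are divided by four and there are two pieces; iterating, the bound
    tends to 0. *)
Lemma nonincreasing_of_increments (Phi M : R -> R) a b C : a <= b ->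
  {within `[a, b], continuous M} ->
  (forall s t, a <= s -> s <= t -> t <= b ->
     M s <= M t /\ Phi t - Phi s <= C * (M t - M s) ^+ 2) ->
  Phi b <= Phi a.
Proof.
move=> ab cM H.
have bisect n s t : a <= s -> s <= t -> t <= b ->
    Phi t - Phi s <= (C * (M t - M s) ^+ 2) / 2 ^+ n.
  elim: n s t => [|n IHn] s t as_ st tb.
    by rewrite expr0 divr1; exact: (H s t as_ st tb).2.
  have [Mst _] := H s t as_ st tb.
  (* c halves the increment of M, not the interval *)
  have [c cst Mc] : exists2 c, c \in `[s, t]%R & M c = (M s + M t) / 2.
    apply: IVT => //.
      apply: continuous_subspaceW cM => x /=; rewrite !in_itv /=.
      by move=> /andP[sx xt]; rewrite (le_trans as_) // (le_trans xt).
    by rewrite min_l // max_r //; apply/andP; split; lra.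
  move: cst; rewrite in_itv /= => /andP[sc ct].
  have := IHn s c as_ sc (le_trans ct tb).
  have := IHn c t (le_trans as_ sc) ct tb.
  rewrite Mc => H1 H2.
  have -> : Phi t - Phi s = (Phi t - Phi c) + (Phi c - Phi s) by ring.
  apply: le_trans (lerD H1 H2) _; rewrite le_eqVlt; apply/orP; left; apply/eqP.
  have n0 : 2 ^+ n != 0 :> R by rewrite expf_neq0.
  by rewrite [2 ^+ n.+1]exprS; field.
rewrite -subr_le0 leNgt; apply/negP => x0.
set x := Phi b - Phi a in x0; set K := C * (M b - M a) ^+ 2.
(* the bound of order n decays faster than 1/n *)
have Kx n : x * n%:R <= K.
  have := bisect n a b (lexx a) ab (lexx b); rewrite -/x -/K.
  rewrite ler_pdivlMr ?exprn_gt0 // => xK; apply: le_trans xK.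
  by rewrite ler_pM2l // -natrX ler_nat ltnW // ltn_expl.
have := Kx (Num.truncn (K / x)).+1.
by rewrite leNgt mulrC -ltr_pdivrMr // truncnS_gt.
Qed.

(** [F] is absolutely continuous on [[0, T]] with derivative [f], in the form of the
    fundamental theorem of calculus.  The derivative is only meaningful almost
    everywhere. *)
Definition ac T F f := rintegrable mu `[0, T] f /\
  forall t : R, 0 <= t <= T -> F t = F 0 + \int[mu]_(s in `[0, t]) f s.

Lemma subset_itv0 (s t T : R) : 0 <= s -> t <= T -> `]s, t] `<=` `[0, T].
Proof.
move=> s0 tT x /=; rewrite !in_itv /= => /andP[sx xt].
by rewrite (le_trans s0 (ltW sx)) (le_trans xt).
Qed.

Lemma ac_rintegrable T F f s t : ac T F f -> 0 <= s -> t <= T ->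
  rintegrable mu `]s, t] f.
Proof.
by move=> [intf _] s0 tT; apply: rintegrableS intf => //; exact: subset_itv0.
Qed.

Lemma ac_increment T F f s t : ac T F f -> 0 <= s -> s <= t -> t <= T ->
  F t - F s = \int[mu]_(r in `]s, t]) f r.
Proof.
move=> [intf HF] s0 st tT.
rewrite HF ?(le_trans s0 st) // (HF s) ?s0 ?(le_trans st tT) //.
rewrite -(@Rintegral_itvB _ f (BLeft 0) (BRight t) s).
- by ring.
- by apply: rintegrableS intf => //; apply: subset_itvl; rewrite bnd_simp.
- by rewrite bnd_simp.
- by rewrite bnd_simp.
Qed.

Lemma ac_continuous T F f : 0 <= T -> ac T F f ->
  {within `[0, T], continuous F}.
Proof.
move=> T0 [intf HF].
have cP := parameterized_integral_continuous T0 intf.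
have cG : {within `[0, T], continuous
    (fun x => F 0 + parameterized_integral mu 0 x f)}.
  move=> x; apply: cvgD; first exact: cvg_cst.
  exact: cP.
apply: (subspace_eq_continuous _ cG) => x /[!inE] /=.
by rewrite in_itv /= => xT; rewrite [RHS]HF.
Qed.

Lemma acS T T' F f : T' <= T -> ac T F f -> ac T' F f.
Proof.
move=> T'T [intf HF]; split.
  by apply: rintegrableS intf => //; apply: subset_itvl; rewrite bnd_simp.
by move=> t /andP[t0 tT]; apply: HF; rewrite t0 (le_trans tT).
Qed.

Lemma ac_sub T F f t : t <= T -> ac T F f -> rintegrable mu `[0, t] f.
Proof. by move=> tT /(acS tT) []. Qed.

Lemma acD T F f G g : ac T F f -> ac T G g ->
  ac T (fun t => F t + G t) (fun t => f t + g t).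
Proof.
move=> HF HG; split; first by apply: rintegrableD => //; [case: HF|case: HG].
move=> t t0T; rewrite RintegralD //.
- by rewrite HF.2 // HG.2 //; ring.
- by apply: ac_sub HF; case/andP: t0T.
- by apply: ac_sub HG; case/andP: t0T.
Qed.

Lemma acZ T F f k : ac T F f -> ac T (fun t => k * F t) (fun t => k * f t).
Proof.
move=> HF; split; first by apply: rintegrableZ => //; case: HF.
move=> t t0T; rewrite RintegralZl //.
- by rewrite HF.2 // mulrDr.
- by apply: ac_sub HF; case/andP: t0T.
Qed.

Lemma acB T F f G g : ac T F f -> ac T G g ->
  ac T (fun t => F t - G t) (fun t => f t - g t).
Proof.
move=> HF /(acZ (-1)) HG; have := acD HF HG.
by congr ac; apply/funext => t; rewrite mulN1r.
Qed.

Lemma eq_ac T F f G g : ac T F f -> (forall t : R, 0 <= t <= T -> F t = G t) ->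
  (forall t : R, 0 <= t <= T -> f t = g t) -> ac T G g.
Proof.
move=> [intf HF] FG fg; split.
  apply: (eq_rintegrable _ _ intf) => //.
move=> t t0T; have /andP[t0 tT] := t0T.
rewrite -!FG ?lexx ?(le_trans t0 tT) // HF //; congr (_ + _).
apply: eq_Rintegral => x; rewrite inE /= in_itv /= => /andP[x0 xt].
by rewrite fg // x0 (le_trans xt).
Qed.

(** Comparison of two functions through their derivatives: this is how differential
    inequalities that hold almost everywhere are integrated. *)
Lemma ac_le T F f G g : 0 <= T -> ac T F f -> ac T G g -> F 0 <= G 0 ->
  {ae mu, forall t : R, 0 <= t <= T -> f t <= g t} -> F T <= G T.
Proof.
move=> T0 [intf HF] [intg HG] FG0 fg.
rewrite HF ?T0 ?lexx // HG ?T0 ?lexx //; apply: lerD => //.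
by apply: Rintegral_ae_le => //; apply: (ae_imply fg)=> x {}fg /=; rewrite in_itv.
Qed.

Lemma ac_cst T k : ac T (fun=> k) (fun=> 0).
Proof.
split; first exact: integrable0.
by move=> t _; rewrite Rintegral_cst // mul0r addr0.
Qed.

Lemma ac_primitive T f k : 0 <= T -> rintegrable mu `[0, T] f ->
  ac T (fun t => k + \int[mu]_(s in `[0, t]) f s) f.
Proof.
by move=> T0 intf; split=> // t t0T; rewrite set_itv1 Rintegral_set1 addr0.
Qed.

Lemma ac_bounded T F f : 0 <= T -> ac T F f ->
  exists K, 0 <= K /\ forall t : R, 0 <= t <= T -> `|F t| <= K.
Proof.
move=> T0 HF; have [intf _] := HF.
exists (`|F 0| + \int[mu]_(s in `[0, T]) `|f s|); split.
  by rewrite addr_ge0 // Rintegral_ge0.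
move=> t t0T; have /andP[t0 tT] := t0T; rewrite HF.2 //.
apply: le_trans (ler_normD _ _) _; apply: lerD => //.
have intft : rintegrable mu `[0, t] f by exact: ac_sub HF.
apply: le_trans (le_normr_Rintegral _ _) _ => //.
have := Rintegral_itvB (rintegrable_norm _ intf) _ tT.
rewrite bnd_simp => /(_ _ t0) => H; rewrite -subr_ge0 H //.
exact: Rintegral_ge0.
Qed.

End absolute_continuity.

(** * Absolutely continuous curves in L^2(0, 1) *)

Section paths.
Context {R : realType}.
Local Notation mu := (@lebesgue_measure R).
Implicit Types (F G f g : R -> R) (T : R) (a b : R -> R -> R).

(** Curves [a] in [L^2(0, 1)] that are absolutely continuous with derivative [a'].
    The increment formula is only required after pairing with a fixed function
    of [L^2], which avoids vector-valued integrals and asks for the measurability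
    of scalar functions of time only. *)
Definition acpath T a a' :=
  [/\ forall t : R, 0 <= t <= T -> L2 (a t),
      forall t : R, 0 <= t <= T -> L2 (a' t),
      rintegrable mu `[0, T] (fun t => L2norm (a' t)) &
      forall f, L2 f -> ac T (fun t => inner (a t) f) (fun t => inner (a' t) f)].

(** The distance travelled up to time [t]: the continuous monotone function
    that controls all increments of the curve. *)
Definition speed (a' : R -> R -> R) t : R :=
  0 + \int[mu]_(s in `[0, t]) L2norm (a' s).

Lemma ac_speed T a a' : 0 <= T -> acpath T a a' ->
  ac T (speed a') (fun t => L2norm (a' t)).
Proof. by move=> T0 [_ _ inta _]; exact: ac_primitive. Qed.

(** The increment [d] of the curve is paired with itself:
    [|d|^2] is the integral of [(a', d)], hence at most [|d|] times the integral
    of [|a'|]. *)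
Lemma acpath_dist T a a' s t : acpath T a a' ->
  0 <= s -> s <= t -> t <= T ->
  L2norm (fun x => a t x - a s x) <= speed a' t - speed a' s.
Proof.
move=> Ha s0 st tT; have [La La' inta ipa] := Ha.
have T0 : 0 <= T by rewrite (le_trans s0) // (le_trans st).
have sT : 0 <= s <= T by rewrite s0 (le_trans st).
have t0T : 0 <= t <= T by rewrite tT (le_trans s0).
set d := fun x => a t x - a s x.
have Ld : L2 d by apply: L2B; exact: La.
have HV := ac_speed T0 Ha.
have inta' := ac_rintegrable HV s0 tT.
have step : L2norm d ^+ 2 <= L2norm d * (speed a' t - speed a' s).
  rewrite L2normK {1}/d innerBl //; try exact: La.
  rewrite (ac_increment (ipa _ Ld) s0 st tT).
  rewrite (ac_increment HV s0 st tT) -RintegralZl //.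
  apply: le_Rintegral => //.
  - exact: ac_rintegrable (ipa _ Ld) s0 tT.
  - exact: rintegrableZ.
  - move=> r /(subset_itv0 s0 tT) /=; rewrite in_itv /= => rT.
    rewrite mulrC; apply: le_trans (ler_norm _) _; apply: cauchy_schwarz => //.
    exact: La'.
have [->|d0] := eqVneq (L2norm d) 0.
  rewrite (ac_increment HV s0 st tT).
  by apply: Rintegral_ge0 => r _; exact: L2norm_ge0.
have dp : 0 < L2norm d by rewrite lt_neqAle eq_sym d0 L2norm_ge0.
by move: step; rewrite expr2 ler_pM2l.
Qed.

Lemma acpath_speed T a a' : 0 <= T -> acpath T a a' ->
  exists V : R -> R, ac T V (fun t => L2norm (a' t)) /\
    forall s t, 0 <= s -> s <= t -> t <= T ->
      L2norm (fun x => a t x - a s x) <= V t - V s.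
Proof.
move=> T0 Ha; exists (speed a'); split; first exact: (ac_speed T0 Ha).
by move=> s t s0 st tT; exact: acpath_dist Ha s0 st tT.
Qed.

Lemma acpath_bounded T a a' : 0 <= T -> acpath T a a' ->
  exists K, 0 <= K /\ forall t : R, 0 <= t <= T -> L2norm (a t) <= K.
Proof.
move=> T0 Ha; have [K [K0 HK]] := ac_bounded T0 (ac_speed T0 Ha).
have [La _ _ _] := Ha.
have L0 : L2 (a 0) by apply: La; rewrite lexx.
exists (L2norm (a 0) + (K + K)); split.
  by rewrite addr_ge0 ?addr_ge0 // L2norm_ge0.
move=> t t0T; have /andP[t0 tT] := t0T.
have -> : L2norm (a t) = L2norm (fun x => a 0 x + (a t x - a 0 x)).
  by congr L2norm; apply/funext => x; rewrite addrC subrK.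
apply: le_trans (ler_L2normD L0 (L2B (La _ t0T) L0)) _.
rewrite lerD2l; apply: le_trans (acpath_dist Ha (lexx 0) t0 tT) _.
have := HK _ t0T; have := HK 0; rewrite lexx => /(_ T0).
by rewrite !ler_norml => /andP[? ?] /andP[? ?]; lra.
Qed.

Definition grid_floor (n : nat) (s : R) : R :=
  (Num.truncn (s * n.+1%:R))%:R / n.+1%:R.

Lemma grid_floor_itv n s : 0 <= s -> 0 <= grid_floor n s <= s.
Proof.
move=> s0; rewrite /grid_floor divr_ge0 //=.
by rewrite ler_pdivrMr // truncn_le mulr_ge0.
Qed.

(** Freezing [b] at the points of a grid gives functions that are measurable on
    each cell, and these converge because [b] is continuous. *)
Lemma acpath_measurable T a a' b b' : 0 <= T -> acpath T a a' ->
  acpath T b b' -> measurable_fun `[0, T] (fun s => inner (a' s) (b s)).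
Proof.
move=> T0 Ha Hb; have [_ La' inta ipa] := Ha; have [Lb _ _ _] := Hb.
apply: (@measurable_fun_cvg _ _ _ _ (fun n s => inner (a' s) (b (grid_floor n s)))).
  move=> n; pose E (k : nat) := `[0, T] `&` `[(k%:R / n.+1%:R : R), k.+1%:R / n.+1%:R[.
  have mE k : measurable (E k : set (measurableTypeR R)) by exact: measurableI.
  have -> : (`[0, T] : set R) = \bigcup_k E k.
    apply/seteqP; split => [x xT|x [k _ []] //]; exists (Num.truncn (x * n.+1%:R)) => //.
    have x0 : 0 <= x by move: xT; rewrite /= in_itv /= => /andP[].
    split=> //=; rewrite in_itv /= (andP (grid_floor_itv n x0)).2 /=.
    by rewrite ltr_pdivlMr // truncnS_gt.
  apply/(measurable_fun_bigcup _ mE) => k.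
  have [/eqP E0|/set0P[y [yT yk]]] := boolP (E k == set0).
    by rewrite E0; exact: measurable_fun_set0.
  have kT : 0 <= (k%:R / n.+1%:R : R) <= T.
    rewrite divr_ge0 //=; move: yT yk; rewrite /= !in_itv /= => /andP[_ yT] /andP[ky _].
    exact: le_trans yT.
  have [intk _] := ipa _ (Lb _ kT).
  apply: (eq_measurable_fun (fun s => inner (a' s) (b (k%:R / n.+1%:R)))).
    move=> s; rewrite inE => -[_ /=]; rewrite in_itv /= => /andP[ks sk].
    congr inner; congr b; rewrite /grid_floor; congr (_%:R / _); apply/esym/truncn_def.
    by rewrite -ler_pdivrMr // ks /= -ltr_pdivlMr.
  by apply: measurable_funS (rintegrable_measurable intk) => // x [].
move=> s sT; have s0T : 0 <= s <= T by move: sT; rewrite /= in_itv.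
have /andP[s0 sT'] := s0T.
have cM := ac_continuous T0 (ac_speed T0 Hb).
apply/cvgrPdist_lt => e e0.
have e'0 : 0 < e / (L2norm (a' s) + 1).
  by rewrite divr_gt0 // ltr_wpDl // L2norm_ge0.
have : \forall y \near within `[0, T] (nbhs s), `|speed b' s - speed b' y| < e / (L2norm (a' s) + 1).
  have := cM s; rewrite /continuous_at /= nbhs_subspace_in //= => /cvgrPdist_lt; exact.
rewrite /within /= => -[dl /= dl0 Hdl].
near=> n.
have /andP[g0 gs] := grid_floor_itv n s0.
have gT : 0 <= grid_floor n s <= T by rewrite g0 (le_trans gs).
have := Hdl (grid_floor n s); rewrite /ball_ /= => Hn.
have /Hn {}Hn : `|s - grid_floor n s| < dl.
  rewrite ger0_norm ?subr_ge0 //.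
  have : s < grid_floor n s + n.+1%:R^-1.
    rewrite /grid_floor -[X in _ + X]mul1r -mulrDl natr1 ltr_pdivlMr //.
    exact: truncnS_gt.
  have : n.+1%:R^-1 < dl.
    near: n; exact: near_infty_natSinv_lt (PosNum dl0).
  by move=> A B; rewrite ltrBlDl; apply: lt_trans B _; rewrite ltrD2l.
have {}Hn : `|speed b' s - speed b' (grid_floor n s)| < e / (L2norm (a' s) + 1).
  by apply: Hn; rewrite in_itv.
rewrite -innerBr //; try exact: Lb; try exact: La'.
apply: le_lt_trans (cauchy_schwarz (La' _ s0T) (L2B (Lb _ s0T) (Lb _ gT))) _.
have Hd := acpath_dist Hb g0 gs sT'.
have Hd' := le_lt_trans (le_trans Hd (ler_norm _)) Hn.
apply: le_lt_trans (_ : _ <= (L2norm (a' s) + 1) * L2norm (fun x => b s x - b (grid_floor n s) x)) _.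
  by rewrite ler_wpM2r ?L2norm_ge0 // lerDl.
by rewrite mulrC -ltr_pdivlMr // ltr_wpDl // L2norm_ge0.
Unshelve. all: by end_near. Qed.

Lemma acpath_rintegrable T a a' b b' : 0 <= T -> acpath T a a' ->
  acpath T b b' -> rintegrable mu `[0, T] (fun s => inner (a' s) (b s)).
Proof.
move=> T0 Ha Hb; have [K [K0 HK]] := acpath_bounded T0 Hb.
have [_ La' inta ipa] := Ha; have [Lb _ _ _] := Hb.
apply: (@le_rintegrable _ _ _ mu _ _ (fun s => K * L2norm (a' s))) => //.
- exact: acpath_measurable Ha Hb.
- move=> s sT; have s0T : 0 <= s <= T by move: sT; rewrite /= in_itv.
  apply: le_trans (cauchy_schwarz (La' _ s0T) (Lb _ s0T)) _.
  by rewrite mulrC ler_wpM2r ?L2norm_ge0 // HK.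
- exact: rintegrableZ.
Qed.

(** The increment of [(a, b)] over [[s, t]] minus the integral of
    [(a', b) + (a, b')] is the integral of [(a'(r), b(t) - b(r)) + (a(s) - a(r), b'(r))],
    which is of second order in the distances travelled by [a] and [b]. *)
Let acpath_inner_le T a a' b b' : 0 <= T -> acpath T a a' -> acpath T b b' ->
  inner (a T) (b T) - inner (a 0) (b 0) <=
  \int[mu]_(s in `[0, T]) (inner (a' s) (b s) + inner (a s) (b' s)).
Proof.
move=> T0 Ha Hb; have [La La' inta ipa] := Ha; have [Lb Lb' intb ipb] := Hb.
pose g s := inner (a' s) (b s) + inner (a s) (b' s).
have intg : rintegrable mu `[0, T] g.
  apply: rintegrableD => //; first exact: acpath_rintegrable Ha Hb.
  have := acpath_rintegrable T0 Hb Ha; congr rintegrable.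
  by apply/funext => s; rewrite innerC.
have Hg := ac_primitive 0 T0 intg.
pose G t := 0 + \int[mu]_(s in `[0, t]) g s.
pose Phi t := inner (a t) (b t) - G t.
have [A [VA distA]] := acpath_speed T0 Ha.
have [B [VB distB]] := acpath_speed T0 Hb.
have VAB := acD VA VB.
suff : Phi T <= Phi 0.
  by rewrite /Phi /G /g set_itv1 Rintegral_set1; lra.
apply: (@nonincreasing_of_increments _ Phi (fun t => A t + B t) _ _ 1 T0) => //.
  exact: ac_continuous VAB.
move=> s t s0 st tT.
have s0T : 0 <= s <= T by rewrite s0 (le_trans st).
have t0T : 0 <= t <= T by rewrite tT (le_trans s0).
have monoA : 0 <= A t - A s.
  exact: le_trans (L2norm_ge0 _) (distA _ _ s0 st tT).
have monoB : 0 <= B t - B s.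
  exact: le_trans (L2norm_ge0 _) (distB _ _ s0 st tT).
split; first by rewrite -subr_ge0 opprD addrACA addr_ge0.
rewrite mul1r.
have HG : G t - G s = \int[mu]_(r in `]s, t]) g r by exact: ac_increment Hg s0 st tT.
have HA := ac_increment (ipa _ (Lb _ t0T)) s0 st tT.
have HB := ac_increment (ipb _ (La _ s0T)) s0 st tT.
have intA := ac_rintegrable (ipa _ (Lb _ t0T)) s0 tT.
have intB := ac_rintegrable (ipb _ (La _ s0T)) s0 tT.
have intg' := ac_rintegrable Hg s0 tT.
have -> : Phi t - Phi s = \int[mu]_(r in `]s, t])
    ((inner (a' r) (b t) + inner (b' r) (a s)) - g r).
  rewrite RintegralB //; last exact: rintegrableD.
  rewrite -HG RintegralD // -HA -HB.
  by rewrite /Phi (innerC (b t)) (innerC (b s)); ring.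
have [DA eDA] : exists DA, DA = A t - A s by eexists.
have [DB eDB] : exists DB, DB = B t - B s by eexists.
have intV := ac_rintegrable VA s0 tT; have intW := ac_rintegrable VB s0 tT.
apply: (@le_trans _ _ (\int[mu]_(r in `]s, t]) (DB * L2norm (a' r) + DA * L2norm (b' r)))).
  apply: le_Rintegral => //.
  - by apply: rintegrableB => //; exact: rintegrableD.
  - by apply: rintegrableD => //; exact: rintegrableZ.
  move=> r rst; have := subset_itv0 s0 tT rst; rewrite /= in_itv /= => r0T.
  move: rst; rewrite /= in_itv /= => /andP[sr rt].
  have sr' := ltW sr; have r0 : 0 <= r by exact: le_trans sr'.
  have rT : r <= T by exact: le_trans tT.
  have -> : inner (a' r) (b t) + inner (b' r) (a s) - g r =
      inner (a' r) (fun x => b t x - b r x) - inner (b' r) (fun x => a r x - a s x).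
    rewrite !innerBr //; try exact: La; try exact: Lb; try exact: La'; try exact: Lb'.
    by rewrite /g (innerC (a r)); ring.
  apply: le_trans (ler_norm _) _; apply: le_trans (ler_normB _ _) _.
  apply: lerD.
    apply: le_trans (cauchy_schwarz (La' _ r0T) (L2B (Lb _ t0T) (Lb _ r0T))) _.
    rewrite mulrC; apply: ler_wpM2r; first exact: L2norm_ge0.
    apply: le_trans (distB _ _ r0 rt tT) _.
    by rewrite eDB lerD2l lerN2 -subr_ge0; exact: le_trans (L2norm_ge0 _) (distB _ _ s0 sr' rT).
  apply: le_trans (cauchy_schwarz (Lb' _ r0T) (L2B (La _ r0T) (La _ s0T))) _.
  rewrite mulrC; apply: ler_wpM2r; first exact: L2norm_ge0.
  apply: le_trans (distA _ _ s0 sr' rT) _.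
  by rewrite eDA lerD2r -subr_ge0; exact: le_trans (L2norm_ge0 _) (distA _ _ r0 rt tT).
rewrite RintegralD //; try exact: rintegrableZ.
rewrite !RintegralZl // -(ac_increment VA s0 st tT) -(ac_increment VB s0 st tT).
rewrite -eDA -eDB.
have -> : A t + B t - (A s + B s) = DA + DB.
  by rewrite eDA eDB; ring.
have -> : (DA + DB) ^+ 2 = DB * DA + DA * DB + (DA ^+ 2 + DB ^+ 2) by ring.
by rewrite lerDl addr_ge0 // sqr_ge0.
Qed.

Lemma acpathS T T' a a' : T' <= T -> acpath T a a' -> acpath T' a a'.
Proof.
move=> TT [La La' inta ipa]; split.
- by move=> t /andP[t0 tT]; apply: La; rewrite t0 (le_trans tT).
- by move=> t /andP[t0 tT]; apply: La'; rewrite t0 (le_trans tT).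
- by apply: rintegrableS inta => //; apply: subset_itvl; rewrite bnd_simp.
- by move=> f Lf; apply: acS TT _; exact: ipa.
Qed.

Lemma acpathZ T k a a' : acpath T a a' ->
  acpath T (fun t x => k * a t x) (fun t x => k * a' t x).
Proof.
move=> [La La' inta ipa]; split.
- by move=> t t0T; apply: L2Z; exact: La.
- by move=> t t0T; apply: L2Z; exact: La'.
- apply: (eq_rintegrable _ _ (rintegrableZ `|k| _ inta)) => //.
  move=> t /=; rewrite in_itv /= => t0T.
  apply/eqP; rewrite -(@eqrXn2 _ 2) ?mulr_ge0 ?L2norm_ge0 // exprMn !L2normK.
  rewrite real_normK ?num_real // innerZl ?innerZr ?mulrA -?expr2 //; try exact: La'.
  by apply: L2Z; exact: La'.
- move=> f Lf; apply: (eq_ac (acZ k (ipa _ Lf))) => t t0T.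
    by rewrite innerZl //; exact: La.
  by rewrite innerZl //; exact: La'.
Qed.

(** Changing the sign of [a] turns the one-sided inequality into the other one. *)
Lemma acpath_inner T a a' b b' : 0 <= T -> acpath T a a' -> acpath T b b' ->
  ac T (fun t => inner (a t) (b t))
       (fun t => inner (a' t) (b t) + inner (a t) (b' t)).
Proof.
move=> T0 Ha Hb; split.
  apply: rintegrableD => //; first exact: acpath_rintegrable Ha Hb.
  have := acpath_rintegrable T0 Hb Ha; congr rintegrable.
  by apply/funext => s; rewrite innerC.
move=> t /andP[t0 tT].
have Ha' := acpathS tT Ha; have Hb' := acpathS tT Hb.
have [La La' _ _] := Ha'; have [Lb Lb' _ _] := Hb'.
have t0t : 0 <= t <= t by rewrite t0 lexx.
have o0t : 0 <= (0 : R) <= t by rewrite t0 lexx.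
have H1 := acpath_inner_le t0 Ha' Hb'.
have H2 := acpath_inner_le t0 (acpathZ (-1) Ha') Hb'.
rewrite !innerZl // in H2; try exact: La; try exact: Lb.
have e : \int[mu]_(s in `[0, t]) (inner (fun x => -1 * a' s x) (b s) + inner (fun x => -1 * a s x) (b' s)) =
    -1 * \int[mu]_(s in `[0, t]) (inner (a' s) (b s) + inner (a s) (b' s)).
  rewrite -RintegralZl //.
    apply: eq_Rintegral => s; rewrite inE /= in_itv /= => s0t.
    by rewrite mulrDr !innerZl //; auto.
  apply: rintegrableD => //; first exact: acpath_rintegrable Ha' Hb'.
  have := acpath_rintegrable t0 Hb' Ha'; congr rintegrable.
  by apply/funext => s; rewrite innerC.
move: H1 H2; rewrite e; move: (inner (a t) (b t)) (inner (a 0) (b 0)).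
by move: (Rintegral _ _ _) => r p q; lra.
Qed.

(** A scalar function of time is a curve of functions that are constant in
    space, since [(0, 1)] has measure 1; the scalar product rule follows from
    the one for curves. *)
Lemma acpath_scalar T F f : ac T F f ->
  acpath T (fun t _ => F t) (fun t _ => f t).
Proof.
move=> HF; split.
- by move=> t _; exact: L2_cst.
- by move=> t _; exact: L2_cst.
- have [intf _] := HF; apply: (eq_rintegrable _ _ (rintegrable_norm _ intf)) => //.
  by move=> t _; rewrite L2norm_cst.
- move=> g Lg.
  have inner_cstl k : inner (fun=> k) g = inner (fun=> 1) g * k.
    have -> : (fun _ : R => k) = (fun=> k * 1) by apply/funext => x; rewrite mulr1.
    by rewrite innerZl //; [rewrite mulrC|exact: L2_cst].
  by apply: (eq_ac (acZ (inner (fun=> 1) g) HF)) => t t0T; rewrite -inner_cstl.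
Qed.

Lemma acM T F f G g : 0 <= T -> ac T F f -> ac T G g ->
  ac T (fun t => F t * G t) (fun t => f t * G t + F t * g t).
Proof.
move=> T0 /acpath_scalar HF /acpath_scalar HG.
apply: (eq_ac (acpath_inner T0 HF HG)) => t _; by rewrite !inner_cst.
Qed.

(** With [P] the right-hand side of the hypothesis and [H] the primitive of [h], the
    increments of [P] are at most [P(t)] times those of [H], so the increments of
    [P e^(-H)] are at most [P(T)] times the square of those of [H]. *)
Lemma gronwall T (h y : R -> R) k : 0 <= T ->
  rintegrable mu `[0, T] h -> rintegrable mu `[0, T] (fun s => h s * y s) ->
  (forall t : R, 0 <= t <= T -> 0 <= h t /\ 0 <= y t) ->
  (forall t : R, 0 <= t <= T -> y t <= k + \int[mu]_(s in `[0, t]) (h s * y s)) ->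
  y T <= k * expR (\int[mu]_(s in `[0, T]) h s).
Proof.
move=> T0 inth inthy hy0 Hy.
have Hh := ac_primitive 0 T0 inth; have Hhy := ac_primitive k T0 inthy.
set H := fun t => 0 + _ in Hh; set P' := fun t => k + _ in Hhy.
have incrH s t : 0 <= s -> s <= t -> t <= T -> 0 <= H t - H s.
  move=> s0 st tT; rewrite (ac_increment Hh s0 st tT); apply: Rintegral_ge0 => r.
  by move=> /(subset_itv0 s0 tT); rewrite /= in_itv /= => /hy0[].
have incrP s t : 0 <= s -> s <= t -> t <= T -> 0 <= P' t - P' s.
  move=> s0 st tT; rewrite (ac_increment Hhy s0 st tT); apply: Rintegral_ge0 => r.
  by move=> /(subset_itv0 s0 tT); rewrite /= in_itv /= => /hy0[? ?]; rewrite mulr_ge0.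
have P0 : 0 <= P' 0.
  have o0 : 0 <= (0 : R) <= T by rewrite lexx.
  by apply: le_trans (Hy _ o0); case: (hy0 _ o0).
suff : P' T * expR (- H T) <= P' 0 * expR (- H 0).
  rewrite {2}/H {2}/P' set_itv1 !Rintegral_set1 !addr0 oppr0 expR0 mulr1.
  rewrite expRN ler_pdivrMr ?expR_gt0 // /H add0r; apply: le_trans.
  by apply: Hy; rewrite T0 lexx.
apply: (@nonincreasing_of_increments _ (fun t => P' t * expR (- H t)) H _ _ (P' T)) => //.
  exact: ac_continuous Hh.
move=> s t s0 st tT; have D0 := incrH s t s0 st tT; split; first by rewrite -subr_ge0.
have s0T : 0 <= s <= T by rewrite s0 (le_trans st).
have t0T : 0 <= t <= T by rewrite tT (le_trans s0).
have t0 : 0 <= t by exact: le_trans st.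
have incr : P' t - P' s <= P' t * (H t - H s).
  rewrite (ac_increment Hhy s0 st tT) (ac_increment Hh s0 st tT).
  have inth' := ac_rintegrable Hh s0 tT.
  rewrite -RintegralZl //; apply: le_Rintegral => //.
  - exact: ac_rintegrable Hhy s0 tT.
  - exact: rintegrableZ.
  move=> r rst; have := subset_itv0 s0 tT rst; rewrite /= in_itv /= => r0T.
  move: rst; rewrite /= in_itv /= => /andP[sr rt].
  have [h0 _] := hy0 _ r0T.
  rewrite mulrC ler_wpM2r //; apply: le_trans (Hy _ r0T) _.
  have /andP[r0 rT] := r0T.
  by rewrite -subr_ge0; exact: incrP.
have Pt : 0 <= P' t by have := incrP 0 t (lexx 0) t0 tT; lra.
have PtT := incrP t T t0 tT (lexx T).
have HS : 0 <= H s by have := incrH 0 s (lexx 0) s0 (andP s0T).2; rewrite {2}/H set_itv1 Rintegral_set1; lra.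
set D := H t - H s in D0 incr *.
have -> : expR (- H t) = expR (- D) * expR (- H s).
  by rewrite -expRD /D; congr expR; ring.
(* through e^(-D) <= 1 / (1 + D) *)
have eD : expR (- D) <= 1 - D + D ^+ 2.
  have D1 : 0 < 1 + D by lra.
  rewrite expRN; apply: (@le_trans _ _ (1 + D)^-1).
    by rewrite lef_pV2 ?posrE ?expR_gt0 // expR_ge1Dx.
  rewrite -[leLHS]mul1r ler_pdivrMr //.
  have : 0 <= D ^+ 3 by rewrite exprn_ge0.
  by rewrite [_ ^+ 3]exprS; nra.
have es1 : expR (- H s) <= 1 by rewrite -expR0 ler_expR; lra.
have es0 : 0 <= expR (- H s) by exact: expR_ge0.
apply: (@le_trans _ _ (P' t * D ^+ 2 * expR (- H s))).
  have : P' t * expR (- D) <= P' t * (1 - D + D ^+ 2) by exact: ler_wpM2l.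
  rewrite !mulrA -mulrBl => HH; apply: ler_wpM2r => //; nra.
have : 0 <= D ^+ 2 by rewrite sqr_ge0.
by move=> D2; apply: le_trans (ler_wpM2l _ es1) _; [rewrite mulr_ge0|rewrite mulr1 ler_wpM2r //; lra].
Qed.

Lemma ac_expR T k : 0 <= T ->
  ac T (fun t => expR (k * t)) (fun t => k * expR (k * t)).
Proof.
move=> T0.
have cE : continuous (fun t : R => k * expR (k * t)).
  move=> t; apply: cvgM; first exact: cvg_cst.
  apply: continuous_comp; last exact: continuous_expR.
  by apply: cvgM; [exact: cvg_cst|exact: cvg_id].
have dE (t : R) : is_derive t 1 (fun t => expR (k * t)) (k * expR (k * t)).
  have lin : is_derive t 1 (fun t : R => k * t) k.
    have := @is_deriveZ R R R id k t 1 1 (is_derive_id t (1 : R)).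
    by rewrite /GRing.scale /= mulr1.
  rewrite [X in is_derive _ _ _ X]mulrC.
  exact: (@is_derive1_comp _ expR (fun t => k * t)).
have cE' : continuous (fun t : R => expR (k * t)).
  by move=> t; apply: differentiable_continuous; apply/derivable1_diffP; case: (dE t).
have intE t : rintegrable mu `[0, t] (fun t => k * expR (k * t)).
  apply: continuous_compact_integrable; first exact: segment_compact.
  exact: continuous_subspaceT.
split; first exact: intE.
move=> t /andP[]; rewrite le_eqVlt => /predU1P[<- _|t0 tT].
  by rewrite set_itv1 Rintegral_set1 addr0.
have := @continuous_FTC2 _ (fun t => k * expR (k * t)) (fun t => expR (k * t)) 0 t t0.
move=> /(_ (continuous_subspaceT cE)) ftc.
rewrite /Rintegral ftc /=; first by ring.
  split.
  - by move=> x _; case: (dE x).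
  - by apply: cvg_at_right_filter; exact: cE'.
  - by apply: cvg_at_left_filter; exact: cE'.
by move=> x _; rewrite derive1E; apply: derive_val.
Qed.

End paths.

(** * Smooth cutoff functions *)

Section cutoff.
Context {R : realType}.
Local Notation mu := (@lebesgue_measure R).
Implicit Types (x y h c : R).

Definition relu y : R := Num.max y 0.

Lemma relu_le0 y : y <= 0 -> relu y = 0.
Proof. by move=> y0; rewrite /relu max_r. Qed.

Lemma reluE y : 0 <= y -> relu y = y.
Proof. by move=> y0; rewrite /relu max_l. Qed.

Lemma continuous_relu : continuous relu.
Proof.
move=> y; apply/cvgrPdist_le => /= e e0; near=> z.
have : `|y - z| <= e by near: z; apply: (@cvgr_dist_le _ _ _ (nbhs y) _ id y) => //; exact: cvg_id.
apply: le_trans; rewrite /relu.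
have [y0|y0] := leP y 0; have [z0|z0] := leP z 0.
- by rewrite subrr normr0.
- by rewrite sub0r normrN gtr0_norm // ler0_norm; lra.
- by rewrite subr0 gtr0_norm // ger0_norm; lra.
- by [].
Unshelve. all: by end_near. Qed.

(** The square of the positive part is continuously differentiable, with the
    quadratic remainder of a polynomial of degree two. *)
Lemma relu_sq_increment y h :
  `|relu (h + y) ^+ 2 - relu y ^+ 2 - h * (2 * relu y)| <= h ^+ 2.
Proof.
rewrite /relu; have [y0|y0] := leP y 0; have [z0|z0] := leP (h + y) 0;
  rewrite ler_norml; apply/andP; split; nra.
Qed.

Lemma is_derive_relu_sq y : is_derive y 1 (fun y => relu y ^+ 2) (2 * relu y).
Proof.
have H : (fun h => h^-1 *: (relu (h *: 1 + y) ^+ 2 - relu y ^+ 2)) @ 0^' --> 2 * relu y.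
  apply/cvgrPdist_le => /= e e0; near=> h.
  have h0 : h != 0 by near: h; exact: nbhs_dnbhs_neq.
  have he : `|h| <= e by near: h; apply: dnbhs0_le.
  have := relu_sq_increment y h; rewrite /GRing.scale /= mulr1 => H.
  rewrite distrC -(@ler_pM2l _ `|h|) ?normr_gt0 // -normrM mulrBr mulrA divff // mul1r.
  apply: le_trans H _; rewrite -real_normK ?num_real // expr2.
  by rewrite ler_wpM2l.
apply: DeriveDef; first exact: cvgP H.
exact: cvg_lim H.
Unshelve. all: by end_near. Qed.

(** Half the second difference of the squared positive part: it rises from 0 before 0 to
    1 after 2, and its derivative [hat] is a piecewise linear hat function. *)
Definition ramp y : R := (relu y ^+ 2 - 2 * relu (y - 1) ^+ 2 + relu (y - 2) ^+ 2) / 2.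
Definition hat y : R := relu y - 2 * relu (y - 1) + relu (y - 2).

Lemma is_derive_ramp y : is_derive y 1 ramp (hat y).
Proof.
have sh c : is_derive y 1 (fun y => relu (y - c) ^+ 2) (2 * relu (y - c)).
  have := @is_derive1_comp _ (fun y => relu y ^+ 2) (fun y => y - c) y (2 * relu (y - c)) 1.
  rewrite mulr1; apply; first exact: is_derive_relu_sq.
  have := @is_deriveB _ _ _ id (cst c) y 1 1 0 (is_derive_id y (1 : R)) _.
  by rewrite subr0; apply.
have s0 : is_derive y 1 (fun y => relu y ^+ 2) (2 * relu y) by exact: is_derive_relu_sq.
have := is_deriveZ (2^-1) (is_deriveD (is_deriveB s0 (is_deriveZ 2 (sh 1))) (sh 2)).
have -> : 2^-1 *: (2 * relu y - 2 *: (2 * relu (y - 1)) + 2 * relu (y - 2)) = hat y.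
  by rewrite /hat /GRing.scale /=; field.
congr is_derive; apply/funext => z; rewrite /ramp /GRing.scale /= mulrC.
by rewrite !fctE.
Qed.

Lemma continuous_hat : continuous hat.
Proof.
have sh c : continuous (fun y => relu (y - c)).
  move=> y; apply: (@continuous_comp _ _ _ (fun y => y - c) relu); last exact: continuous_relu.
  by apply: cvgB; [exact: cvg_id|exact: cvg_cst].
move=> y; apply: cvgD; last exact: sh.
apply: cvgB; first exact: continuous_relu.
by apply: cvgM; [exact: cvg_cst|exact: sh].
Qed.

Lemma hat_ge0 y : 0 <= hat y.
Proof.
rewrite /hat /relu.
by have [] := leP y 0; have [] := leP (y - 1) 0; have [] := leP (y - 2) 0; lra.
Qed.

Lemma ramp_le0 y : y <= 0 -> ramp y = 0.
Proof.
by move=> y0; rewrite /ramp !relu_le0 ?expr0n /=; [ring|lra..].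
Qed.

Lemma ramp_ge2 y : 2 <= y -> ramp y = 1.
Proof. by move=> y2; rewrite /ramp !reluE; [field|lra..]. Qed.

Lemma hat_out y : y <= 0 \/ 2 <= y -> hat y = 0.
Proof.
by move=> [y0|y0]; [rewrite /hat !relu_le0; [ring|lra..]|rewrite /hat !reluE; [ring|lra..]].
Qed.

Lemma ramp_itv y : 0 <= ramp y <= 1.
Proof.
rewrite /ramp /relu.
by have [] := leP y 0; have [] := leP (y - 1) 0; have [] := leP (y - 2) 0;
 move=> *; apply/andP; split; nra.
Qed.

(** The ramp that rises on [[c, c + 2 h]]; for small [h] it approximates the
    indicator of [[c, 1]], and its derivative [bump] the Dirac mass at [c]. *)
Definition cutoff c h x : R := ramp (h^-1 * (x - c)).
Definition bump c h x : R := h^-1 * hat (h^-1 * (x - c)).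

Lemma is_derive_cutoff c h x : is_derive x 1 (cutoff c h) (bump c h x).
Proof.
have lin : is_derive x 1 (fun x => h^-1 * (x - c)) (h^-1).
  have := is_deriveZ h^-1 (is_deriveB (is_derive_id x (1 : R)) (is_derive_cst c x 1)).
  by rewrite subr0 /GRing.scale /= mulr1.
rewrite /bump mulrC.
exact: (@is_derive1_comp _ ramp (fun x => h^-1 * (x - c)) _ _ _ (is_derive_ramp _)).
Qed.

Lemma continuous_bump c h : continuous (bump c h).
Proof.
move=> x; apply: cvgM; first exact: cvg_cst.
apply: (@continuous_comp _ _ _ (fun x => h^-1 * (x - c)) hat); last exact: continuous_hat.
by apply: cvgM; [exact: cvg_cst|apply: cvgB; [exact: cvg_id|exact: cvg_cst]].
Qed.

Lemma continuous_cutoff c h : continuous (cutoff c h).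
Proof.
move=> x; apply: differentiable_continuous; apply/derivable1_diffP.
by case: (is_derive_cutoff c h x).
Qed.

Lemma cutoff_left c h x : 0 < h -> x <= c -> cutoff c h x = 0.
Proof. by move=> h0 xc; apply: ramp_le0; rewrite pmulr_rle0 ?invr_gt0 // subr_le0. Qed.

Lemma cutoff_right c h x : 0 < h -> c + 2 * h <= x -> cutoff c h x = 1.
Proof.
move=> h0 xc; apply: ramp_ge2; rewrite mulrC ler_pdivlMr //; lra.
Qed.

Lemma bump_out c h x : 0 < h -> x <= c \/ c + 2 * h <= x -> bump c h x = 0.
Proof.
move=> h0 xc; rewrite /bump hat_out ?mulr0 //.
case: xc => xc; [left|right].
  by rewrite pmulr_rle0 ?invr_gt0 // subr_le0.
by rewrite mulrC ler_pdivlMr //; lra.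
Qed.

Lemma bump_ge0 c h x : 0 < h -> 0 <= bump c h x.
Proof. by move=> h0; rewrite mulr_ge0 ?hat_ge0 // invr_ge0 ltW. Qed.

Lemma continuous_rintegrable (f : R -> R) a b :
  {within `[a, b], continuous f} -> rintegrable mu `[a, b] f.
Proof. move=> cf; apply: continuous_compact_integrable => //; exact: segment_compact. Qed.

Lemma Rintegral_oo_cc (f : R -> R) (a b : R) : measurable_fun `]a, b[ f ->
  \int[mu]_(x in `]a, b[) f x = \int[mu]_(x in `[a, b]) f x.
Proof.
move=> mf; rewrite /Rintegral (@integral_itv_bndoo _ a b _ true false) //.
exact/measurable_EFinP.
Qed.

Lemma Rintegral_bump c h : 0 < h -> 0 <= c -> c + 2 * h <= 1 ->
  \int[mu]_(x in `]0, 1[) bump c h x = 1.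
Proof.
move=> h0 c0 ch; have cb := @continuous_bump c h.
rewrite Rintegral_oo_cc; last first.
  apply: measurable_funTS; exact: continuous_measurable_fun.
rewrite /Rintegral (@continuous_FTC2 _ _ (cutoff c h)) //=.
- by rewrite cutoff_right ?cutoff_left // subr0.
- exact: continuous_subspaceT.
- split.
  + by move=> x _; case: (is_derive_cutoff c h x).
  + by apply: cvg_at_right_filter; exact: continuous_cutoff.
  + by apply: cvg_at_left_filter; exact: continuous_cutoff.
- move=> x _; rewrite derive1E; by case: (is_derive_cutoff c h x).
Qed.

End cutoff.

(** * Cutoff functions as approximations of Dirac masses and indicators *)

Section sobolev_one.
Context {R : realType}.
Local Notation mu := (@lebesgue_measure R).
Implicit Types f g : R -> R.
Local Notation I := (`]0, 1[ : set R).

Lemma rintegrable_oo_cc f (a b : R) :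
  rintegrable mu `]a, b[ f -> rintegrable mu `[a, b] f.
Proof.
move=> /integrableP[/measurable_EFinP mf intf]; apply/integrableP; split.
  apply/measurable_EFinP; exact: measurable_fun_itv_cc mf.
rewrite (@integral_itv_bndoo _ a b _ true false) //.
by apply: measurableT_comp => //; exact/measurable_EFinP.
Qed.

Lemma rintegrable_patch f (D E : set R) : measurable D -> measurable E ->
  rintegrable mu D f -> rintegrable mu D (f \_ E).
Proof.
move=> mD mE intf; have /(integrable_restrict mu mE mD) : rintegrable mu (D `&` E) f.
  by apply: rintegrableS intf => //; exact: measurableI.
by rewrite restrict_EFin.
Qed.

Lemma inner_cc f g : L2 f -> L2 g ->
  inner f g = \int[mu]_(x in `[0, 1]) (f x * g x).
Proof.
by move=> Lf Lg; rewrite /inner Rintegral_oo_cc //; apply: measurable_funM; exact: L2_measurable.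
Qed.

Lemma L2_norm f : L2 f -> L2 (fun x => `|f x|).
Proof.
move=> [mf f2]; split; first exact: measurableT_comp.
by apply: (eq_rintegrable _ _ f2) => // x _; rewrite real_normK ?num_real.
Qed.

Lemma L2norm_norm f : L2norm (fun x => `|f x|) = L2norm f.
Proof.
rewrite /L2norm /inner; congr Num.sqrt; apply: eq_Rintegral => x _.
by rewrite -!expr2 real_normK ?num_real.
Qed.

Lemma ac_variation F f (x y : R) : ac 1 F f -> 0 <= x <= 1 -> 0 <= y <= 1 ->
  `|F x - F y| <= \int[mu]_(s in `[0, 1]) `|f s|.
Proof.
move=> HF.
wlog xy : x y / y <= x.
  move=> wl x01 y01; have [yx|/ltW xy] := leP y x; first exact: wl.
  by rewrite distrC; exact: wl.
move=> /andP[x0 x1] /andP[y0 y1].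
have [intf _] := HF.
have intf' := ac_rintegrable HF y0 x1.
rewrite (ac_increment HF y0 xy x1).
apply: le_trans (le_normr_Rintegral _ _) _ => //.
have intV : rintegrable mu `[0, 1] (fun x => `|f x|) by exact: rintegrable_norm.
have HV := ac_primitive 0 (@ler01 R) intV.
rewrite -(ac_increment HV y0 xy x1).
have E : 0 + \int[mu]_(s in `[0, 1]) `|f s| - (0 + \int[mu]_(s in `[0, x]) `|f s|) =
  \int[mu]_(s in `]x, 1]) `|f s| by apply: (ac_increment HV).
have : 0 <= \int[mu]_(s in `]x, 1]) `|f s| by exact: Rintegral_ge0.
have : 0 <= \int[mu]_(s in `[0, y]) `|f s| by exact: Rintegral_ge0.
rewrite -E; move: (Rintegral _ _ _) (Rintegral _ _ _) (Rintegral _ _ _) => p q r.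
by lra.
Qed.

(** Smallness of the oscillation of [F] to the right of [c], in the form used by
    the two approximation lemmas below. *)
Lemma small_variation (F : R -> R) (c e : R) : 0 < c < 1 -> 0 < e ->
  {within `[0, 1], continuous F} ->
  \forall h \near (0 : R)^'+, c + 2 * h < 1 /\
    forall x, c <= x <= c + 2 * h -> `|F x - F c| <= e.
Proof.
move=> /andP[c0 c1] e0 cF.
have /(_ c) cFc : {in `]0, 1[%R, continuous F}.
  by move/continuous_within_itvP : cF => /(_ ltr01)[].
have /cvgrPdist_le /(_ e e0) : F @ c --> F c by apply: cFc; rewrite in_itv /= c0.
move=> /nbhs_ballP[d /= d0 Hd].
near=> h; have h0 : 0 < h by [].
have hd : h < d / 2 by near: h; apply: nbhs_right_lt; rewrite divr_gt0.
have hc : h < (1 - c) / 2.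
  by near: h; apply: nbhs_right_lt; rewrite divr_gt0 // subr_gt0.
split; first lra.
move=> x /andP[cx xc]; rewrite distrC; apply: Hd.
by rewrite /ball /= distrC ger0_norm ?subr_ge0 //; lra.
Unshelve. all: by end_near. Qed.

(** The bump has integral 1 and lives where [f] is close to [f c]. *)
Lemma inner_bump f (c e : R) : 0 < c < 1 -> 0 < e -> L2 f ->
  {within `[0, 1], continuous f} ->
  \forall h \near (0 : R)^'+, `|inner f (bump c h) - f c| <= e.
Proof.
move=> c01 e0 Lf cf; have := small_variation c01 e0 cf.
move: c01 => /andP[c0 c1].
apply: filterS2 (nbhs_right_gt (0 : R)) => h h0 [ch Hh].
have mb : measurable_fun I (bump c h).
  by apply: measurable_funTS; apply: continuous_measurable_fun; exact: continuous_bump.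
have intb : rintegrable mu I (bump c h).
  apply: (@rintegrableS _ _ _ mu `[0, 1]) => //.
    exact: subset_itv_oo_cc.
  by apply: continuous_rintegrable; apply: continuous_subspaceT; exact: continuous_bump.
have one := Rintegral_bump h0 (ltW c0) (ltW ch).
have intfb : rintegrable mu I (fun x => f x * bump c h x).
  apply: (@rintegrableS _ _ _ mu `[0, 1]) => //; first exact: subset_itv_oo_cc.
  apply: continuous_rintegrable => x; apply: cvgM; first exact: cf.
  by apply: continuous_subspaceT; exact: continuous_bump.
have -> : inner f (bump c h) - f c = \int[mu]_(x in I) ((f x - f c) * bump c h x).
  under [RHS]eq_Rintegral do rewrite mulrBl.
  by rewrite RintegralB //; [rewrite RintegralZl // one mulr1|exact: rintegrableZ].
have intd : rintegrable mu I (fun x => (f x - f c) * bump c h x).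
  apply: (eq_rintegrable _ _ (rintegrableB _ intfb (rintegrableZ (f c) _ intb))) => //.
  by move=> x _; rewrite mulrBl.
apply: le_trans (le_normr_Rintegral _ intd) _ => //.
have -> : e = \int[mu]_(x in I) (e * bump c h x) by rewrite RintegralZl // one mulr1.
apply: le_Rintegral => //.
- exact: rintegrable_norm.
- exact: rintegrableZ.
move=> x _; rewrite normrM (ger0_norm (bump_ge0 _ _ h0)).
have [cx|xc] := leP c x; last by rewrite bump_out ?mulr0 //; left; exact: ltW.
have [xc|cx'] := leP x (c + 2 * h).
  by apply: ler_wpM2r; [exact: bump_ge0|apply: Hh; rewrite cx].
by rewrite bump_out ?mulr0 //; right; exact: ltW.
Qed.

(** The cutoff differs from the indicator only on [[c, c + 2 h]], where the integral
    of [|g|] is small. *)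
Lemma inner_cutoff g (c e : R) : 0 < c < 1 -> 0 < e -> L2 g ->
  \forall h \near (0 : R)^'+, `|inner g (cutoff c h) - \int[mu]_(x in `]c, 1]) g x| <= e.
Proof.
move=> c01 e0 Lg.
have intg : rintegrable mu `[0, 1] g.
  by apply: rintegrable_oo_cc; exact: L2_rintegrable.
have intV : rintegrable mu `[0, 1] (fun x => `|g x|) by exact: rintegrable_norm.
have HV := ac_primitive 0 (@ler01 R) intV.
have := small_variation c01 e0 (ac_continuous ler01 HV).
move: c01 => /andP[c0 c1].
apply: filterS2 (nbhs_right_gt (0 : R)) => h h0 [ch Hh].
have mk : measurable_fun (`[0, 1] : set R) (cutoff c h).
  by apply: measurable_funTS; apply: continuous_measurable_fun; exact: continuous_cutoff.
have intgk : rintegrable mu `[0, 1] (fun x => g x * cutoff c h x).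
  apply: (@le_rintegrable _ _ _ mu _ _ (fun x => `|g x|)) => //.
    by apply: measurable_funM => //; exact: rintegrable_measurable intg.
  move=> x _; rewrite normrM ler_piMr //.
  by have /andP[? ?] := ramp_itv (h^-1 * ((x : R) - c)); rewrite ger0_norm.
have -> : inner g (cutoff c h) = \int[mu]_(x in `[0, 1]) (g x * cutoff c h x).
  rewrite /inner Rintegral_oo_cc //; apply: measurable_funS (rintegrable_measurable intgk) => //.
  exact: subset_itv_oo_cc.
have sub : (`]c, 1] : set R) `<=` `[0, 1].
  by apply: subset_itv; rewrite bnd_simp // ltW.
rewrite (_ : \int[mu]_(x in `]c, 1]) g x = \int[mu]_(x in `[0, 1]) (g \_ `]c, 1]) x); last first.
  by rewrite -Rintegral_mkcondr setIidr.
have intgr : rintegrable mu `[0, 1] (g \_ `]c, 1]).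
  exact: rintegrable_patch.
rewrite -RintegralB //.
apply: le_trans (le_normr_Rintegral _ _) _ => //; first exact: rintegrableB.
have h1 : c + 2 * h <= 1 by exact: ltW.
have cch : c <= c + 2 * h by rewrite lerDl mulr_ge0 // ltW.
have := Hh (c + 2 * h); rewrite lexx cch => /(_ isT).
rewrite (ac_increment HV (ltW c0) cch h1); apply: le_trans.
rewrite [leRHS]ger0_norm; last exact: Rintegral_ge0.
have sub' : (`]c, c + 2 * h] : set R) `<=` `[0, 1].
  by apply: subset_itv; rewrite bnd_simp // ltW.
rewrite (_ : \int[mu]_(x in `]c, _]) _ = \int[mu]_(x in `[0, 1]) ((fun x => `|g x|) \_ `]c, c + 2 * h]) x); last first.
  by rewrite -Rintegral_mkcondr setIidr.
apply: le_Rintegral => //.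
- by apply: rintegrable_norm => //; exact: rintegrableB.
- exact: rintegrable_patch.
move=> x /=; rewrite in_itv /= => /andP[x0 x1].
rewrite !patchE !mem_setE !in_itv /= x1 andbT.
have [xc|cx] := leP x c.
  by rewrite cutoff_left // mulr0 subr0 normr0.
have [xh|hx] := leP x (c + 2 * h).
  rewrite -{2}(mulr1 (g x)) -mulrBr normrM ler_piMr //.
  have /andP[? ?] := ramp_itv (h^-1 * ((x : R) - c)).
  by rewrite ler_norml /cutoff; apply/andP; split; lra.
by rewrite cutoff_right ?mulr1 ?subrr ?normr0 // ltW.
Qed.

End sobolev_one.

(** * The Sobolev space H^1(0, 1) *)

Section sobolev_one_consequences.
Context {R : realType}.
Local Notation mu := (@lebesgue_measure R).
Implicit Types f g : R -> R.
Local Notation I := (`]0, 1[ : set R).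

Lemma fine_mu_cc (t : R) : 0 <= t -> fine (mu `[0, t]) = t.
Proof.
rewrite lebesgue_measure_itv /= lte_fin le_eqVlt => /predU1P[<-|t0].
  by rewrite ltxx.
by rewrite t0 /= oppr0 addr0.
Qed.

Lemma Rintegral_cst_cc (k t : R) : 0 <= t -> \int[mu]_(x in `[0, t]) k = k * t.
Proof. by move=> t0; rewrite Rintegral_cst // [fine _](fine_mu_cc t0). Qed.

Lemma test_function_cutoff (a b h : R) : 0 < a -> a < b -> 0 < h -> b + 2 * h < 1 ->
  test_function (fun x => cutoff a h x - cutoff b h x) /\
  derive1 (fun x => cutoff a h x - cutoff b h x) = (fun x => bump a h x - bump b h x).
Proof.
move=> a0 ab h0 bh.
have dd (x : R) : is_derive x 1 (fun x => cutoff a h x - cutoff b h x) (bump a h x - bump b h x).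
  exact: (is_deriveB (is_derive_cutoff a h x) (is_derive_cutoff b h x)).
have de : derive1 (fun x => cutoff a h x - cutoff b h x) = (fun x => bump a h x - bump b h x).
  by apply/funext => x; rewrite derive1E; case: (dd x).
split=> //; split.
- by move=> x; case: (dd x).
- by rewrite de => x; apply: cvgB; exact: continuous_bump.
- exists a, (b + 2 * h); split=> // x; rewrite negb_and -!ltNge => /orP[xa|xb].
    by rewrite !cutoff_left ?subrr // ltW // (lt_trans xa).
  have xa : a + 2 * h <= x by lra.
  by rewrite !cutoff_right ?subrr // ltW.
Qed.

Lemma L2_within_continuous f : {within `[0, 1], continuous f} -> L2 f.
Proof.
move=> cf; split.
  apply: measurable_funS (rintegrable_measurable (continuous_rintegrable cf)) => //.
  exact: subset_itv_oo_cc.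
apply: (@rintegrableS _ _ _ mu `[0, 1]) => //; first exact: subset_itv_oo_cc.
by apply: continuous_rintegrable => x; apply: cvgM; exact: cf.
Qed.

(** Testing the weak derivative with a cutoff rising at [a] minus a cutoff rising at
    [b], and letting their width tend to 0, gives
    [f a - f b = - (int_a^1 g - int_b^1 g)]. *)
Lemma weak_derivative_increment f g (a b : R) :
  {within `[0, 1], continuous f} -> L2 g -> weak_derivative f g ->
  0 < a -> a < b -> b < 1 ->
  f a - f b + (\int[mu]_(x in `]a, 1]) g x - \int[mu]_(x in `]b, 1]) g x) = 0.
Proof.
move=> cf Lg wfg a0 ab b1.
have a01 : 0 < a < 1 by rewrite a0 (lt_trans ab).
have b01 : 0 < b < 1 by rewrite b1 andbT (lt_trans a0).
have Lf := L2_within_continuous cf.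
apply/eqP; rewrite -normr_le0; apply/ler_addgt0Pr => e e0; rewrite add0r.
(* a quarter for each of the four approximations *)
have e40 : 0 < e / 4 by rewrite divr_gt0.
near (0 : R)^'+ => h.
have h0 : 0 < h by near: h; exact: nbhs_right_gt.
have bh : b + 2 * h < 1.
  suff : h < (1 - b) / 2 by lra.
  by near: h; apply: nbhs_right_lt; rewrite divr_gt0 // subr_gt0.
have [tf de] := test_function_cutoff a0 ab h0 bh.
have := wfg _ tf; rewrite de.
have Lb c : L2 (bump c h).
  by apply: L2_within_continuous; apply: continuous_subspaceT; exact: continuous_bump.
have Lc c : L2 (cutoff c h).
  by apply: L2_within_continuous; apply: continuous_subspaceT; exact: continuous_cutoff.
rewrite !innerBr // => E.
have H1 : `|inner f (bump a h) - f a| <= e / 4 by near: h; exact: inner_bump.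
have H2 : `|inner f (bump b h) - f b| <= e / 4 by near: h; exact: inner_bump.
have H3 : `|inner g (cutoff a h) - \int[mu]_(x in `]a, 1]) g x| <= e / 4 by near: h; exact: inner_cutoff.
have H4 : `|inner g (cutoff b h) - \int[mu]_(x in `]b, 1]) g x| <= e / 4 by near: h; exact: inner_cutoff.
move: E H1 H2 H3 H4.
move: (inner _ _) (inner _ _) (inner _ _) (inner _ _) (Rintegral _ _ _) (Rintegral _ _ _) => p q r s u v.
move: (f a) (f b) => fa fb.
rewrite !ler_norml => E /andP[? ?] /andP[? ?] /andP[? ?] /andP[? ?].
by apply/andP; split; lra.
Unshelve. all: by end_near. Qed.

(** The increment formula is first proved inside the interval, where test functions
    see the function, and reaches the end points by continuity. *)
Lemma eq_at_endpoints (F : R -> R) c : {within `[0, 1], continuous F} ->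
  (forall x, 0 < x < 1 -> F x = c) -> forall x, 0 <= x <= 1 -> F x = c.
Proof.
move=> cF Fc; have [_ c0 c1] := (continuous_within_itvP F ltr01).1 cF.
have H0 : F x @[x --> 0^'+] --> c.
  have : cst c x @[x --> (0 : R)^'+] --> c by exact: cvg_cst.
  apply: cvg_trans; apply: near_eq_cvg; near=> x; rewrite Fc //.
  apply/andP; split; first by near: x; exact: nbhs_right_gt.
  by near: x; exact: nbhs_right_lt.
have H1 : F x @[x --> 1^'-] --> c.
  have : cst c x @[x --> (1 : R)^'-] --> c by exact: cvg_cst.
  apply: cvg_trans; apply: near_eq_cvg; near=> x; rewrite Fc //.
  apply/andP; split; first by near: x; exact: nbhs_left_gt.
  by near: x; exact: nbhs_left_lt.
have F0 : F 0 = c by rewrite -(cvg_lim (@Rhausdorff R) c0) (cvg_lim (@Rhausdorff R) H0).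
have F1 : F 1 = c by rewrite -(cvg_lim (@Rhausdorff R) c1) (cvg_lim (@Rhausdorff R) H1).
move=> x /andP[]; rewrite le_eqVlt => /predU1P[<- //|x0].
by rewrite le_eqVlt => /predU1P[-> //|x1]; rewrite Fc ?x0.
Unshelve. all: by end_near. Qed.

Lemma sobolev1_L2 f : sobolev 1 f -> L2 f /\ L2 (derive1 f).
Proof.
by move=> [_ Lf _]; split; [exact: (Lf 0%N)|exact: (Lf 1%N)].
Qed.

(** The difference between [f] and the primitive of its derivative is constant
    inside the interval, by [weak_derivative_increment]. *)
Lemma sobolev1_ac f : sobolev 1 f -> ac 1 f (derive1 f).
Proof.
move=> Sf; have [Lf Lg] := sobolev1_L2 Sf; have [cf _ wf] := Sf.
have {}cf := cf isT; have {}wf : weak_derivative f (derive1 f) := wf 0%N isT.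
set g := derive1 f in Lg wf *.
have intg : rintegrable mu `[0, 1] g by apply: rintegrable_oo_cc; exact: L2_rintegrable.
split=> // t t01.
have HG := ac_primitive 0 (@ler01 R) intg.
set G := fun t : R => _ in HG.
have cG : {within `[0, 1], continuous G} by exact: ac_continuous HG.
have cFG : {within `[0, 1], continuous (fun x => f x - G x)}.
  move=> x; apply: cvgB; first exact: cf.
  exact: cG.
have key (a b : R) : 0 < a -> a < b -> b < 1 -> f a - G a = f b - G b.
  move=> a0 ab b1; have := weak_derivative_increment cf Lg wf a0 ab b1.
  rewrite -(ac_increment HG (ltW a0)) ?(ltW (lt_trans ab b1)) //.
  rewrite -(ac_increment HG (ltW (lt_trans a0 ab))) ?(ltW b1) //.
  move: (f a) (f b) (G a) (G b) (G 1) => p q r s u; lra.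
have const (x : R) : 0 < x < 1 -> f x - G x = f (2^-1) - G (2^-1).
  move=> /andP[x0 x1]; have [xlt|xgt|->//] := ltgtP x 2^-1.
    by apply: key => //; rewrite invf_lt1 // ltr1n.
  by apply/esym/key => //; rewrite invr_gt0.
have E0 := eq_at_endpoints cFG const.
have := E0 t t01; rewrite -(E0 0) ?lexx ?ler01 //.
rewrite /G set_itv1 Rintegral_set1; move: (Rintegral _ _ _) (f t) (f 0) => p q r; lra.
Qed.

Lemma int_norm_le_L2norm f : L2 f -> \int[mu]_(x in `[0, 1]) `|f x| <= L2norm f.
Proof.
move=> Lf; have L1 := L2_cst (1 : R); have Ln := L2_norm Lf.
have := cauchy_schwarz Ln L1; rewrite L2norm_norm L2norm_cst normr1 mulr1.
apply: le_trans; apply: le_trans (ler_norm _); rewrite inner_cc //.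
by rewrite le_eqVlt; apply/orP; left; apply/eqP; apply: eq_Rintegral => x _; rewrite mulr1.
Qed.

Lemma int_mul_le_L2norm f g : L2 f -> L2 g ->
  \int[mu]_(x in `[0, 1]) `|f x * g x| <= L2norm f * L2norm g.
Proof.
move=> /L2_norm Lf /L2_norm Lg; have := cauchy_schwarz Lf Lg; rewrite !L2norm_norm.
apply: le_trans; apply: le_trans (ler_norm _); rewrite inner_cc //.
rewrite le_eqVlt; apply/orP; left; apply/eqP; apply: eq_Rintegral => x _.
exact: normrM.
Qed.

Lemma sobolev1_variation f (x y : R) : sobolev 1 f ->
  0 <= x <= 1 -> 0 <= y <= 1 -> `|f x - f y| <= L2norm (derive1 f).
Proof.
move=> Sf x01 y01; have [Lf Lg] := sobolev1_L2 Sf.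
exact: le_trans (ac_variation (sobolev1_ac Sf) x01 y01) (int_norm_le_L2norm Lg).
Qed.

(** A bound by a quantity depending on a free point of the interval may be averaged
    over that point; this turns pointwise increments into bounds by norms. *)
Lemma le_average f (k m : R) : rintegrable mu `[0, 1] f ->
  (forall x, 0 <= x <= 1 -> k <= f x + m) -> k <= \int[mu]_(x in `[0, 1]) f x + m.
Proof.
move=> intf H; rewrite -lerBlDr.
have one (c : R) : \int[mu]_(x in `[0, 1]) c = c.
  by rewrite Rintegral_cst_cc // mulr1.
rewrite -(one (k - m)); apply: le_Rintegral => //.
  by apply: continuous_rintegrable; apply: continuous_subspaceT => x; exact: cvg_cst.
by move=> x /=; rewrite in_itv /= => x01; rewrite lerBlDr; exact: H.
Qed.

Lemma sobolev1_sup f (x : R) : sobolev 1 f -> 0 <= x <= 1 ->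
  `|f x| <= L2norm f + L2norm (derive1 f).
Proof.
move=> Sf x01; have [Lf Lg] := sobolev1_L2 Sf.
have intf : rintegrable mu `[0, 1] f by apply: rintegrable_oo_cc; exact: L2_rintegrable.
apply: le_trans (lerD (int_norm_le_L2norm Lf) (lexx _)).
apply: le_average; first exact: rintegrable_norm.
move=> y y01; have := sobolev1_variation Sf x01 y01.
have := ler_normD (f y) (f x - f y); rewrite addrC subrK; lra.
Qed.

Lemma ac_sqr f : sobolev 1 f ->
  ac 1 (fun x => f x ^+ 2) (fun x => 2 * (f x * derive1 f x)).
Proof.
move=> Sf; have Hf := sobolev1_ac Sf; have := acM (@ler01 R) Hf Hf.
by move=> H; apply: (eq_ac H) => x _; ring.
Qed.

(** The square of [f] varies by at most [2 |f| |f'|]; its value at [x] is compared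
    with its mean. *)
Lemma sobolev1_agmon f (x : R) : sobolev 1 f -> 0 <= x <= 1 ->
  f x ^+ 2 <= L2norm f ^+ 2 + 2 * (L2norm f * L2norm (derive1 f)).
Proof.
move=> Sf x01; have [Lf Lg] := sobolev1_L2 Sf.
rewrite L2normK inner_cc //.
have intf2 : rintegrable mu `[0, 1] (fun x => f x * f x).
  by apply: rintegrable_oo_cc; exact: L2_mul.
apply: le_average => // y y01.
have := ac_variation (ac_sqr Sf) x01 y01.
under eq_Rintegral do rewrite normrM (ger0_norm (ler0n _ 2)).
rewrite RintegralZl //; last first.
  by apply: rintegrable_norm => //; apply: rintegrable_oo_cc; exact: L2_mul.
have := int_mul_le_L2norm Lf Lg; rewrite -expr2.
have := ler_norm (f x ^+ 2 - f y ^+ 2); lra.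
Qed.

(** Integrating by parts against [x - 1/2] gives
    [(f(0)^2 + f(1)^2) / 2 = |f|^2 + int 2 (x - 1/2) f f'], and
    [|2 (x - 1/2)| <= 1].  The constant 1 is what makes the admissible range of
    [alpha] the one of the theorem. *)
Lemma sobolev1_poincare f : sobolev 1 f ->
  L2norm f ^+ 2 <= L2norm (derive1 f) ^+ 2 + f 0 ^+ 2 + f 1 ^+ 2.
Proof.
move=> Sf; have [Lf Lg] := sobolev1_L2 Sf.
have H2 := ac_sqr Sf.
have H1 : ac 1 (fun x : R => x - 2^-1) (fun=> 1).
  split; first by apply: continuous_rintegrable; apply: continuous_subspaceT => x; exact: cvg_cst.
  by move=> t /andP[t0 t1]; rewrite Rintegral_cst_cc // mul1r; ring.
have H := acM (@ler01 R) H1 H2; have [intH /(_ 1)] := H.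
rewrite ler01 lexx => /(_ isT) E.
have intf2 : rintegrable mu `[0, 1] (fun x => f x * f x).
  by apply: rintegrable_oo_cc; exact: L2_mul.
have intg2 : rintegrable mu `[0, 1] (fun x => derive1 f x * derive1 f x).
  by apply: rintegrable_oo_cc; exact: L2_mul.
have : \int[mu]_(x in `[0, 1]) (2^-1 * (f x * f x) - 2^-1 * (derive1 f x * derive1 f x)) <=
    \int[mu]_(x in `[0, 1]) (1 * f x ^+ 2 + (x - 2^-1) * (2 * (f x * derive1 f x))).
  apply: le_Rintegral => //.
    by apply: rintegrableB => //; exact: rintegrableZ.
  move=> x /=; rewrite in_itv /= => /andP[x0 x1].
  move: (f x) (derive1 f x) => p q.
  have xx : 0 <= x * (1 - x) by rewrite mulr_ge0 // subr_ge0.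
  have := sqr_ge0 (p + 2 * (x - 2^-1) * q).
  have : 0 <= q ^+ 2 * (x * (1 - x)) by rewrite mulr_ge0 // sqr_ge0.
  by nra.
rewrite RintegralB //; try exact: rintegrableZ.
rewrite !RintegralZl // -!inner_cc // -!L2normK.
move: E; move: (Rintegral _ _ _) (L2norm _) (L2norm _) (f 0) (f 1) => p q r s u; nra.
Qed.

Lemma inner_derive_self f : sobolev 1 f ->
  inner (derive1 f) f = (f 1 ^+ 2 - f 0 ^+ 2) / 2.
Proof.
move=> Sf; have [Lf Lg] := sobolev1_L2 Sf.
have [_ /(_ 1)] := ac_sqr Sf; rewrite ler01 lexx => /(_ isT) ->.
rewrite RintegralZl //; last by apply: rintegrable_oo_cc; exact: L2_mul.
rewrite innerC inner_cc //; by field.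
Qed.

Lemma sobolev1_L2_mul f g : sobolev 1 f -> L2 g -> L2 (fun x => f x * g x).
Proof.
move=> Sf Lg; have [Lf Lf'] := sobolev1_L2 Sf.
apply: (@L2_bounded _ _ _ (L2norm f + L2norm (derive1 f))) => //.
  exact: L2_measurable.
move=> x /=; rewrite in_itv /= => /andP[x0 x1].
by apply: sobolev1_sup => //; rewrite !ltW.
Qed.

Lemma inner_derive_cube f : sobolev 1 f ->
  inner (fun x => f x * derive1 f x) f = (f 1 ^+ 3 - f 0 ^+ 3) / 3.
Proof.
move=> Sf; have [Lf Lg] := sobolev1_L2 Sf.
have [_ /(_ 1)] := acM (@ler01 R) (ac_sqr Sf) (sobolev1_ac Sf).
rewrite ler01 lexx => /(_ isT) E.
rewrite inner_cc //; last exact: sobolev1_L2_mul.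
have e : \int[mu]_(s in `[0, 1]) (2 * (f s * derive1 f s) * f s + f s ^+ 2 * derive1 f s) =
    3 * \int[mu]_(x in `[0, 1]) (f x * derive1 f x * f x).
  rewrite -RintegralZl //; last first.
    by apply: rintegrable_oo_cc; apply: L2_mul => //; exact: sobolev1_L2_mul.
  by apply: eq_Rintegral => x _; ring.
move: E; rewrite e; move: (Rintegral _ _ _) => p; rewrite ![_ ^+ 3]exprS => E.
have -> : f 1 * f 1 ^+ 2 = f 1 ^+ 2 * f 1 by ring.
by rewrite E; field.
Qed.

End sobolev_one_consequences.

(** * Fubini and Tonelli on rectangles *)

Section fubini_box.
Context {R : realType}.
Local Notation mu := (@lebesgue_measure R).
Implicit Types (u : R -> R -> R) (D E : set R).

(** The extension by zero to the plane, to which the theorems of Fubini and Tonelli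
    for the product measure apply. *)
Definition box_fun D E u : R * R -> R := (fun p => u p.1 p.2) \_ (D `*` E).

Lemma measurable_box_fun D E u : measurable D -> measurable E ->
  measurable_fun (D `*` E : set (R * R)) (fun p : R * R => u p.1 p.2) ->
  measurable_fun setT (EFin \o box_fun D E u).
Proof.
move=> mD mE mu_; apply/measurable_EFinP.
apply/(measurable_restrictT _ _).1 => //; exact: measurableX.
Qed.

Lemma box_slice D E u t : (fun x => box_fun D E u (t, x)) =
  if t \in D then (u t) \_ E else cst 0.
Proof.
apply/funext => x; rewrite /box_fun patchE in_setX /=.
by case: (t \in D); rewrite //= patchE.
Qed.

Lemma box_slice2 D E u x : (fun t => box_fun D E u (t, x)) =
  if x \in E then (u ^~ x) \_ D else cst 0.
Proof.
apply/funext => t; rewrite /box_fun patchE in_setX /= andbC.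
by case: (x \in E); rewrite //= patchE.
Qed.

Lemma integral_box_slice D E u t : (\int[mu]_x (box_fun D E u (t, x))%:E =
  (if t \in D then \int[mu]_(x in E) (u t x)%:E else 0))%E.
Proof.
rewrite (_ : (fun x => _) = EFin \o (fun x => box_fun D E u (t, x))) //.
rewrite box_slice; case: ifPn => tD; last by rewrite integral0_eq.
by rewrite [RHS]integral_mkcond restrict_EFin.
Qed.

Lemma integral_box_slice2 D E u x : (\int[mu]_t (box_fun D E u (t, x))%:E =
  (if x \in E then \int[mu]_(t in D) (u t x)%:E else 0))%E.
Proof.
rewrite (_ : (fun t => _) = EFin \o (fun t => box_fun D E u (t, x))) //.
rewrite box_slice2; case: ifPn => tD; last by rewrite integral0_eq.
by rewrite [RHS]integral_mkcond restrict_EFin.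
Qed.

Lemma tonelli_box_measurable D E u : measurable D -> measurable E ->
  measurable_fun (D `*` E : set (R * R)) (fun p : R * R => u p.1 p.2) ->
  (forall t x, D t -> E x -> 0 <= u t x) ->
  measurable_fun D (fun t => \int[mu]_(x in E) (u t x)%:E)%E.
Proof.
move=> mD mE mu_ u0.
have mF := measurable_box_fun mD mE mu_.
have F0 p : (0 <= (EFin \o box_fun D E u) p)%E.
  rewrite lee_fin /box_fun patchE; case: ifPn => //; rewrite inE => -[? ?]; exact: u0.
have := measurable_fun_fubini_tonelli_F (m2 := mu) _ mF F0.
move=> /(measurable_funTS (D := D)); apply: eq_measurable_fun => t /[!inE] Dt.
by rewrite /fubini_F /= integral_box_slice mem_set.
Qed.

Section integrable_box.
Variables (D E : set R) (u : R -> R -> R).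
Hypotheses (mD : measurable D) (mE : measurable E).
Hypothesis mu_ : measurable_fun (D `*` E : set (R * R)) (fun p : R * R => u p.1 p.2).
Hypothesis fin : (\int[mu]_(t in D) \int[mu]_(x in E) `|u t x|%:E < +oo)%E.

Let F := EFin \o box_fun D E u.

Let intF : (mu \x mu)%E.-integrable setT F.
Proof.
apply/(integrable12ltyP _ _); first exact: measurable_box_fun.
apply: le_lt_trans fin; rewrite le_eqVlt; apply/orP; left; apply/eqP.
rewrite [RHS]integral_mkcond; apply: eq_integral => t _; rewrite patchE.
rewrite -(integral_box_slice D E (fun t x => `|u t x|)); apply: eq_integral => x _ /=.
by congr EFin; rewrite /box_fun !patchE; case: ifP => // _; rewrite normr0.
Qed.

Let integrable_G : mu.-integrable setT (fubini_G mu F).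
Proof.
have mF := measurable_int _ intF.
have mA := measurableT_comp (@abse_measurable R setT) mF.
apply/integrableP; split; first exact: measurable_fubini_G intF.
have := (integrable21ltyP _ _ mF).1 intF; apply: le_lt_trans.
apply: ge0_le_integral => //.
- by apply: measurableT_comp => //; exact: measurable_fubini_G intF.
- apply: (measurable_fun_fubini_tonelli_G (m1 := mu) _ mA) => p.
  exact: abse_ge0.
- by move=> x _; apply: le_abse_integral => //; exact: measurableT_comp.
Qed.

(** The inner integrals are extended reals, finite almost everywhere; their real parts
    have the same integral. *)
Let fine_rintegrable (G : R -> \bar R) : mu.-integrable setT G ->
  rintegrable mu setT (fine \o G).
Proof.
move=> intG; apply: (le_integrable measurableT _ _ intG).
  apply/measurable_EFinP; apply: measurableT_comp => //.
  exact: measurable_int intG.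
by move=> x _ /=; case: (G x) => [r||] //=; rewrite normr0 ?leey.
Qed.

Let fine_Rintegral (G : R -> \bar R) : mu.-integrable setT G ->
  Rintegral mu setT (fine \o G) = fine (\int[mu]_x G x)%E.
Proof.
move=> intG; congr fine; apply: ae_eq_integral => //.
- by apply/measurable_EFinP/rintegrable_measurable; exact: fine_rintegrable.
- exact: measurable_int intG.
apply: (ae_imply (integrable_ae measurableT intG)) => x /(_ Logic.I) Gx _ /=.
by rewrite fineK.
Qed.

Lemma box_rintegrable1 : rintegrable mu D (fun t => \int[mu]_(x in E) u t x).
Proof.
have intFD : rintegrable mu D (fine \o fubini_F mu F).
  exact: rintegrableS (fine_rintegrable (integrable_fubini_F intF)).
apply: (eq_rintegrable _ _ intFD) => // t Dt.
by rewrite /= /fubini_F integral_box_slice mem_set.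
Qed.

Lemma box_rintegrable2 : rintegrable mu E (fun x => \int[mu]_(t in D) u t x).
Proof.
have intGE : rintegrable mu E (fine \o fubini_G mu F).
  exact: rintegrableS (fine_rintegrable (integrable_G)).
apply: (eq_rintegrable _ _ intGE) => // x Ex.
by rewrite /= /fubini_G integral_box_slice2 mem_set.
Qed.

Lemma box_fubini : \int[mu]_(t in D) \int[mu]_(x in E) u t x =
  \int[mu]_(x in E) \int[mu]_(t in D) u t x.
Proof.
have := Fubini intF => /(congr1 fine).
rewrite -(fine_Rintegral (integrable_fubini_F intF)).
rewrite -(fine_Rintegral (integrable_G)).
rewrite [in X in X -> _](_ : Rintegral mu setT _ = \int[mu]_(t in D) \int[mu]_(x in E) u t x).
  move=> ->; rewrite [RHS]Rintegral_mkcond; apply: eq_Rintegral => x _.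
  by rewrite /= /fubini_G integral_box_slice2 patchE; case: ifP.
rewrite [RHS]Rintegral_mkcond; apply: eq_Rintegral => x _.
by rewrite /= /fubini_F integral_box_slice patchE; case: ifP.
Qed.

Lemma box_ae2 : {ae mu, forall x, E x -> rintegrable mu D (u ^~ x)}.
Proof.
apply: (ae_imply (ae_integrable2 intF)) => x /= intx Ex.
have [_] := @integrable_mkcond _ _ _ mu D (EFin \o u ^~ x) mD; apply; move: intx.
rewrite (_ : (fun t => F (t, x)) = EFin \o (fun t => box_fun D E u (t, x))) //.
by rewrite box_slice2 mem_set // restrict_EFin.
Qed.

End integrable_box.

End fubini_box.

(** * Primitives in time of square integrable families *)

Section primitive_paths.
Context {R : realType}.
Local Notation mu := (@lebesgue_measure R).
Implicit Types (f g : R -> R) (T t : R) (a b : R -> R -> R).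
Local Notation I := (`]0, 1[ : set R).

Lemma ae_le_rintegrable (D : set R) f g : measurable D -> measurable_fun D f ->
  {ae mu, forall x, D x -> `|f x| <= g x} -> rintegrable mu D g ->
  rintegrable mu D f.
Proof.
move=> mD mf fg intg; have mg := rintegrable_measurable intg.
have mnf : measurable_fun D (fun x => `|f x|) by exact: measurableT_comp.
pose h x := Num.min `|f x| `|g x|.
have mh : measurable_fun D h.
  by apply: measurable_minr => //; exact: measurableT_comp.
have inth : rintegrable mu D h.
  apply: (@le_rintegrable _ _ _ mu D _ (fun x => `|g x|)) => //.
    by move=> x _; rewrite /h ger0_norm ?ge_min ?lexx ?orbT // le_min !normr_ge0.
  exact: rintegrable_norm.
apply: (@le_rintegrable _ _ _ mu D _ (fun x => `|f x|)) => //.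
apply: ae_rintegrable inth => //; apply: (ae_imply fg) => x {}fg Dx.
by rewrite /h min_l // (le_trans (fg Dx)) // ler_norm.
Qed.

(** The integral of [(f - c)^2] is nonnegative when [c] is the mean of [f]. *)
Lemma sq_Rintegral_le f t : 0 <= t -> rintegrable mu `[0, t] f ->
  rintegrable mu `[0, t] (fun s => f s ^+ 2) ->
  (\int[mu]_(s in `[0, t]) f s) ^+ 2 <= t * \int[mu]_(s in `[0, t]) (f s ^+ 2).
Proof.
move=> t0 intf intf2; set p := \int[mu]_(s in `[0, t]) f s; set q := \int[mu]_(s in `[0, t]) (f s ^+ 2).
have H c : 0 <= q - 2 * c * p + c ^+ 2 * t.
  have -> : q - 2 * c * p + c ^+ 2 * t = \int[mu]_(s in `[0, t]) (f s - c) ^+ 2.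
    rewrite [RHS](_ : _ = \int[mu]_(s in `[0, t]) (f s ^+ 2 + - (2 * c) * f s + c ^+ 2)).
      have iZ : rintegrable mu `[0, t] (fun s => - (2 * c) * f s) by exact: rintegrableZ.
      have iD : rintegrable mu `[0, t] (fun s => f s ^+ 2 + - (2 * c) * f s).
        exact: rintegrableD.
      have iC : rintegrable mu `[0, t] (fun=> c ^+ 2).
        by apply: continuous_rintegrable; apply: continuous_subspaceT => x; exact: cvg_cst.
      rewrite RintegralD // RintegralD // RintegralZl // Rintegral_cst_cc //.
      by rewrite -/p -/q; ring.
    by apply: eq_Rintegral => x _; ring.
  by apply: Rintegral_ge0 => x _; exact: sqr_ge0.
move: t0; rewrite le_eqVlt => /predU1P[t0|t0].
  by rewrite /p -t0 set_itv1 Rintegral_set1 expr0n mul0r.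
have := H (p / t).
have -> : q - 2 * (p / t) * p + (p / t) ^+ 2 * t = (t * q - p ^+ 2) / t by field; rewrite gt_eqF.
by rewrite pmulr_lge0 ?invr_gt0 // subr_ge0.
Qed.

Lemma measurable_box_slice (D E : set R) (u : R -> R -> R) x : measurable D -> measurable E ->
  measurable_fun (D `*` E : set (R * R)) (fun p : R * R => u p.1 p.2) -> E x ->
  measurable_fun D (u ^~ x).
Proof.
move=> mD mE m Ex.
apply: (@measurable_comp _ _ _ _ _ _ (D `*` E) (fun p : R * R => u p.1 p.2) D (fun t => (t, x))) => //.
- exact: measurableX.
- by move=> _ [t Dt <-].
- by apply: measurable_funTS; exact: pair2_measurable.
Qed.

Lemma measurable_box_snd (D E : set R) f : measurable D -> measurable E -> measurable_fun E f ->
  measurable_fun (D `*` E : set (R * R)) (fun p : R * R => f p.2).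
Proof.
move=> mD mE mf.
apply: (@measurable_comp _ _ _ _ _ _ E f (D `*` E) snd) => //.
  by move=> _ [[s y] [] /= _ Ey <-].
by apply: measurable_funTS; exact: measurable_snd.
Qed.

Lemma measurable_box_fst (D E : set R) f : measurable D -> measurable E -> measurable_fun D f ->
  measurable_fun (D `*` E : set (R * R)) (fun p : R * R => f p.1).
Proof.
move=> mD mE mf.
apply: (@measurable_comp _ _ _ _ _ _ D f (D `*` E) fst) => //.
  by move=> _ [[s y] [] /= Dy _ <-].
by apply: measurable_funTS; exact: measurable_fst.
Qed.

(** Elements of [L^2(0, T; L^2(0, 1))], with every time slice in [L^2]. *)
Definition L2family T a' :=
  [/\ measurable_fun (`[0, T] `*` `]0, 1[ : set (R * R)) (fun p : R * R => a' p.1 p.2),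
      forall t : R, 0 <= t <= T -> L2 (a' t) &
      rintegrable mu `[0, T] (fun t => L2norm (a' t) ^+ 2)].

Lemma L2familyS T t a' : t <= T -> L2family T a' -> L2family t a'.
Proof.
move=> tT [m La inta]; split.
- apply: measurable_funS m => //; first exact: measurableX.
  move=> [s x] /= []; rewrite !in_itv /= => /andP[s0 st] x01; split=> //.
  by rewrite s0 (le_trans st).
- by move=> s /andP[s0 st]; apply: La; rewrite s0 (le_trans st).
- by apply: rintegrableS inta => //; apply: subset_itvl; rewrite bnd_simp.
Qed.

Lemma L2family_L2norm T a' : L2family T a' ->
  rintegrable mu `[0, T] (fun t => L2norm (a' t)).
Proof.
move=> [m La inta].
have E : (fun t => L2norm (a' t)) = Num.sqrt \o (fun t => L2norm (a' t) ^+ 2).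
  by apply/funext => t /=; rewrite sqrtr_sqr ger0_norm // L2norm_ge0.
apply: (@le_rintegrable _ _ _ mu _ _ (fun t => 1 + L2norm (a' t) ^+ 2)) => //.
- rewrite E; apply: measurableT_comp; last exact: rintegrable_measurable inta.
  by apply: continuous_measurable_fun; exact: sqrt_continuous.
- move=> t _; rewrite ger0_norm ?L2norm_ge0 //; move: (L2norm _) => p; nra.
- apply: rintegrableD => //.
  by apply: continuous_rintegrable; apply: continuous_subspaceT => x; exact: cvg_cst.
Qed.

Section box.
Variables (T : R) (a' : R -> R -> R) (f : R -> R).
Hypotheses (Ha : L2family T a') (Lf : L2 f).

Lemma L2family_box_measurable :
  measurable_fun (`[0, T] `*` `]0, 1[ : set (R * R)) (fun p : R * R => a' p.1 p.2 * f p.2).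
Proof.
have [m La inta] := Ha; apply: measurable_funM => //.
by apply: measurable_box_snd => //; exact: L2_measurable.
Qed.

(** [2 |a' f| <= a'^2 + f^2] reduces integrability on the rectangle to that of the
    squared norms. *)
Lemma L2family_box_fin :
  (\int[mu]_(t in `[0%R, T]) \int[mu]_(x in `]0%R, 1%R[) `|a' t x * f x|%:E < +oo)%E.
Proof.
have [m La inta] := Ha.
have intb : rintegrable mu `[0, T] (fun t => L2norm (a' t) ^+ 2 + L2norm f ^+ 2).
  apply: rintegrableD => //.
  by apply: continuous_rintegrable; apply: continuous_subspaceT => x; exact: cvg_cst.
move: (intb) => /integrableP[mb]; apply: le_lt_trans.
apply: ge0_le_integral => //.
- by move=> t _; apply: integral_ge0 => x _; rewrite lee_fin.
- apply: (tonelli_box_measurable (u := fun t x => `|a' t x * f x|)) => //.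
  by apply: measurableT_comp => //; exact: L2family_box_measurable.
- exact: measurableT_comp.
move=> t; rewrite /= in_itv /= => t0T.
have La' := La _ t0T.
have intaf : rintegrable mu I (fun x => `|a' t x * f x|).
  by apply: rintegrable_norm => //; exact: L2_mul.
rewrite EFin_Rintegral // lee_fin; apply: le_trans (ler_norm _).
rewrite !L2normK /inner -RintegralD //; try exact: L2_mul.
apply: le_Rintegral => //; first by apply: rintegrableD => //; exact: L2_mul.
by move=> x _; rewrite ler_norml; apply/andP; split; nra.
Qed.

End box.

Lemma L2family_ae T a' : L2family T a' ->
  {ae mu, forall x, I x -> rintegrable mu `[0, T] (a' ^~ x)}.
Proof.
move=> Ha; have L1 := L2_cst (1 : R).
have := box_ae2 (measurable_itv _) (measurable_itv _) (L2family_box_measurable Ha L1)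
  (L2family_box_fin Ha L1).
move=> H; apply: (ae_imply H) => x {}H Ix; apply: (eq_rintegrable _ _ (H Ix)) => // t _.
by rewrite mulr1.
Qed.

Lemma L2family_sq_box_fin T a' : L2family T a' ->
  (\int[mu]_(t in `[0%R, T]) \int[mu]_(x in `]0%R, 1%R[) `|a' t x ^+ 2|%:E < +oo)%E.
Proof.
move=> [m La inta]; move: (inta) => /integrableP[mb]; apply: le_lt_trans.
rewrite le_eqVlt; apply/orP; left; apply/eqP; apply: eq_integral => t.
rewrite inE /= in_itv /= => t0T; have Lt := La _ t0T.
rewrite ger0_norm ?sqr_ge0 // L2normK /inner -EFin_Rintegral //; last exact: L2_mul.
by apply: eq_integral => x _; rewrite ger0_norm ?sqr_ge0 // expr2.
Qed.

Definition primitive a' t x : R := \int[mu]_(s in `[0, t]) a' s x.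

Lemma primitive0 a' : primitive a' 0 = fun=> 0.
Proof. by apply/funext => x; rewrite /primitive set_itv1 Rintegral_set1. Qed.

(** By Cauchy-Schwarz in time, the square of the primitive is at most [T] times the
    integral of the square, which is integrable in space. *)
Lemma L2_primitive T a' : 0 <= T -> L2family T a' -> L2 (primitive a' T).
Proof.
move=> T0 Ha; have L1 := L2_cst (1 : R); have [m La inta] := Ha.
have intp : rintegrable mu I (primitive a' T).
  have := box_rintegrable2 (measurable_itv _) (measurable_itv _)
    (L2family_box_measurable Ha L1) (L2family_box_fin Ha L1).
  move=> H; apply: (eq_rintegrable _ _ H) => // x _; apply: eq_Rintegral => t _.
  by rewrite mulr1.
have mp := rintegrable_measurable intp.
split=> //.
have m2 : measurable_fun (`[0, T] `*` `]0, 1[ : set (R * R)) (fun p : R * R => a' p.1 p.2 ^+ 2).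
  exact: measurable_funX.
have Hi := box_rintegrable2 (u := fun t x => a' t x ^+ 2) (measurable_itv _) (measurable_itv _) m2 (L2family_sq_box_fin Ha).
have Hae := box_ae2 (u := fun t x => a' t x ^+ 2) (measurable_itv _) (measurable_itv _) m2 (L2family_sq_box_fin Ha).
apply: (@ae_le_rintegrable I _ (fun x => T * \int[mu]_(s in `[0, T]) (a' s x ^+ 2))) => //.
- exact: measurable_funX.
- apply: (ae_imply (ae_and Hae (L2family_ae Ha))) => x [H1 H2] Ix.
  rewrite ger0_norm ?sqr_ge0 //; apply: sq_Rintegral_le => //; [exact: H2|exact: H1].
- exact: rintegrableZ.
Qed.

(** Pairing with [f] commutes with integration in time by Fubini. *)
Lemma acpath_primitive T a' : 0 <= T -> L2family T a' ->
  acpath T (primitive a') a'.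
Proof.
move=> T0 Ha; have [m La inta] := Ha; split => //.
- by move=> t /andP[t0 tT]; apply: L2_primitive => //; exact: L2familyS Ha.
- exact: L2family_L2norm.
move=> f Lf; split.
  exact: (box_rintegrable1 (measurable_itv _) (measurable_itv _)
    (L2family_box_measurable Ha Lf) (L2family_box_fin Ha Lf)).
move=> t /andP[t0 tT].
have -> : inner (primitive a' 0) f = 0.
  by rewrite primitive0 inner0l.
rewrite add0r; have Ht := L2familyS tT Ha.
have Lp := L2_primitive t0 Ht.
have := box_fubini (measurable_itv _) (measurable_itv _)
    (L2family_box_measurable Ht Lf) (L2family_box_fin Ht Lf).
rewrite /inner => ->.
have int2 := box_rintegrable2 (measurable_itv _) (measurable_itv _)
    (L2family_box_measurable Ht Lf) (L2family_box_fin Ht Lf).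
apply: Rintegral_ae_eq => //.
- by apply: measurable_funM; exact: L2_measurable.
- exact: rintegrable_measurable int2.
apply: (ae_imply (L2family_ae Ht)) => x H Ix; rewrite RintegralZr //; exact: H.
Qed.

Lemma acpath_of_ae T a a' : 0 <= T -> L2family T a' ->
  (forall t : R, 0 <= t <= T -> L2 (a t)) ->
  (forall t : R, 0 <= t <= T ->
     {ae mu, forall x, I x -> a t x = a 0 x + primitive a' t x}) ->
  acpath T a a'.
Proof.
move=> T0 Ha La aP; have [LP La' inta ipP] := acpath_primitive T0 Ha.
split=> // f Lf; have [intf HP] := ipP f Lf; split=> // t t0T.
have o0 : 0 <= (0 : R) <= T by rewrite lexx.
have := HP t t0T; have -> : inner (primitive a' 0) f = 0.
  by rewrite primitive0 inner0l.
rewrite add0r => <-; rewrite -innerDl //; try exact: La; try exact: LP.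
apply: ae_inner => //; first exact: La.
- by apply: L2D; [exact: La|exact: LP].
- exact: aP.
Qed.

(** The derivative of a vanishing primitive is 0, and it is equal to the integrand
    almost everywhere by Lebesgue's differentiation theorem. *)
Lemma ae_eq0_of_primitive f : L2 f ->
  (forall x : R, 0 <= x <= 1 -> \int[mu]_(y in `[0, x]) f y = 0) ->
  {ae mu, forall x, I x -> f x = 0}.
Proof.
move=> Lf H; pose g := f \_ `[0, 1].
have intf : rintegrable mu `[0, 1] f by apply: rintegrable_oo_cc; exact: L2_rintegrable.
have intg : mu.-integrable setT (EFin \o g).
  have [+ _] := @integrable_mkcond _ _ _ mu `[0, 1] (EFin \o f) (measurable_itv _).
  by rewrite restrict_EFin; apply.
have locg : locally_integrable setT g by apply: open_integrable_locally => //; exact: openT.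
have intgy y : mu.-integrable `]-oo, y] (EFin \o g) by exact: integrableS intg.
have F0 : (fun x => \int[mu]_(t in `]-oo, x]) g t) = cst 0.
  apply/funext => x /=; rewrite /g -Rintegral_mkcondr.
  have [x0|x0] := ltP x 0.
    rewrite (_ : _ `&` _ = set0) ?Rintegral_set0 //.
    apply/seteqP; split => // y [] /=; rewrite !in_itv /= => yx /andP[y0 _].
    by have := lt_le_trans x0 (le_trans y0 yx); rewrite ltxx.
  have [x1|x1] := leP x 1.
    rewrite (_ : _ `&` _ = `[0, x]) ?H ?x0 //.
    apply/seteqP; split => y /=; rewrite !in_itv /=; first by move=> [-> /andP[->]].
    by move=> /andP[-> yx]; rewrite yx (le_trans yx).
  rewrite (_ : _ `&` _ = `[0, 1]) ?H ?ler01 ?lexx //.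
  apply/seteqP; split => y /=; rewrite !in_itv /=; first by case.
  by move=> /andP[-> y1]; rewrite y1 (le_trans y1 (ltW x1)).
apply: (ae_imply (FTC1Ny intgy locg)) => x /= [_]; rewrite F0 derive1_cst => gx Ix.
rewrite gx /g patchE mem_set //; exact: subset_itv_oo_cc Ix.
Qed.

End primitive_paths.

(** * Space derivatives and boundary values of curves *)

Section derivative_paths.
Context {R : realType}.
Local Notation mu := (@lebesgue_measure R).
Implicit Types (f g : R -> R) (T t : R) (a b : R -> R -> R).
Local Notation I := (`]0, 1[ : set R).

(** Du Bois-Reymond's lemma for the zero function: its primitive does not depend on
    the end point. *)
Lemma ae_eq0_of_weak_derivative f : L2 f ->
  weak_derivative (fun=> 0 : R) f -> {ae mu, forall x, I x -> f x = 0}.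
Proof.
move=> Lf wf; apply: ae_eq0_of_primitive => //.
have intf : rintegrable mu `[0, 1] f by apply: rintegrable_oo_cc; exact: L2_rintegrable.
have HG := ac_primitive 0 (@ler01 R) intf.
set G := fun t : R => _ in HG.
have c0 : {within `[0, 1], continuous (cst 0 : R -> R)}.
  by apply: continuous_subspaceT => x; exact: cvg_cst.
(* at the end points themselves no test function is available *)
have key (a b : R) : 0 < a -> a < b -> b < 1 -> G a = G b.
  move=> a0 ab b1; have := weak_derivative_increment c0 Lf wf a0 ab b1.
  rewrite -(ac_increment HG (ltW a0)) ?(ltW (lt_trans ab b1)) //.
  rewrite -(ac_increment HG (ltW (lt_trans a0 ab))) ?(ltW b1) //.
  by move: (G a) (G b) (G 1) => p q r; lra.
have const (x : R) : 0 < x < 1 -> G x = G (2^-1).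
  move=> /andP[x0 x1]; have [xlt|xgt|->//] := ltgtP x 2^-1.
    by apply: key => //; rewrite invf_lt1 // ltr1n.
  by apply/esym/key => //; rewrite invr_gt0.
have cG : {within `[0, 1], continuous G} by exact: ac_continuous HG.
have E := eq_at_endpoints cG const.
move=> x x01; have := E x x01; rewrite -(E 0) ?lexx ?ler01 //.
by rewrite /G set_itv1 Rintegral_set1 !add0r.
Qed.

Lemma test_function_L2 (phi : R -> R) : test_function phi ->
  L2 phi /\ L2 (derive1 phi).
Proof.
move=> [dphi cphi _]; split; apply: L2_within_continuous; apply: continuous_subspaceT => //.
by move=> x; apply: differentiable_continuous; apply/derivable1_diffP; exact: dphi.
Qed.

(** The space derivative [b] of a curve [a] is again a curve: for a test function
    [phi], [(b(t), phi) = - (a(t), phi')] is absolutely continuous with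
    derivative [- (a'(t), phi') = (b'(t), phi)].  Hence [b(t) - b(0)] and the
    primitive of [b'] have the same pairing with every test function, and they are
    equal almost everywhere. *)
Lemma acpath_weak_derivative T a a' b b' : 0 <= T -> acpath T a a' ->
  (forall t : R, 0 <= t <= T -> L2 (b t)) -> L2family T b' ->
  (forall t : R, 0 <= t <= T -> weak_derivative (a t) (b t)) ->
  (forall t : R, 0 <= t <= T -> weak_derivative (a' t) (b' t)) ->
  acpath T b b'.
Proof.
move=> T0 Pa Lb Fb wab wab'; have [La La' _ ipa] := Pa.
have [LP Lb' _ ipP] := acpath_primitive T0 Fb.
have o0 : 0 <= (0 : R) <= T by rewrite lexx.
apply: acpath_of_ae => // t t0T; have /andP[t0 tT] := t0T.
have Lbt := Lb _ t0T; have Lb0 := Lb _ o0; have LPt := LP _ t0T.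
pose D x := b t x - (b 0 x + primitive b' t x).
have LD : L2 D by apply: L2B => //; exact: L2D.
have wD : weak_derivative (fun=> 0) D.
  move=> phi tphi; have [Lphi Ldphi] := test_function_L2 tphi.
  rewrite inner0l.
  have HP := (ipP _ Lphi).2 t t0T; have Ha := (ipa _ Ldphi).2 t t0T.
  have P0 : inner (primitive b' 0) phi = 0 by rewrite primitive0 inner0l.
  have Eint : \int[mu]_(s in `[0, t]) inner (b' s) phi = - \int[mu]_(s in `[0, t]) inner (a' s) (derive1 phi).
    rewrite -mulN1r -RintegralZl //; last exact: ac_sub (ipa _ Ldphi).
    apply: eq_Rintegral => s; rewrite inE /= in_itv /= => /andP[s0 st].
    by rewrite wab' ?mulN1r ?opprK // s0 (le_trans st).
  have := wab _ t0T phi tphi; have := wab _ o0 phi tphi.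
  rewrite innerBl // ?innerDl //; last exact: L2D.
  move: HP; rewrite P0 Eint Ha.
  move: (inner _ _) (inner _ _) (inner _ _) (inner _ _) (Rintegral _ _ _) => p q r s u.
  by move=> -> ? ?; lra.
by apply: (ae_imply (ae_eq0_of_weak_derivative LD wD)) => x H /H /eqP; rewrite subr_eq0 => /eqP.
Qed.

Lemma L2_id : L2 (fun x : R => x).
Proof. by apply: L2_within_continuous; apply: continuous_subspaceT => x; exact: cvg_id. Qed.

Lemma ac_id T : ac T (fun x : R => x) (fun=> 1).
Proof.
split; first by apply: continuous_rintegrable; apply: continuous_subspaceT => x; exact: cvg_cst.
by move=> t /andP[t0 tT]; rewrite Rintegral_cst_cc // mul1r add0r.
Qed.

(** The derivative of [x f(x)] is integrated: a boundary value is a continuous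
    functional of the function and of its derivative in [L^2]. *)
Lemma trace_right f g : L2 f -> L2 g -> ac 1 f g ->
  f 1 = inner f (fun=> 1) + inner g (fun x => x).
Proof.
move=> Lf Lg Hf; have L1 := L2_cst (1 : R); have Li := L2_id.
have [_ /(_ 1)] := acM (@ler01 R) Hf (ac_id 1).
rewrite ler01 lexx => /(_ isT); rewrite mulr1 mulr0 add0r => ->.
rewrite !inner_cc // RintegralD //; try (by apply: rintegrable_oo_cc; exact: L2_mul).
by rewrite addrC.
Qed.

Lemma trace_left f g : L2 f -> L2 g -> ac 1 f g ->
  f 0 = inner f (fun=> 1) + inner g (fun x => x) - inner g (fun=> 1).
Proof.
move=> Lf Lg Hf; rewrite -(trace_right Lf Lg Hf).
have [_ /(_ 1)] := Hf; rewrite ler01 lexx => /(_ isT) ->.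
rewrite inner_cc //; last exact: L2_cst.
have -> : \int[mu]_(x in `[0, 1]) (g x * 1) = \int[mu]_(x in `[0, 1]) g x.
  by apply: eq_Rintegral => x _; rewrite mulr1.
by rewrite addrK.
Qed.

(** The traces are fixed linear functionals of the curves [a] and [b]. *)
Lemma ac_trace T a a' b b' : acpath T a a' -> acpath T b b' ->
  (forall t : R, 0 <= t <= T -> ac 1 (a t) (b t)) ->
  (forall t : R, 0 <= t <= T -> ac 1 (a' t) (b' t)) ->
  ac T (fun t => a t 0) (fun t => a' t 0) /\ ac T (fun t => a t 1) (fun t => a' t 1).
Proof.
move=> [La La' _ ipa] [Lb Lb' _ ipb] Hab Hab'.
have L1 := L2_cst (1 : R); have Li := L2_id.
have H1 := acD (ipa _ L1) (ipb _ Li).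
split; last first.
  by apply: (eq_ac H1) => t t0T; apply/esym/trace_right; auto.
by apply: (eq_ac (acB H1 (ipb _ L1))) => t t0T; apply/esym/trace_left; auto.
Qed.

End derivative_paths.

(** * The energy estimates for scalar functions of time *)

Section scalar_energy.
Context {R : realType}.
Local Notation mu := (@lebesgue_measure R).

Lemma ac_rint (T : R) (F f : R -> R) : 0 <= T -> ac T F f -> rintegrable mu `[0, T] F.
Proof. by move=> T0 HF; apply: continuous_rintegrable; exact: ac_continuous HF. Qed.

Lemma fourth_ge0 (p : R) : 0 <= p ^+ 4.
Proof. by rewrite (exprM p 2 2) sqr_ge0. Qed.

(** The difference of the two sides is [(c |b| - b^2 / 3)^2 / c].  The coefficients
    of the cubic feedback are tuned to this inequality. *)
Lemma cubic_young (c b : R) : 0 < c ->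
  2 / 3 * `|b ^+ 3| <= c * b ^+ 2 + (9 * c)^-1 * b ^+ 4.
Proof.
move=> c0.
have -> : c * b ^+ 2 + (9 * c)^-1 * b ^+ 4 = c^-1 * (c * `|b| - `|b| ^+ 2 / 3) ^+ 2 + 2 / 3 * `|b| ^+ 3.
  have e2 : b ^+ 2 = `|b| ^+ 2 by rewrite real_normK ?num_real.
  have e4 : b ^+ 4 = `|b| ^+ 4 by rewrite (exprM b 2 2) (exprM `|b| 2 2) -e2.
  by rewrite e2 e4; field; rewrite gt_eqF.
by rewrite normrX lerDr mulr_ge0 ?sqr_ge0 // invr_ge0 ltW.
Qed.

(** Young's inequality for a quantity [c] that satisfies a Cauchy-Schwarz bound
    [c^2 <= X Z]. *)
Lemma young_product (c X Z p q : R) : 0 <= X -> 0 <= Z -> 0 <= p -> 0 <= q ->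
  c ^+ 2 <= X * Z -> `|2 * p * q * c| <= p ^+ 2 * X + q ^+ 2 * Z.
Proof.
move=> X0 Z0 p0 q0 cXZ.
have R0 : 0 <= p ^+ 2 * X + q ^+ 2 * Z by rewrite addr_ge0 // mulr_ge0 // sqr_ge0.
rewrite -(@ler_pXn2r _ 2) ?nnegrE ?normr_ge0 // real_normK ?num_real //.
have -> : (2 * p * q * c) ^+ 2 = 4 * (p * q) ^+ 2 * c ^+ 2 by ring.
apply: (@le_trans _ _ (4 * (p * q) ^+ 2 * (X * Z))).
  by apply: ler_wpM2l => //; rewrite mulr_ge0 // sqr_ge0.
have -> : (p ^+ 2 * X + q ^+ 2 * Z) ^+ 2 = 4 * (p * q) ^+ 2 * (X * Z) + (p ^+ 2 * X - q ^+ 2 * Z) ^+ 2.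
  by ring.
by rewrite lerDl sqr_ge0.
Qed.

Variables (nu rho delta c0 c1 wd alpha beta : R).
Hypotheses (nu_gt0 : 0 < nu) (rho_gt0 : 0 < rho) (delta_gt0 : 0 < delta)
  (c0_gt0 : 0 < c0) (c1_gt0 : 0 < c1) (wd_ge0 : 0 <= wd) (alpha_ge0 : 0 <= alpha)
  (beta_gt0 : 0 < beta) (beta_nu : beta <= nu - 2 * alpha)
  (beta_delta : beta <= delta - 2 * alpha)
  (beta_c0 : beta <= c0 + wd - 2 * alpha) (beta_c1 : beta <= c1 + wd - 2 * alpha).

(** The energy of the boundary values [p] at 0 and [q] at 1; its derivative in time is
    the power [2 flux(p) p' + 2 flux(q) q'] of the boundary fluxes. *)
Definition boundary_potential (p q : R) : R :=
  ((c0 + wd) * p ^+ 2 + (9 * c0)^-1 * p ^+ 4) + ((c1 + wd) * q ^+ 2 + (9 * c1)^-1 * q ^+ 4).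

(** What the first energy estimate controls in time, in terms of
    [X = |w_x|^2], [Z = |z|^2] and the boundary values [p] and [q]. *)
Definition dissipation (X Z p q : R) : R :=
  beta * (X + p ^+ 2 + q ^+ 2) + rho * beta * Z + (3 * c0)^-1 * p ^+ 4 + (3 * c1)^-1 * q ^+ 4.

(** The multiple of the dissipation that bounds the linear terms of the second
    energy estimate; its summands take care of [X], [Z], the two squares and the
    fourth powers. *)
Definition growth : R :=
  (2 * alpha * nu + rho * delta + 2 * rho + 2 * wd ^+ 2) / beta + delta / beta
  + 2 * alpha * (c0 + wd) / beta + 2 * alpha * (c1 + wd) / beta + 2 * alpha / 3.

(** The equality is the weak form tested with [w], with [n = |w|^2] and
    [c = (z, w_x)].  The cubic boundary terms are absorbed by [cubic_young], and
    [2 alpha n] by the Poincare inequality; the terms in [rho c] cancel. *)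
Lemma first_energy_inequality (n n' X Z c p q : R) : 0 <= X -> 0 <= Z ->
  n <= X + p ^+ 2 + q ^+ 2 ->
  n' / 2 + nu * X + wd * ((q ^+ 2 - p ^+ 2) / 2) + (q ^+ 3 - p ^+ 3) / 3 + rho * c
    + flux wd c0 p * p + flux wd c1 q * q = 0 ->
  2 * alpha * (n + rho * Z) + (n' + rho * (2 * c - 2 * delta * Z)) + dissipation X Z p q <= 0.
Proof.
move=> X0 Z0 nX E.
have e0 : flux wd c0 p * p = (c0 + wd) * p ^+ 2 + 2 * ((9 * c0)^-1 * p ^+ 4).
  by rewrite /flux; field; rewrite gt_eqF.
have e1 : flux wd c1 q * q = (c1 + wd) * q ^+ 2 + 2 * ((9 * c1)^-1 * q ^+ 4).
  by rewrite /flux; field; rewrite gt_eqF.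
rewrite e0 e1 in E.
have f0 : (3 * c0)^-1 * p ^+ 4 = 3 * ((9 * c0)^-1 * p ^+ 4) by field; rewrite gt_eqF.
have f1 : (3 * c1)^-1 * q ^+ 4 = 3 * ((9 * c1)^-1 * q ^+ 4) by field; rewrite gt_eqF.
have y0 := cubic_young p c0_gt0; have y1 := cubic_young q c1_gt0.
have := ler_norm (p ^+ 3); have := ler_norm (- q ^+ 3); rewrite normrN => n1 n0.
rewrite /dissipation f0 f1.
have p2 := sqr_ge0 p; have q2 := sqr_ge0 q.
have wq : 0 <= wd * q ^+ 2 by exact: mulr_ge0.
have k1 : 2 * alpha * n <= 2 * alpha * (X + p ^+ 2 + q ^+ 2) by apply: ler_wpM2l => //; rewrite mulr_ge0.
have k2 : beta * X <= (nu - 2 * alpha) * X by exact: ler_wpM2r.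
have k3 : beta * p ^+ 2 <= (c0 + wd - 2 * alpha) * p ^+ 2 by exact: ler_wpM2r.
have k4 : beta * q ^+ 2 <= (c1 + wd - 2 * alpha) * q ^+ 2 by exact: ler_wpM2r.
have rZ : 0 <= rho * Z by rewrite mulr_ge0 // ltW.
have k5 : rho * beta * Z <= (delta - 2 * alpha) * (rho * Z).
  by rewrite mulrAC mulrC; exact: ler_wpM2r.
have k6 : 0 <= nu * X by rewrite mulr_ge0 // ltW.
have k7 : 0 <= delta * (rho * Z) by rewrite mulr_ge0 // ltW.
move: E y0 y1 n0 n1 wq k1 k2 k3 k4 k5 k6 k7.
move: (_^-1 * p ^+ 4) (_^-1 * q ^+ 4) (`|p ^+ 3|) (`|q ^+ 3|) (p ^+ 3) (q ^+ 3) (p ^+ 2) (q ^+ 2).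
by move=> p4 q4 np3 nq3 p3 q3 pp qq; nra.
Qed.

Lemma dissipation_ge0 (X Z p q : R) : 0 <= X -> 0 <= Z -> 0 <= dissipation X Z p q.
Proof.
move=> X0 Z0.
have p4 := fourth_ge0 p.
have q4 := fourth_ge0 q.
have h0 : 0 <= X + p ^+ 2 + q ^+ 2 by rewrite !addr_ge0 // sqr_ge0.
rewrite /dissipation; apply: addr_ge0; first apply: addr_ge0; first apply: addr_ge0.
- by rewrite mulr_ge0 // ltW.
- by rewrite !mulr_ge0 // ltW.
- by rewrite mulr_ge0 // invr_ge0 mulr_ge0 // ltW.
- by rewrite mulr_ge0 // invr_ge0 mulr_ge0 // ltW.
Qed.

Lemma boundary_potential_ge0 (p q : R) : 0 <= boundary_potential p q.
Proof.
have p4 := fourth_ge0 p.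
have q4 := fourth_ge0 q.
have k0 : 0 <= c0 + wd by rewrite addr_ge0 // ltW.
have k1 : 0 <= c1 + wd by rewrite addr_ge0 // ltW.
rewrite /boundary_potential; apply: addr_ge0; apply: addr_ge0; rewrite mulr_ge0 ?sqr_ge0 //.
  by rewrite invr_ge0 mulr_ge0 // ltW.
by rewrite invr_ge0 mulr_ge0 // ltW.
Qed.

Lemma growth_ge0 : 0 <= growth.
Proof.
have b1 : 0 <= (2 * alpha * nu + rho * delta + 2 * rho + 2 * wd ^+ 2) / beta.
  apply: divr_ge0; last exact: ltW.
  apply: addr_ge0; last by rewrite mulr_ge0 // sqr_ge0.
  apply: addr_ge0; last by rewrite mulr_ge0 // ltW.
  by apply: addr_ge0; rewrite !mulr_ge0 // ltW.
have b2 : 0 <= delta / beta by rewrite divr_ge0 // ltW.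
have b3 : 0 <= 2 * alpha * (c0 + wd) / beta by apply: divr_ge0; [rewrite !mulr_ge0 // addr_ge0 // ltW|exact: ltW].
have b4 : 0 <= 2 * alpha * (c1 + wd) / beta by apply: divr_ge0; [rewrite !mulr_ge0 // addr_ge0 // ltW|exact: ltW].
have b5 : 0 <= 2 * alpha / 3 by rewrite divr_ge0 // mulr_ge0.
rewrite /growth; apply: addr_ge0 => //; apply: addr_ge0 => //; apply: addr_ge0 => //; exact: addr_ge0.
Qed.

(** Collects the terms of the derivative of
    [e^(2 alpha t) (nu X + E + 2 rho c)] that do not involve [w_t] or the
    convection. *)
Lemma second_energy_inequality (X Z c p q : R) : 0 <= X -> 0 <= Z ->
  c ^+ 2 <= X * Z ->
  2 * alpha * (nu * X + boundary_potential p q + 2 * rho * c) + 2 * rho * (X - delta * c)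
    + 2 * wd ^+ 2 * X <= growth * dissipation X Z p q.
Proof.
move=> X0 Z0 cXZ.
have : `|2 * 1 * 1 * c| <= 1 ^+ 2 * X + 1 ^+ 2 * Z by exact: young_product.
rewrite !mulr1 !expr1n !mul1r => c2.
have cc : (2 * alpha - delta) * (2 * rho * c) <= rho * delta * (X + Z).
  have -> : (2 * alpha - delta) * (2 * rho * c) = - ((delta - 2 * alpha) * rho * (2 * c)) by ring.
  apply: le_trans (ler_norm _) _; rewrite normrN normrM.
  have d0 : 0 <= delta - 2 * alpha by apply: le_trans beta_delta; exact: ltW.
  have r0 : 0 <= (delta - 2 * alpha) * rho by rewrite mulr_ge0 // ltW.
  rewrite (ger0_norm r0) (mulrC rho delta); apply: ler_pM => //.
  by apply: ler_wpM2r; [exact: ltW|rewrite lerBlDr lerDl mulr_ge0].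
have f0 : (3 * c0)^-1 * p ^+ 4 = 3 * ((9 * c0)^-1 * p ^+ 4) by field; rewrite gt_eqF.
have f1 : (3 * c1)^-1 * q ^+ 4 = 3 * ((9 * c1)^-1 * q ^+ 4) by field; rewrite gt_eqF.
have P4 : 0 <= (9 * c0)^-1 * p ^+ 4.
  by rewrite mulr_ge0 ?fourth_ge0 // invr_ge0 mulr_ge0 // ltW.
have Q4 : 0 <= (9 * c1)^-1 * q ^+ 4.
  by rewrite mulr_ge0 ?fourth_ge0 // invr_ge0 mulr_ge0 // ltW.
rewrite /boundary_potential /dissipation f0 f1.
set u := (9 * c0)^-1 * p ^+ 4 in P4 *; set v := (9 * c1)^-1 * q ^+ 4 in Q4 *.
have p2 := sqr_ge0 p; have q2 := sqr_ge0 q.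
move: (p ^+ 2) (q ^+ 2) p2 q2 => pp qq p2 q2.
have b1 : 0 <= (2 * alpha * nu + rho * delta + 2 * rho + 2 * wd ^+ 2) / beta.
  apply: divr_ge0; last exact: ltW.
  apply: addr_ge0; last by rewrite mulr_ge0 // sqr_ge0.
  apply: addr_ge0; last by rewrite mulr_ge0 // ltW.
  by apply: addr_ge0; rewrite !mulr_ge0 // ltW.
have b2 : 0 <= delta / beta by rewrite divr_ge0 // ltW.
have b3 : 0 <= 2 * alpha * (c0 + wd) / beta by apply: divr_ge0; [rewrite !mulr_ge0 // addr_ge0 // ltW|exact: ltW].
have b4 : 0 <= 2 * alpha * (c1 + wd) / beta by apply: divr_ge0; [rewrite !mulr_ge0 // addr_ge0 // ltW|exact: ltW].
have b5 : 0 <= 2 * alpha / 3 by rewrite divr_ge0 // mulr_ge0.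
have e1 : (2 * alpha * nu + rho * delta + 2 * rho + 2 * wd ^+ 2) / beta * beta = 2 * alpha * nu + rho * delta + 2 * rho + 2 * wd ^+ 2 by rewrite divfK // gt_eqF.
have e2 : delta / beta * beta = delta by rewrite divfK // gt_eqF.
have e3 : 2 * alpha * (c0 + wd) / beta * beta = 2 * alpha * (c0 + wd) by rewrite divfK // gt_eqF.
have e4 : 2 * alpha * (c1 + wd) / beta * beta = 2 * alpha * (c1 + wd) by rewrite divfK // gt_eqF.
rewrite /growth.
set B1 := (_ + _ + _ + _) / beta in b1 e1 *; set B2 := delta / beta in b2 e2 *.
set B3 := _ * (c0 + wd) / beta in b3 e3 *; set B4 := _ * (c1 + wd) / beta in b4 e4 *.
set B5 := _ / 3 in b5 *.
have B50 : 3 * B5 = 2 * alpha by rewrite /B5; field.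
have [K eK] : exists K, K = B1 + B2 + B3 + B4 + B5 by eexists.
have mono B y : B <= K -> 0 <= y -> B * beta * y <= K * beta * y.
  by move=> BK y0; apply: ler_wpM2r => //; apply: ler_wpM2r => //; exact: ltW.
have kX : B1 * beta * X <= K * beta * X by apply: mono => //; rewrite eK; lra.
have kp : B3 * beta * pp <= K * beta * pp by apply: mono => //; rewrite eK; lra.
have kq : B4 * beta * qq <= K * beta * qq by apply: mono => //; rewrite eK; lra.
have kZ : B2 * beta * (rho * Z) <= K * beta * (rho * Z).
  by apply: mono; [rewrite eK; lra|rewrite mulr_ge0 // ltW].
have ku : 3 * B5 * u <= 3 * K * u.
  by apply: ler_wpM2r => //; rewrite eK; lra.
have kv : 3 * B5 * v <= 3 * K * v.
  by apply: ler_wpM2r => //; rewrite eK; lra.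
rewrite e1 in kX; rewrite e2 in kZ; rewrite e3 in kp; rewrite e4 in kq.
rewrite B50 in ku kv.
rewrite -eK.
have -> : K * (beta * (X + pp + qq) + rho * beta * Z + 3 * u + 3 * v) =
  K * beta * X + K * beta * pp + K * beta * qq + K * beta * (rho * Z) + 3 * K * u + 3 * K * v by ring.
have := lerD (lerD (lerD kX kp) (lerD kq kZ)) (lerD ku kv).
move=> H; apply: le_trans (_ : _ <= _) _; last first.
  apply: le_trans H _; rewrite le_eqVlt; apply/orP; left; apply/eqP; ring.
have -> : 2 * alpha * (nu * X + ((c0 + wd) * pp + u + ((c1 + wd) * qq + v)) + 2 * rho * c) +
  2 * rho * (X - delta * c) + 2 * wd ^+ 2 * X =
  (2 * alpha - delta) * (2 * rho * c) + (2 * alpha * nu * X + 2 * rho * X + 2 * wd ^+ 2 * X) +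
  2 * alpha * (c0 + wd) * pp + 2 * alpha * (c1 + wd) * qq + 2 * alpha * u + 2 * alpha * v by ring.
move: cc; nra.
Qed.


Let weight (t : R) := expR (2 * alpha * t).

Let weight_gt0 (t : R) : 0 < weight t. Proof. exact: expR_gt0. Qed.
Let weight_ge0 (t : R) : 0 <= weight t. Proof. exact: expR_ge0. Qed.
Let weight_ge1 (t : R) : 0 <= t -> 1 <= weight t.
Proof. by move=> t0; rewrite /weight -expR0 ler_expR mulr_ge0 // mulr_ge0. Qed.

Variables (T : R) (n n' X X' Z c zv p q p' q' N : R -> R).
Hypotheses (T0 : 0 <= T) (An : ac T n n') (AX : ac T X X')
  (AZ : ac T Z (fun t => 2 * c t - 2 * delta * Z t))
  (Ac : ac T c (fun t => X t - delta * c t + zv t))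
  (Ap : ac T p p') (Aq : ac T q q') (intN : rintegrable mu `[0, T] N).
Hypothesis pos : forall t : R, 0 <= t <= T -> [/\ 0 <= n t, 0 <= X t, 0 <= Z t & 0 <= N t].
Hypothesis poincare : forall t : R, 0 <= t <= T -> n t <= X t + p t ^+ 2 + q t ^+ 2.
Hypothesis coupling : forall t : R, 0 <= t <= T -> c t ^+ 2 <= X t * Z t.
Hypothesis test_w : {ae mu, forall t : R, 0 <= t <= T ->
  n' t / 2 + nu * X t + wd * ((q t ^+ 2 - p t ^+ 2) / 2) + (q t ^+ 3 - p t ^+ 3) / 3
  + rho * c t + flux wd c0 (p t) * p t + flux wd c1 (q t) * q t = 0}.
Hypothesis test_wt : {ae mu, forall t : R, 0 <= t <= T ->
  nu * X' t + 2 * rho * zv t + 2 * flux wd c0 (p t) * p' t + 2 * flux wd c1 (q t) * q' t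
  <= - N t + (2 * wd ^+ 2 + 4 * (X t + p t ^+ 2 + q t ^+ 2)) * X t}.
Hypotheses (Z_0 : Z 0 = 0) (c_0 : c 0 = 0).

Let g t := dissipation (X t) (Z t) (p t) (q t).
Let h t := X t + p t ^+ 2 + q t ^+ 2.
Let b t := boundary_potential (p t) (q t).

Let AE : ac T weight (fun t => 2 * alpha * weight t).
Proof. exact: ac_expR. Qed.

Let A2 (F f : R -> R) : ac T F f -> ac T (fun t => F t ^+ 2) (fun t => 2 * (F t * f t)).
Proof. by move=> HF; apply: (eq_ac (acM T0 HF HF)) => t _; ring. Qed.

Let A4 (F f : R -> R) : ac T F f -> ac T (fun t => F t ^+ 4) (fun t => 4 * (F t ^+ 3 * f t)).
Proof.
by move=> HF; have H2 := A2 HF; apply: (eq_ac (A2 H2)) => t _; ring.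
Qed.

Let Ah : ac T h (fun t => X' t + 2 * (p t * p' t) + 2 * (q t * q' t)).
Proof. exact: acD (acD AX (A2 Ap)) (A2 Aq). Qed.

Let Ab : ac T b (fun t => 2 * flux wd c0 (p t) * p' t + 2 * flux wd c1 (q t) * q' t).
Proof.
have H := acD (acD (acZ (c0 + wd) (A2 Ap)) (acZ (9 * c0)^-1 (A4 Ap)))
  (acD (acZ (c1 + wd) (A2 Aq)) (acZ (9 * c1)^-1 (A4 Aq))).
apply: (eq_ac H) => // t _.
by rewrite /flux; field; rewrite !gt_eqF.
Qed.

Let intEg : rintegrable mu `[0, T] (fun t => weight t * g t).
Proof.
have H := acD (acD (acD (acZ beta Ah) (acZ (rho * beta) AZ)) (acZ (3 * c0)^-1 (A4 Ap)))
  (acZ (3 * c1)^-1 (A4 Aq)).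
exact: ac_rint (acM T0 AE H).
Qed.

Let pos_h (t : R) : 0 <= t <= T -> 0 <= h t.
Proof. by move=> /pos[_ ? _ _]; rewrite /h !addr_ge0 // sqr_ge0. Qed.

Let pos_g (t : R) : 0 <= t <= T -> 0 <= g t.
Proof. by move=> /pos[_ ? ? _]; apply: dissipation_ge0. Qed.

Let pos_b t : 0 <= b t.
Proof. exact: boundary_potential_ge0. Qed.

Lemma first_energy_estimate (t : R) : 0 <= t <= T ->
  weight t * (n t + rho * Z t) + \int[mu]_(s in `[0, t]) (weight s * g s) <= n 0.
Proof.
move=> /andP[t0 tT].
have AF := acD (acM T0 AE (acD An (acZ rho AZ))) (ac_primitive 0 T0 intEg).
have := ac_le t0 (acS tT AF) (ac_cst t (n 0)).
rewrite set_itv1 Rintegral_set1 Z_0 mulr0 !addr0 !add0r /weight mulr0 expR0 mul1r lexx.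
move=> /(_ isT); apply.
apply: (ae_imply test_w) => s test /andP[s0 st].
have s0T : 0 <= s <= T by rewrite s0 (le_trans st).
have [n0 X0 Z0 N0] := pos s0T.
have := first_energy_inequality X0 Z0 (poincare s0T) (test s0T).
rewrite -/(weight s) -(@pmulr_rle0 _ (weight s)) //; apply: le_trans.
by rewrite le_eqVlt; apply/orP; left; apply/eqP; rewrite /g; ring.
Qed.

Let EN : rintegrable mu `[0, T] (fun t => weight t * N t).
Proof.
apply: (@le_rintegrable _ _ _ mu _ _ (fun t => expR (2 * alpha * T) * N t)) => //.
- apply: measurable_funM; last exact: rintegrable_measurable intN.
  exact: rintegrable_measurable (ac_rint T0 AE).
- move=> t; rewrite /= in_itv /= => tT; have [_ _ _ N0] := pos tT.
  rewrite ger0_norm ?mulr_ge0 //; apply: ler_wpM2r => //.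
  by rewrite /weight ler_expR ler_wpM2l ?mulr_ge0 //; case/andP: tT.
- exact: rintegrableZ.
Qed.

(** The hypothesis [test_wt] is the weak form tested with [w_t] after the
    transport terms have been estimated.  The dissipation is integrated in time
    by means of the first estimate. *)
Lemma second_energy_estimate (t : R) : 0 <= t <= T ->
  weight t * (nu * X t + b t + 2 * rho * c t) + \int[mu]_(s in `[0, t]) (weight s * N s)
  <= nu * X 0 + b 0 + growth * n 0 + \int[mu]_(s in `[0, t]) (4 * h s * (weight s * X s)).
Proof.
move=> t0T; have /andP[t0 tT] := t0T.
have intK : rintegrable mu `[0, T] (fun s => growth * (weight s * g s)) by exact: rintegrableZ.
have intH : rintegrable mu `[0, T] (fun s => 4 * h s * (weight s * X s)).
  exact: ac_rint (acM T0 (acZ 4 Ah) (acM T0 AE AX)).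
have AL := acD (acM T0 AE (acD (acD (acZ nu AX) Ab) (acZ (2 * rho) Ac))) (ac_primitive 0 T0 EN).
have AR := acD (ac_primitive (nu * X 0 + b 0) T0 intK) (ac_primitive 0 T0 intH).
have := ac_le t0 (acS tT AL) (acS tT AR).
rewrite set_itv1 !Rintegral_set1 c_0 mulr0 !addr0 !add0r {1}/weight mulr0 expR0 mul1r lexx.
have -> : \int[mu]_(s in `[0, t]) (growth * (weight s * g s)) =
    growth * \int[mu]_(s in `[0, t]) (weight s * g s).
  by rewrite RintegralZl //; apply: rintegrableS intEg => //; apply: subset_itvl; rewrite bnd_simp.
move=> /(_ isT) H.
have K0 : 0 <= growth by exact: growth_ge0.
have Eg0 : \int[mu]_(s in `[0, t]) (weight s * g s) <= n 0.
  have := first_energy_estimate t0T; have [n0 _ Z0 _] := pos t0T.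
  have : 0 <= weight t * (n t + rho * Z t) by rewrite mulr_ge0 // addr_ge0 // mulr_ge0 // ltW.
  by move: (Rintegral _ _ _) (weight t * _) => u v; lra.
have KE := ler_wpM2l K0 Eg0.
apply: le_trans (H _) _; last first.
  by rewrite lerD2r lerD2l.
apply: (ae_imply test_wt) => s test /andP[s0 st].
have s0T : 0 <= s <= T by rewrite s0 (le_trans st).
have [n0 X0 Z0 N0] := pos s0T.
have := second_energy_inequality (p s) (q s) X0 Z0 (coupling s0T).
have := test s0T.
rewrite -/(b s) -/(g s) => H1 H2.
have H3 := ler_wpM2l (weight_ge0 s) (lerD H1 H2).
rewrite -subr_le0 in H3; rewrite -subr_le0; apply: le_trans H3.
by rewrite le_eqVlt; apply/orP; left; apply/eqP; rewrite /h; ring.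
Qed.


Let initial := nu * X 0 + b 0 + (growth + 2 * rho / nu) * n 0.

Let y t := weight t * (nu / 2 * X t + b t) + \int[mu]_(s in `[0, t]) (weight s * N s).

Let pos_N_int (t : R) : 0 <= t <= T -> 0 <= \int[mu]_(s in `[0, t]) (weight s * N s).
Proof.
move=> /andP[t0 tT]; apply: Rintegral_ge0 => s; rewrite /= in_itv /= => /andP[s0 st].
by have [_ _ _ N0] : [/\ 0 <= n s, 0 <= X s, 0 <= Z s & 0 <= N s];
  [apply: pos; rewrite s0 (le_trans st)|rewrite mulr_ge0].
Qed.

(** The coupling term of the second estimate is absorbed by Young's inequality, using
    the bound of the first estimate on [rho |z|^2]; the quantity [4 h X] is at
    most [8 / nu] times [h] times the energy itself. *)
Lemma gronwall_estimate (t : R) : 0 <= t <= T ->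
  y t <= initial + \int[mu]_(s in `[0, t]) (8 / nu * h s * y s).
Proof.
move=> t0T; have /andP[t0 tT] := t0T.
have H2 := second_energy_estimate t0T; have H1 := first_energy_estimate t0T.
have [n0 X0 Z0 N0] := pos t0T.
have o0 : 0 <= (0 : R) <= T by rewrite lexx.
have Eg0 : 0 <= \int[mu]_(s in `[0, t]) (weight s * g s).
  apply: Rintegral_ge0 => s; rewrite /= in_itv /= => /andP[s0 st].
  by rewrite mulr_ge0 // pos_g // s0 (le_trans st).
have cc : - (2 * rho * c t) <= nu / 2 * X t + 2 * rho / nu * (rho * Z t).
  (* the square root splits nu / 2 into the two weights of Young's inequality *)
  have e1 : Num.sqrt (nu / 2) ^+ 2 = nu / 2 by rewrite sqr_sqrtr // divr_ge0 // ltW.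
  have n20 : 0 < nu / 2 by rewrite divr_gt0.
  have s0 : 0 < Num.sqrt (nu / 2) by rewrite sqrtr_gt0.
  have Y := young_product X0 Z0 (ltW s0) (divr_ge0 (ltW rho_gt0) (ltW s0)) (coupling t0T).
  have e2 : 2 * Num.sqrt (nu / 2) * (rho / Num.sqrt (nu / 2)) * c t = 2 * rho * c t.
    by field; rewrite gt_eqF.
  rewrite e2 expr_div_n e1 in Y.
  have := ler_norm (- (2 * rho * c t)); rewrite normrN => Y'.
  apply: le_trans Y' _; apply: le_trans Y _; rewrite lerD2l le_eqVlt.
  by apply/orP; left; apply/eqP; field; rewrite gt_eqF.
have intHX : rintegrable mu `[0, t] (fun s => 4 * h s * (weight s * X s)).
  exact: ac_rint t0 (acS tT (acM T0 (acZ 4 Ah) (acM T0 AE AX))).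
have Ay := acD (acM T0 AE (acD (acZ (nu / 2) AX) Ab)) (ac_primitive 0 T0 EN).
have intHy : rintegrable mu `[0, t] (fun s => 8 / nu * h s * y s).
  have H := ac_rint t0 (acS tT (acM T0 (acZ (8 / nu) Ah) Ay)).
  by apply: (eq_rintegrable _ _ H) => // s _; rewrite add0r.
have I12 : \int[mu]_(s in `[0, t]) (4 * h s * (weight s * X s)) <=
    \int[mu]_(s in `[0, t]) (8 / nu * h s * y s).
  apply: le_Rintegral => // s; rewrite /= in_itv /= => /andP[s0 st].
  have s0T : 0 <= s <= T by rewrite s0 (le_trans st).
  have [ns0 Xs0 Zs0 Ns0] := pos s0T.
  have -> : 4 * h s * (weight s * X s) = 8 / nu * h s * (weight s * (nu / 2 * X s)).
    by field; rewrite gt_eqF.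
  apply: ler_wpM2l; first by rewrite mulr_ge0 ?pos_h // divr_ge0 // ltW.
  apply: le_trans (_ : _ <= weight s * (nu / 2 * X s + b s)) _.
    by apply: ler_wpM2l => //; rewrite lerDl.
  by rewrite /y lerDl pos_N_int.
have k1 : 0 <= 2 * rho / nu by rewrite divr_ge0 ?mulr_ge0 // ltW.
have Wn : 0 <= weight t * n t by rewrite mulr_ge0.
have H3 : weight t * (rho * Z t) <= n 0 by move: H1; rewrite mulrDr; move: (Rintegral _ _ _) Eg0 => u ? ?; lra.
have := ler_wpM2l k1 H3.
have := ler_wpM2l (weight_ge0 t) cc.
move: H2 I12; rewrite /y /initial.
move: (Rintegral _ _ _) (Rintegral _ _ _) (Rintegral _ _ _) => u v w0.
move: (weight t) => e.
have -> : (growth + 2 * rho / nu) * n 0 = growth * n 0 + 2 * rho / nu * n 0 by ring.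
have -> : e * (nu / 2 * X t + 2 * rho / nu * (rho * Z t)) =
   e * (nu / 2 * X t) + 2 * rho / nu * (e * (rho * Z t)) by ring.
have -> : e * (nu * X t + b t + 2 * rho * c t) = e * (nu / 2 * X t) + e * (nu / 2 * X t + b t) - e * (- (2 * rho * c t)).
  by field.
move: (2 * rho / nu * n 0) (2 * rho / nu * _) (growth * n 0) (e * - _) (e * (nu / 2 * X t)) (e * _) => a1 a2 a3 a4 a5 a6.
lra.
Qed.

(** Since the weight is at least 1 and [beta h] is at most the dissipation, the
    integral of [8 / nu * h] is at most [8 / (nu beta)] times the initial [n]. *)
Lemma energy_decay : y T <= initial * expR (8 / (nu * beta) * n 0).
Proof.
have TT : 0 <= T <= T by rewrite T0 lexx.
have o0 : 0 <= (0 : R) <= T by rewrite lexx.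
have Ay := acD (acM T0 AE (acD (acZ (nu / 2) AX) Ab)) (ac_primitive 0 T0 EN).
have inth : rintegrable mu `[0, T] (fun s => 8 / nu * h s) by exact: ac_rint (acZ (8 / nu) Ah).
have intHy : rintegrable mu `[0, T] (fun s => 8 / nu * h s * y s).
  have H := ac_rint T0 (acM T0 (acZ (8 / nu) Ah) Ay).
  by apply: (eq_rintegrable _ _ H) => // s _; rewrite add0r.
have n80 : 0 <= 8 / nu by rewrite divr_ge0 // ltW.
have pos_y (t : R) : 0 <= t <= T -> 0 <= y t.
  move=> t0T; have [? ? ? ?] := pos t0T; rewrite /y addr_ge0 ?pos_N_int // mulr_ge0 //.
  by rewrite addr_ge0 // mulr_ge0 // divr_ge0 // ltW.
have G := gronwall T0 inth intHy _ gronwall_estimate.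
apply: le_trans (G _) _; first by move=> t t0T; rewrite pos_y // mulr_ge0 // pos_h.
have i0 : 0 <= initial.
  have [? ? ? ?] := pos o0.
  have k1 : 0 <= 2 * rho / nu by rewrite divr_ge0 ?mulr_ge0 // ltW.
  rewrite /initial; apply: addr_ge0; last by rewrite mulr_ge0 // addr_ge0 // growth_ge0.
  by apply: addr_ge0; [rewrite mulr_ge0 // ltW|exact: pos_b].
apply: ler_wpM2l => //; rewrite ler_expR.
have [nT _ ZT _] := pos TT.
have Eg : \int[mu]_(s in `[0, T]) (weight s * g s) <= n 0.
  have := first_energy_estimate TT.
  have : 0 <= weight T * (n T + rho * Z T) by rewrite mulr_ge0 // addr_ge0 // mulr_ge0 // ltW.
  by move: (Rintegral _ _ _) (weight T * _) => u v; lra.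
have k0 : 0 <= 8 / (nu * beta) by rewrite divr_ge0 // mulr_ge0 // ltW.
apply: le_trans (ler_wpM2l k0 Eg).
rewrite -RintegralZl //; apply: le_Rintegral => //; first exact: rintegrableZ.
move=> s; rewrite /= in_itv /= => s0T; have [ns Xs Zs Ns] := pos s0T.
have -> : 8 / nu * h s = 8 / (nu * beta) * (beta * h s) by field; rewrite !gt_eqF.
apply: ler_wpM2l => //.
have hg : beta * h s <= g s.
  have r1 : 0 <= rho * beta * Z s by rewrite !mulr_ge0 // ltW.
  have r2 : 0 <= (3 * c0)^-1 * p s ^+ 4.
    by rewrite mulr_ge0 ?fourth_ge0 // invr_ge0 mulr_ge0 // ltW.
  have r3 : 0 <= (3 * c1)^-1 * q s ^+ 4.
    by rewrite mulr_ge0 ?fourth_ge0 // invr_ge0 mulr_ge0 // ltW.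
  by rewrite /g /dissipation -/(h s) -!addrA lerDl !addr_ge0.
have s0 : 0 <= s by case/andP: s0T.
apply: le_trans hg _; rewrite ler_peMl ?weight_ge1 // pos_g //.
Qed.

End scalar_energy.

(** * The constant, and families extended by zero *)

Section initial_data.
Context {R : realType}.
Variables (nu rho delta c0 c1 wd alpha beta : R).
Hypotheses (nu_gt0 : 0 < nu) (rho_gt0 : 0 < rho) (delta_gt0 : 0 < delta)
  (c0_gt0 : 0 < c0) (c1_gt0 : 0 < c1) (wd_ge0 : 0 <= wd) (alpha_ge0 : 0 <= alpha)
  (beta_gt0 : 0 < beta).

(** The sum of a constant for the factor before the exponential and one for its
    exponent; each is at most the sum. *)
Definition decay_constant : R :=
  nu + growth nu rho delta c0 c1 wd alpha beta + 2 * rho / nu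
  + (2 * (c0 + wd) + 2 * (c1 + wd) + 8 * (9 * c0)^-1 + 8 * (9 * c1)^-1)
  + (1 + 8 / (nu * beta)).

(** Here [a = |w0|], [b = |w0'|], and Agmon's inequality bounds the squares of the
    boundary values [p] and [q].  Their fourth powers are at most
    [8 (a^2 + b^2) a^2], and the factor [a^2] goes into the exponential. *)
Lemma initial_estimate (a b p q : R) : 0 <= a -> 0 <= b ->
  p ^+ 2 <= a ^+ 2 + 2 * (a * b) -> q ^+ 2 <= a ^+ 2 + 2 * (a * b) ->
  (nu * b ^+ 2 + boundary_potential c0 c1 wd p q
   + (growth nu rho delta c0 c1 wd alpha beta + 2 * rho / nu) * a ^+ 2)
  * expR (8 / (nu * beta) * a ^+ 2) <=
  decay_constant * (a ^+ 2 + b ^+ 2) * expR (decay_constant * a ^+ 2).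
Proof.
move=> a0 b0 pab qab.
have G0 : 0 <= growth nu rho delta c0 c1 wd alpha beta by exact: growth_ge0.
have r0 : 0 <= 2 * rho / nu by rewrite divr_ge0 ?mulr_ge0 // ltW.
have k0 : 0 <= 8 / (nu * beta) by rewrite divr_ge0 // mulr_ge0 // ltW.
have i0 : 0 <= (9 * c0)^-1 by rewrite invr_ge0 mulr_ge0 // ltW.
have i1 : 0 <= (9 * c1)^-1 by rewrite invr_ge0 mulr_ge0 // ltW.
have d0 : 0 <= c0 + wd by rewrite addr_ge0 // ltW.
have d1 : 0 <= c1 + wd by rewrite addr_ge0 // ltW.
set s := a ^+ 2 + b ^+ 2.
have s0 : 0 <= s by rewrite addr_ge0 // sqr_ge0.
have sq (x : R) : x ^+ 2 <= a ^+ 2 + 2 * (a * b) -> x ^+ 2 <= 2 * s.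
  by move=> H; apply: le_trans H _; rewrite /s; have := sqr_ge0 (a - b); have := sqr_ge0 a; have := sqr_ge0 b; rewrite sqrrB mulr2n; nra.
have fo (x : R) : x ^+ 2 <= a ^+ 2 + 2 * (a * b) -> x ^+ 4 <= 8 * s * a ^+ 2.
  move=> H; rewrite (exprM x 2 2).
  apply: (@le_trans _ _ ((a ^+ 2 + 2 * (a * b)) ^+ 2)).
    by rewrite lerXn2r ?nnegrE ?sqr_ge0 // (le_trans _ H) // sqr_ge0.
  have -> : (a ^+ 2 + 2 * (a * b)) ^+ 2 = (a + 2 * b) ^+ 2 * a ^+ 2 by ring.
  apply: ler_wpM2r; first exact: sqr_ge0.
  by rewrite /s; have := sqr_ge0 (2 * a - b); have := sqr_ge0 a; have := sqr_ge0 b; nra.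
have ea : 1 + a ^+ 2 <= expR (a ^+ 2) by exact: expR_ge1Dx.
have a2 : 0 <= a ^+ 2 by exact: sqr_ge0.
set G := growth _ _ _ _ _ _ _ _ in G0 *.
set M := 2 * (c0 + wd) + 2 * (c1 + wd) + 8 * (9 * c0)^-1 + 8 * (9 * c1)^-1.
have M0 : 0 <= M by rewrite /M !addr_ge0 // mulr_ge0.
set k := 8 / (nu * beta) in k0 *.
have E : boundary_potential c0 c1 wd p q <= M * s * (1 + a ^+ 2).
  rewrite /boundary_potential.
  have h1 := ler_wpM2l d0 (sq _ pab); have h2 := ler_wpM2l d1 (sq _ qab).
  have h3 := ler_wpM2l i0 (fo _ pab); have h4 := ler_wpM2l i1 (fo _ qab).
  have j1 : 0 <= (c0 + wd) * (s * a ^+ 2) by rewrite !mulr_ge0.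
  have j2 : 0 <= (c1 + wd) * (s * a ^+ 2) by rewrite !mulr_ge0.
  have j3 : 0 <= (9 * c0)^-1 * s by rewrite mulr_ge0.
  have j4 : 0 <= (9 * c1)^-1 * s by rewrite mulr_ge0.
  rewrite /M; nra.
have n0 : 0 <= nu by exact: ltW.
have S0 : 0 <= nu + G + 2 * rho / nu + M.
  by apply: addr_ge0 => //; apply: addr_ge0 => //; exact: addr_ge0.
have total : nu * b ^+ 2 + boundary_potential c0 c1 wd p q + (G + 2 * rho / nu) * a ^+ 2 <=
    (nu + G + 2 * rho / nu + M) * s * expR (a ^+ 2).
  apply: (@le_trans _ _ ((nu + G + 2 * rho / nu + M) * s * (1 + a ^+ 2))).
    have as' : a ^+ 2 <= s by rewrite /s lerDl sqr_ge0.
    have bs : b ^+ 2 <= s by rewrite /s lerDr sqr_ge0.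
    have h1 := ler_wpM2l (ltW nu_gt0) bs.
    have h2 := ler_wpM2l (addr_ge0 G0 r0) as'.
    have j : 0 <= (nu + (G + 2 * rho / nu)) * s * a ^+ 2.
      by apply: mulr_ge0 => //; apply: mulr_ge0 => //; apply: addr_ge0 => //; exact: addr_ge0.
    nra.
  by apply: ler_wpM2l => //; exact: mulr_ge0.
apply: (@le_trans _ _ ((nu + G + 2 * rho / nu + M) * s * expR (a ^+ 2) * expR (k * a ^+ 2))).
  by apply: ler_wpM2r => //; exact: expR_ge0.
rewrite -mulrA -expRD.
have C1 : nu + G + 2 * rho / nu + M <= decay_constant.
  by rewrite /decay_constant -/G -/M -/k lerDl addr_ge0.
have C2 : 1 + k <= decay_constant.
  by rewrite /decay_constant -/G -/M -/k lerDr.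
apply: ler_pM.
- exact: mulr_ge0.
- exact: expR_ge0.
- exact: ler_wpM2r.
- by rewrite ler_expR -{1}(mul1r (a ^+ 2)) -mulrDl; exact: ler_wpM2r.
Qed.

Lemma decay_constant_gt0 : 0 < decay_constant.
Proof.
have G0 : 0 <= growth nu rho delta c0 c1 wd alpha beta by exact: growth_ge0.
have r0 : 0 <= 2 * rho / nu by rewrite divr_ge0 ?mulr_ge0 // ltW.
have k0 : 0 <= 8 / (nu * beta) by rewrite divr_ge0 // mulr_ge0 // ltW.
have i0 : 0 <= (9 * c0)^-1 by rewrite invr_ge0 mulr_ge0 // ltW.
have i1 : 0 <= (9 * c1)^-1 by rewrite invr_ge0 mulr_ge0 // ltW.
have d0 : 0 <= c0 + wd by rewrite addr_ge0 // ltW.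
have d1 : 0 <= c1 + wd by rewrite addr_ge0 // ltW.
have n0 : 0 <= nu by exact: ltW.
apply: ltr_wpDl; last exact: ltr_wpDr.
apply: addr_ge0; first by apply: addr_ge0 => //; exact: addr_ge0.
by apply: addr_ge0; [apply: addr_ge0; [apply: addr_ge0|]|]; exact: mulr_ge0.
Qed.

End initial_data.

Section time_families.
Context {R : realType}.
Local Notation mu := (@lebesgue_measure R).
Local Notation I := (`]0, 1[ : set R).
Implicit Types (u : R -> R -> R) (A D : set R).

Lemma measurable_L2norm_sq D u : measurable D ->
  measurable_fun (D `*` `]0, 1[ : set (R * R)) (fun p : R * R => u p.1 p.2) ->
  measurable_fun D (fun t => L2norm (u t) ^+ 2).
Proof.
move=> mD m.
have mt := tonelli_box_measurable (u := fun t x => u t x * u t x) mD (measurable_itv _)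
  (measurable_funM m m) (fun t x _ _ => sqr_ge0 (u t x)).
apply: (eq_measurable_fun (fine \o (fun t => \int[mu]_(x in `]0%R, 1%R[) (u t x * u t x)%:E)%E)).
  by move=> t _; rewrite L2normK.
by apply: measurableT_comp.
Qed.

(** A family given for almost every time, extended by zero so that each of its time
    slices lies in [L^2]. *)
Definition on_times A u (s x : R) : R := if s \in A then u s x else 0.

Lemma on_timesE A u s : s \in A -> on_times A u s = u s.
Proof. by move=> sA; apply/funext => x; rewrite /on_times sA. Qed.

Lemma on_timesN A u s : s \notin A -> on_times A u s = fun=> 0.
Proof. by move=> /negbTE sA; apply/funext => x; rewrite /on_times sA. Qed.

Lemma sobolev_norm_sqE m (f : R -> R) :
  sobolev_norm m f ^+ 2 = \sum_(k < m.+1) L2norm (derive1n k f) ^+ 2.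
Proof. by rewrite /sobolev_norm sqr_sqrtr // sumr_ge0 // => k _; exact: sqr_ge0. Qed.

Lemma sobolev_norm1_sqE (f : R -> R) :
  sobolev_norm 1 f ^+ 2 = L2norm f ^+ 2 + L2norm (derive1 f) ^+ 2.
Proof. by rewrite sobolev_norm_sqE big_ord_recl big_ord1. Qed.

Lemma L2_on_times A u : (forall s, A s -> L2 (u s)) -> forall s, L2 (on_times A u s).
Proof.
move=> Lu s; have [sA|sA] := boolP (s \in A).
  by rewrite on_timesE //; apply: Lu; exact: set_mem.
by rewrite on_timesN //; exact: L2_cst.
Qed.

Lemma L2family_on_times m u A k (T : R) : (k <= m)%N ->
  measurable A -> A `<=` `]0, +oo[ ->
  (forall t, A t -> sobolev m (u t)) ->
  (forall j, (j <= m)%N -> measurable_fun (A `*` `]0, 1[ : set (R * R))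
            (fun p : R * R => derive1n j (u p.1) p.2)) ->
  (\int[mu]_(t in A `&` `]0%R, (T + 1)%R[) ((sobolev_norm m (u t)) ^+ 2)%:E < +oo)%E ->
  L2family T (on_times A (fun s => derive1n k (u s))).
Proof.
move=> km mA A0 Su mu_ fin.
have Lk j s : (j <= m)%N -> A s -> L2 (derive1n j (u s)).
  by move=> jm /Su[_ H _]; exact: H.
have mbox D : measurable D ->
    measurable_fun (D `*` `]0, 1[ : set (R * R))
      (fun p : R * R => on_times A (fun s => derive1n k (u s)) p.1 p.2).
  move=> mD.
  apply: (eq_measurable_fun ((fun p : R * R => derive1n k (u p.1) p.2) \_ (A `*` `]0, 1[))).
    move=> [s x]; rewrite inE /= => -[_ /= x01].
    have x01' : x \in (`]0, 1[ : set R) by rewrite inE.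
    by rewrite patchE in_setX /= x01' andbT.
  apply/(measurable_restrict _ _ _).1; [exact: measurableX|exact: measurableX|].
  by apply: measurable_funS (mu_ k km); [exact: measurableX|exact: subIsetr].
have L : forall s, L2 (on_times A (fun s => derive1n k (u s)) s).
  by apply: L2_on_times => s; exact: Lk.
split.
- exact: mbox.
- by move=> t _; exact: L.
have mN : measurable_fun `[0, T] (fun t => L2norm (on_times A (fun s => derive1n k (u s)) t) ^+ 2).
  by apply: measurable_L2norm_sq => //; exact: mbox.
apply: rintegrable_lty => //; first by move=> t _; exact: sqr_ge0.
apply: le_lt_trans fin.
have -> : (\int[mu]_(x in `[0%R, T]) (L2norm (on_times A (fun s => derive1n k (u s)) x) ^+ 2)%:E =
   \int[mu]_(x in `[0%R, T] `&` A) (L2norm (derive1n k (u x)) ^+ 2)%:E)%E.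
  rewrite [RHS]integral_mkcondr; apply: eq_integral => t _; rewrite patchE.
  case: ifPn => tA; first by rewrite on_timesE.
  by rewrite on_timesN // L2norm_cst normr0 expr0n.
have msob (j : nat) : (j <= m)%N -> measurable_fun A (fun t => L2norm (derive1n j (u t)) ^+ 2).
  by move=> jm; apply: measurable_L2norm_sq => //; exact: mu_.
have msum : measurable_fun A (fun t => sobolev_norm m (u t) ^+ 2).
  under eq_fun do rewrite sobolev_norm_sqE.
  by apply: measurable_sum => j; apply: msob; rewrite -ltnS.
have mA1 : measurable (`[0, T] `&` A : set R) by exact: measurableI.
have mA2 : measurable (A `&` `]0, T + 1[ : set R) by exact: measurableI.
(* the closed interval up to T lies in the open one up to T + 1 *)
apply: (@le_trans _ _ (\int[mu]_(x in A `&` `]0%R, (T + 1)%R[) (L2norm (derive1n k (u x)) ^+ 2)%:E)%E).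
  apply: ge0_subset_integral => //.
  - by apply/measurable_EFinP; apply: measurable_funS (msob _ km) => //; exact: subIsetl.
  - by move=> t _; rewrite lee_fin sqr_ge0.
  - move=> t [] /=; rewrite in_itv /= => /andP[_ tT] At; split=> //=.
    have := A0 _ At; rewrite /= !in_itv /= andbT => ->.
    by rewrite (le_lt_trans tT) // ltrDl.
apply: ge0_le_integral => //.
- by move=> t _; rewrite lee_fin sqr_ge0.
- by apply/measurable_EFinP; apply: measurable_funS (msob _ km) => //; exact: subIsetl.
- by apply/measurable_EFinP; apply: measurable_funS msum => //; exact: subIsetl.
move=> t _; rewrite lee_fin sobolev_norm_sqE.
rewrite (bigD1 (Ordinal (km : (k < m.+1)%N))) //= lerDl sumr_ge0 // => j _; exact: sqr_ge0.
Qed.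

End time_families.

(** * The curves attached to a solution *)

Section preliminaries.
Context {R : realType}.
Local Notation mu := (@lebesgue_measure R).
Local Notation I := (`]0, 1[ : set R).

Lemma eq_derive1_itv (f g : R -> R) : (forall x, 0 <= x <= 1 -> f x = g x) ->
  forall x, I x -> derive1 f x = derive1 g x.
Proof.
move=> fg x Ix; rewrite !derive1E; apply: near_eq_derive.
have : \forall y \near x, I y by exact: near_in_itvoo.
by apply: filterS => y; rewrite /= in_itv /= => /andP[y0 y1]; apply: fg; rewrite !ltW.
Qed.

Lemma L2familyZ (T k : R) (a : R -> R -> R) : L2family T a ->
  L2family T (fun s x => k * a s x).
Proof.
move=> [m La inta]; split.
- exact: measurable_funM.
- by move=> t t0T; apply: L2Z; exact: La.
- apply: (eq_rintegrable _ _ (rintegrableZ (k ^+ 2) _ inta)) => // t.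
  rewrite /= in_itv /= => t0T; rewrite !L2normK innerZl ?innerZr //.
  + by rewrite mulrA expr2.
  + exact: La.
  + exact: La.
  + exact: La.
  + by apply: L2Z; exact: La.
Qed.

Lemma L2norm_mul_le (f g : R -> R) (k : R) : L2 g -> L2 (fun x => f x * g x) ->
  (forall x, I x -> f x ^+ 2 <= k) ->
  L2norm (fun x => f x * g x) ^+ 2 <= k * L2norm g ^+ 2.
Proof.
move=> Lg Lfg fk; rewrite !L2normK /inner -RintegralZl //; last exact: L2_mul.
apply: le_Rintegral => //; first exact: L2_mul.
  by apply: rintegrableZ => //; exact: L2_mul.
move=> x Ix; have -> : f x * g x * (f x * g x) = f x ^+ 2 * (g x * g x) by ring.
by apply: ler_wpM2r; [rewrite -expr2 sqr_ge0|exact: fk].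
Qed.

Lemma sobolev1_sq_le (f : R -> R) (x : R) : sobolev 1 f -> 0 <= x <= 1 ->
  f x ^+ 2 <= 2 * (L2norm (derive1 f) ^+ 2 + f 0 ^+ 2).
Proof.
move=> Sf x01; have o01 : 0 <= (0 : R) <= 1 by rewrite lexx ler01.
have := sobolev1_variation Sf x01 o01; set d := L2norm _ => H.
have d0 : 0 <= d by exact: L2norm_ge0.
have H2 : (f x - f 0) ^+ 2 <= d ^+ 2.
  by rewrite -(real_normK (num_real (f x - f 0))) lerXn2r ?nnegrE.
have := sqr_ge0 (f x - 2 * f 0); nra.
Qed.

Lemma sobolevW m k (f : R -> R) : (0 < k)%N -> (k <= m)%N -> sobolev m f -> sobolev k f.
Proof.
move=> k0 km [cf Lf wf]; split.
- by move=> _; apply: cf; exact: leq_trans km.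
- by move=> j jk; apply: Lf; exact: leq_trans km.
- by move=> j jk; apply: wf; exact: leq_trans km.
Qed.

End preliminaries.

Section solution.
Context {R : realType}.
Local Notation mu := (@lebesgue_measure R).
Local Notation I := (`]0, 1[ : set R).
Variables (w : R -> R -> R) (T delta : R).
Hypotheses (T0 : 0 <= T) (cw : continuous_sobolev1 w) (tw : time_derivative_L2loc w).
Variable A : set R.
Hypotheses (mA : measurable A) (A0 : A `<=` `]0, +oo[)
  (An : mu (`]0, +oo[ `\` A) = 0%E) (SA : forall t, A t -> sobolev 2 (dt w t))
  (mdA : forall k, (k <= 2)%N -> measurable_fun (A `*` `]0, 1[ : set (R * R))
            (fun p : R * R => derive1n k (dt w p.1) p.2))
  (finA : forall T : R, 0 < T ->
        (\int[mu]_(t in A `&` `]0%R, T[) ((sobolev_norm 2 (dt w t)) ^+ 2)%:E < +oo)%E).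

Lemma ae_in_times : {ae mu, forall t : R, 0 <= t <= T -> A t}.
Proof.
exists ((`]0, +oo[ `\` A) `|` [set 0]); split.
- by apply: measurableU => //; exact: measurableD.
- by apply: null_set_setU => //; [exact: measurableD|exact: lebesgue_measure_set1].
move=> t /= /not_implyP[/andP[t0 _] At].
have [->|tn0] := eqVneq t 0; [by right|left; split=> //=].
by rewrite in_itv /= andbT lt_neqAle eq_sym tn0.
Qed.

Definition velocity := on_times A (dt w).
Definition velocity_x := on_times A (fun s => derive1 (dt w s)).

Lemma family_velocity : L2family T velocity.
Proof.
apply: (@L2family_on_times _ 2 (dt w) A 0 T) => //.
by apply: finA; rewrite ltr_wpDl.
Qed.

Lemma family_velocity_x : L2family T velocity_x.
Proof.
apply: (@L2family_on_times _ 2 (dt w) A 1 T) => //.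
by apply: finA; rewrite ltr_wpDl.
Qed.

Lemma sobolev_w (t : R) : 0 <= t -> sobolev 1 (w t).
Proof. by case: cw => + _ _; apply. Qed.

Lemma sobolev_dtw (t : R) : A t -> sobolev 1 (dt w t).
Proof. by move=> At; apply: (sobolevW _ _ (SA At)). Qed.

(** The time derivative [dt w] is replaced by zero at the exceptional times, which
    changes neither side of the integral formula. *)
Lemma acpath_w : acpath T w velocity.
Proof.
apply: (acpath_of_ae T0 family_velocity).
  by move=> t /andP[t0 _]; exact: (sobolev1_L2 (sobolev_w t0)).1.
move=> t /andP[t0 tT]; have [mdt _ /(_ t t0) H] := tw.
apply: (ae_imply H) => x {}H Ix.
have x01 : 0 < x < 1 by move: Ix; rewrite /= in_itv.
rewrite (H x01); congr (_ + _); apply: Rintegral_ae_eq => //.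
- apply/measurable_fun_itv_obnd_cbndP.
  have := measurable_box_slice (u := dt w) (measurable_itv _) (measurable_itv _) mdt Ix.
  by apply: measurable_funS => //; apply: subset_itvl.
- have [m _ _] := L2familyS tT family_velocity.
  exact: measurable_box_slice (measurable_itv _) (measurable_itv _) m Ix.
apply: (ae_imply ae_in_times) => s As; rewrite /= in_itv /= => /andP[s0 st].
by rewrite /velocity on_timesE //; apply: mem_set; apply: As; rewrite s0 (le_trans st).
Qed.

Lemma weak_derivative_velocity t : weak_derivative (velocity t) (velocity_x t).
Proof.
move=> phi tphi; have [tA|tA] := boolP (t \in A).
  rewrite /velocity /velocity_x !on_timesE //; have [_ _ wf] := sobolev_dtw (set_mem tA).
  exact: (wf 0%N isT).
by rewrite /velocity /velocity_x !on_timesN // !inner0l oppr0.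
Qed.

Lemma acpath_dxw : acpath T (dx w) velocity_x.
Proof.
apply: (acpath_weak_derivative T0 acpath_w _ family_velocity_x).
- by move=> t /andP[t0 _]; exact: (sobolev1_L2 (sobolev_w t0)).2.
- by move=> t /andP[t0 _]; have [_ _ wf] := sobolev_w t0; exact: (wf 0%N isT).
- by move=> t _; exact: weak_derivative_velocity.
Qed.

Lemma ac_boundary : ac T (fun t => w t 0) (fun t => velocity t 0) /\
  ac T (fun t => w t 1) (fun t => velocity t 1).
Proof.
apply: (ac_trace acpath_w acpath_dxw).
  by move=> t /andP[t0 _]; exact: sobolev1_ac (sobolev_w t0).
move=> t _; have [tA|tA] := boolP (t \in A).
  by rewrite /velocity /velocity_x !on_timesE //; exact: sobolev1_ac (sobolev_dtw (set_mem tA)).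
by rewrite /velocity /velocity_x !on_timesN //; exact: ac_cst.
Qed.

(** The source of [e^(delta t) z], which is a plain primitive in time whereas [z] is a
    convolution. *)
Definition weighted_wx (s x : R) : R := expR (delta * s) * dx w s x.

Lemma L2_dxw (t : R) : 0 <= t -> L2 (dx w t).
Proof. by move=> t0; exact: (sobolev1_L2 (sobolev_w t0)).2. Qed.

Lemma family_weighted_wx : L2family T weighted_wx.
Proof.
have [_ mdx _] := cw; split.
- apply: (measurable_funM (f := fun p : R * R => expR (delta * p.1))).
    apply: (measurable_box_fst (f := fun s => expR (delta * s))) => //.
    exact: rintegrable_measurable (ac_rint T0 (ac_expR delta T0)).
  apply: measurable_funS mdx; [exact: measurableX|].
  by move=> [s x] [] /=; rewrite !in_itv /= => /andP[-> _].
- by move=> t /andP[t0 _]; apply: L2Z; exact: L2_dxw.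
have AE := ac_expR delta T0.
have H := ac_rint T0 (acM T0 (acM T0 AE AE) (acpath_inner T0 acpath_dxw acpath_dxw)).
apply: (eq_rintegrable _ _ H) => // t; rewrite /= in_itv /= => /andP[t0 _].
have L := L2_dxw t0.
by rewrite L2normK innerZl ?innerZr // ?mulrA //; exact: L2Z.
Qed.

Lemma zof_ae (t : R) : 0 <= t <= T -> L2 (zof delta w t) /\
  {ae mu, forall x, I x -> zof delta w t x = expR (- delta * t) * primitive weighted_wx t x}.
Proof.
move=> /andP[t0 tT]; have F := L2familyS tT family_weighted_wx.
have E : zof delta w t = primitive (fun s x => expR (- delta * t) * weighted_wx s x) t.
  apply/funext => x; apply: eq_Rintegral => s _; rewrite /weighted_wx mulrA -expRD.
  by congr (expR _ * _); ring.
split; first by rewrite E; apply: L2_primitive => //; exact: L2familyZ.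
apply: (ae_imply (L2family_ae F)) => x H Ix.
by rewrite E /primitive RintegralZl //; exact: H.
Qed.

Lemma acpath_weighted_wx : acpath T (primitive weighted_wx) weighted_wx.
Proof. exact: acpath_primitive family_weighted_wx. Qed.

(** The curve [P] is the primitive of [weighted_wx].  It is kept abstract because only
    its derivative and these pairings matter. *)
Lemma inner_zof : exists P : R -> R -> R, acpath T P weighted_wx /\
  forall (t : R) (f : R -> R), 0 <= t <= T -> L2 f ->
    inner (zof delta w t) f = expR (- delta * t) * inner (P t) f.
Proof.
exists (primitive weighted_wx); split; first exact: acpath_weighted_wx.
move=> t f t0T Lf; have [Lz zE] := zof_ae t0T; have [Lp _ _ _] := acpath_weighted_wx.
have Lpt := Lp _ t0T; rewrite -(innerZl (expR (- delta * t)) Lpt Lf).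
by apply: ae_inner => //; exact: L2Z.
Qed.

Lemma inner_weighted_wx (t : R) (f : R -> R) : 0 <= t -> L2 f ->
  inner (weighted_wx t) f = (expR (- delta * t))^-1 * inner (dx w t) f.
Proof.
move=> t0 Lf; rewrite -expRN mulNr opprK.
exact: (innerZl (expR (delta * t)) (L2_dxw t0) Lf).
Qed.

(** The product rule for [e^(-delta t)] and [(P, w_x)]; this is the identity
    [z_t = w_x - delta z] paired with [w_x], plus the term from [w_xt]. *)
Lemma ac_zof_dxw : ac T (fun t => inner (zof delta w t) (dx w t))
  (fun t => inner (dx w t) (dx w t) - delta * inner (zof delta w t) (dx w t)
            + inner (zof delta w t) (velocity_x t)).
Proof.
have [P [acP zP]] := inner_zof.
have H := acM T0 (ac_expR (- delta) T0) (acpath_inner T0 acP acpath_dxw).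
have [Ld Lt _ _] := acpath_dxw.
apply: (eq_ac H) => t t0T; have Lx := Ld _ t0T; first by rewrite (zP _ _ t0T Lx).
have Ltx := Lt _ t0T; have /andP[t0 _] := t0T.
rewrite (zP _ _ t0T Lx) (zP _ _ t0T Ltx) (inner_weighted_wx t0 Lx).
have := expR_gt0 (- delta * t); move: (expR _) (inner _ _) (inner _ _) (inner _ _) => e p q r e0.
by field; rewrite gt_eqF.
Qed.

Lemma ac_zof_sq : ac T (fun t => inner (zof delta w t) (zof delta w t))
  (fun t => 2 * inner (zof delta w t) (dx w t)
            - 2 * delta * inner (zof delta w t) (zof delta w t)).
Proof.
have [P [acP zP]] := inner_zof.
have AE := ac_expR (- delta) T0.
have H := acM T0 AE (acM T0 AE (acpath_inner T0 acP acP)).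
have [Ld Lt _ _] := acpath_dxw; have [Lp _ _ _] := acP.
have sq (t : R) : 0 <= t <= T -> inner (zof delta w t) (zof delta w t) =
    expR (- delta * t) * (expR (- delta * t) * inner (P t) (P t)).
  move=> t0T; have [Lz _] := zof_ae t0T; have Lpt := Lp _ t0T.
  by rewrite (zP _ _ t0T Lz) innerC (zP _ _ t0T Lpt).
apply: (eq_ac H) => t t0T; first by rewrite sq.
have Lx := Ld _ t0T; have Lpt := Lp _ t0T; have /andP[t0 _] := t0T.
rewrite sq // (zP _ _ t0T Lx) (innerC (P t) (weighted_wx t)).
rewrite (inner_weighted_wx t0 Lpt) (innerC (dx w t)).
have := expR_gt0 (- delta * t); move: (expR _) (inner _ _) (inner _ _) => e p q e0.
by field; rewrite gt_eqF.
Qed.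

End solution.

(** * Decay of the energy of a solution *)

Section decay.
Context {R : realType}.
Local Notation mu := (@lebesgue_measure R).
Local Notation I := (`]0, 1[ : set R).

(** Here [m1] and [m2] stand for [(w_x, w_t)] and [(w w_x, w_t)], and [N] for
    [|w_t|^2], half of which is spent on each of them. *)
Lemma transport_young (wd X N m1 m2 S : R) : 0 <= wd -> 0 <= X -> 0 <= N -> 0 <= S ->
  m1 ^+ 2 <= X * N -> m2 ^+ 2 <= S * N ->
  - (2 * (wd * m1 + m2)) <= N + 2 * wd ^+ 2 * X + 2 * S.
Proof.
move=> wd0 X0 N0 S0 H1 H2.
have w20 : 0 <= 2 * wd by rewrite mulr_ge0.
(* the weights 2 wd and 2 leave half of N on each side after dividing by 2 *)
have Y1 := young_product X0 N0 w20 ler01 H1.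
have Y2 := young_product S0 N0 (ler0n R 2) ler01 H2.
move: Y1 Y2; rewrite !ler_norml => /andP[+ _] /andP[+ _].
by rewrite expr1n !mul1r !mulr1 exprMn; lra.
Qed.

(** The estimate at one time, multiplied by the weight.  The exact value of [|w_t|^2] is
    only known almost everywhere; [N] is a version of it that is given by the
    curve [velocity]. *)
Theorem solution_decay (nu rho delta c0 c1 wd alpha beta : R)
  (nu_gt0 : 0 < nu) (rho_gt0 : 0 < rho) (delta_gt0 : 0 < delta)
  (c0_gt0 : 0 < c0) (c1_gt0 : 0 < c1) (wd_ge0 : 0 <= wd) (alpha_ge0 : 0 <= alpha)
  (beta_gt0 : 0 < beta) (beta_nu : beta <= nu - 2 * alpha)
  (beta_delta : beta <= delta - 2 * alpha)
  (beta_c0 : beta <= c0 + wd - 2 * alpha) (beta_c1 : beta <= c1 + wd - 2 * alpha)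
  (w0 : R -> R) (w : R -> R -> R) (t : R) : 0 <= t ->
  weak_solution nu rho delta c0 c1 wd w0 w -> L2loc_sobolev 2 (dt w) ->
  exists N : R -> R, [/\ rintegrable mu `[0, t] N,
    {ae mu, forall s, 0 <= s <= t -> L2norm (dt w s) ^+ 2 = N s} &
    expR (2 * alpha * t) * (nu / 2 * L2norm (dx w t) ^+ 2 + boundary_energy c0 c1 wd w t)
    + \int[mu]_(s in `[0, t]) (expR (2 * alpha * s) * N s) <=
    decay_constant nu rho delta c0 c1 wd alpha beta * sobolev_norm 1 (w 0) ^+ 2
    * expR (decay_constant nu rho delta c0 c1 wd alpha beta * L2norm (w 0) ^+ 2)].
Proof.
move=> t0 [cw tw wfw _] [A [[mA A0] An SA mdA finA]].
have S1 := sobolev_w cw.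
have Pw := acpath_w t0 cw tw mA A0 An SA mdA finA.
have Px := acpath_dxw t0 cw tw mA A0 An SA mdA finA.
have [Ap Aq] := ac_boundary t0 cw tw mA A0 An SA mdA finA.
have Acc := @ac_zof_dxw _ w t delta t0 cw tw A mA A0 An SA mdA finA.
have AZ := @ac_zof_sq _ w t delta t0 cw tw A mA A0 An SA mdA finA.
have Lz s (s0t : 0 <= s <= t) := (@zof_ae _ w t delta t0 cw tw A mA A0 An SA mdA finA s s0t).1.
have [mV LV intN] := family_velocity t0 mA A0 SA mdA finA.
have aeA := ae_in_times t mA An.
exists (fun s => L2norm (velocity w A s) ^+ 2); split=> //.
  by apply: (ae_imply aeA) => s As /As /mem_set As'; rewrite /velocity on_timesE.
have An' := acpath_inner t0 Pw Pw; have AX := acpath_inner t0 Px Px.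
have Lw s : 0 <= s -> L2 (w s) by move=> s0; exact: (sobolev1_L2 (S1 s s0)).1.
have Lx s : 0 <= s -> L2 (dx w s) by move=> s0; exact: (sobolev1_L2 (S1 s s0)).2.
have test_w : {ae mu, forall s : R, 0 <= s <= t ->
  (inner (velocity w A s) (w s) + inner (w s) (velocity w A s)) / 2 + nu * inner (dx w s) (dx w s)
  + wd * ((w s 1 ^+ 2 - w s 0 ^+ 2) / 2) + (w s 1 ^+ 3 - w s 0 ^+ 3) / 3
  + rho * inner (zof delta w s) (dx w s) + flux wd c0 (w s 0) * w s 0
  + flux wd c1 (w s 1) * w s 1 = 0}.
  apply: (ae_imply (ae_and aeA wfw)) => s [As wfs] s0t.
  have As' := As s0t; have s0 : 0 < s by move: (A0 _ As'); rewrite /= in_itv /= andbT.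
  have Ss := S1 s (ltW s0).
  have := wfs s0 _ Ss; rewrite /weak_form.
  have -> : inner (fun x => w s x * dx w s x) (w s) = (w s 1 ^+ 3 - w s 0 ^+ 3) / 3.
    exact: inner_derive_cube.
  have -> : inner (dx w s) (w s) = (w s 1 ^+ 2 - w s 0 ^+ 2) / 2 by exact: inner_derive_self.
  rewrite /velocity on_timesE ?inE // (innerC (w s) (dt w s)) => E.
  by rewrite -[RHS]E; congr (_ + _ + _ + _ + _ + _ + _); field.
have h0 s : 0 <= inner (dx w s) (dx w s) + w s 0 ^+ 2 + w s 1 ^+ 2.
  by rewrite !addr_ge0 ?inner_ge0 // sqr_ge0.
have test_wt : {ae mu, forall s : R, 0 <= s <= t ->
  nu * (inner (velocity_x w A s) (dx w s) + inner (dx w s) (velocity_x w A s))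
  + 2 * rho * inner (zof delta w s) (velocity_x w A s)
  + 2 * flux wd c0 (w s 0) * velocity w A s 0 + 2 * flux wd c1 (w s 1) * velocity w A s 1
  <= - L2norm (velocity w A s) ^+ 2 + (2 * wd ^+ 2 + 4 * (inner (dx w s) (dx w s)
      + w s 0 ^+ 2 + w s 1 ^+ 2)) * inner (dx w s) (dx w s)}.
  apply: (ae_imply (ae_and aeA wfw)) => s [As wfs] s0t.
  have As' := As s0t; have s0 : 0 < s by move: (A0 _ As'); rewrite /= in_itv /= andbT.
  have Ss := S1 s (ltW s0); have Sd := sobolev_dtw SA As'.
  have [Ld Ldx] := sobolev1_L2 Sd; have Lxs := Lx s (ltW s0).
  have := wfs s0 _ Sd; rewrite /weak_form /velocity /velocity_x !on_timesE ?inE //.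
  rewrite -L2normK -/(dx w s).
  set m1 := inner (dx w s) (dt w s); set m2 := inner (fun x => w s x * dx w s x) (dt w s).
  set h := inner (dx w s) (dx w s) + w s 0 ^+ 2 + w s 1 ^+ 2.
  have Lm : L2 (fun x => w s x * dx w s x) by exact: sobolev1_L2_mul.
  have H1 : m1 ^+ 2 <= inner (dx w s) (dx w s) * L2norm (dt w s) ^+ 2.
    rewrite -L2normK -exprMn -(real_normK (num_real m1)) lerXn2r ?nnegrE //.
      by rewrite mulr_ge0 // L2norm_ge0.
    exact: cauchy_schwarz.
  have H2 : m2 ^+ 2 <= 2 * h * inner (dx w s) (dx w s) * L2norm (dt w s) ^+ 2.
    apply: (@le_trans _ _ (L2norm (fun x => w s x * dx w s x) ^+ 2 * L2norm (dt w s) ^+ 2)).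
      rewrite -exprMn -(real_normK (num_real m2)) lerXn2r ?nnegrE //.
        by rewrite mulr_ge0 // L2norm_ge0.
      exact: cauchy_schwarz.
    apply: ler_wpM2r; first exact: sqr_ge0.
    rewrite -[inner (dx w s) (dx w s)]L2normK; apply: L2norm_mul_le => // x.
    rewrite /= in_itv /= => /andP[x0 x1].
    apply: le_trans (sobolev1_sq_le Ss _) _; first by rewrite !ltW.
    by apply: ler_wpM2l => //; rewrite L2normK lerDl sqr_ge0.
  have Y := transport_young wd_ge0 (inner_ge0 (dx w s)) (sqr_ge0 (L2norm (dt w s))) _ H1 H2.
  have S0 : 0 <= 2 * h * inner (dx w s) (dx w s).
    by rewrite mulr_ge0 ?inner_ge0 // mulr_ge0 // h0.
  move: (Y S0); rewrite (innerC (derive1 (dt w s)) (dx w s)).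
  move: (inner (dx w s) (derive1 (dt w s))) (inner (zof delta w s) _) => p q.
  move: (inner (dx w s) (dx w s)) => X.
  move: (L2norm _ ^+ 2) (flux wd c0 _ ) (flux wd c1 _) => N f0 f1 {H1 H2 S0 Y}.
  move=> Y E; nra.
have e0 : zof delta w 0 = fun=> 0.
  by apply/funext => x; rewrite /zof /memory set_itv1 Rintegral_set1.
have pos (s : R) : 0 <= s <= t -> [/\ 0 <= inner (w s) (w s), 0 <= inner (dx w s) (dx w s),
    0 <= inner (zof delta w s) (zof delta w s) & 0 <= L2norm (velocity w A s) ^+ 2].
  by move=> _; split; rewrite ?inner_ge0 ?sqr_ge0.
have poincare (s : R) : 0 <= s <= t ->
    inner (w s) (w s) <= inner (dx w s) (dx w s) + w s 0 ^+ 2 + w s 1 ^+ 2.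
  by move=> /andP[s0 _]; rewrite -!L2normK; exact: sobolev1_poincare (S1 s s0).
have coupling (s : R) : 0 <= s <= t -> inner (zof delta w s) (dx w s) ^+ 2 <=
    inner (dx w s) (dx w s) * inner (zof delta w s) (zof delta w s).
  move=> s0t; have /andP[s0 _] := s0t.
  rewrite -!L2normK mulrC -exprMn -(real_normK (num_real (inner _ _))) lerXn2r ?nnegrE //.
    by rewrite mulr_ge0 // L2norm_ge0.
  by apply: cauchy_schwarz; [exact: Lz|exact: Lx].
have Z_0 : inner (zof delta w 0) (zof delta w 0) = 0 by rewrite e0 inner0l.
have c_0 : inner (zof delta w 0) (dx w 0) = 0 by rewrite e0 inner0l.
have := energy_decay nu_gt0 rho_gt0 delta_gt0 c0_gt0 c1_gt0 wd_ge0 alpha_ge0 beta_gt0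
  beta_nu beta_delta beta_c0 beta_c1 t0 An' AX AZ Acc Ap Aq intN pos poincare coupling
  test_w test_wt Z_0 c_0.
have S0 := S1 0 (lexx 0).
have o01 : 0 <= (0 : R) <= 1 by rewrite lexx ler01.
have i01 : 0 <= (1 : R) <= 1 by rewrite lexx ler01.
rewrite -!L2normK => H; apply: le_trans H _.
apply: le_trans (initial_estimate nu_gt0 rho_gt0 delta_gt0 c0_gt0 c1_gt0 wd_ge0 alpha_ge0 beta_gt0
  (L2norm_ge0 _) (L2norm_ge0 _) (sobolev1_agmon S0 o01) (sobolev1_agmon S0 i01)) _.
by rewrite sobolev_norm1_sqE.
Qed.

End decay.

(** * The weighted time integral in extended form, and the theorem *)

Section weighted_time_integral.
Context {R : realType}.
Local Notation mu := (@lebesgue_measure R).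

Lemma measurable_L2norm_sq_cc (u : R -> R -> R) (t : R) :
  measurable_fun (`]0, +oo[ `*` `]0, 1[ : set (R * R)) (fun p : R * R => u p.1 p.2) ->
  measurable_fun `[0, t] (fun s => L2norm (u s) ^+ 2).
Proof.
move=> /(measurable_L2norm_sq (measurable_itv _)) m.
apply/measurable_fun_itv_obnd_cbndP; apply: measurable_funS m => //.
exact: subset_itvl.
Qed.

Lemma weighted_integral_ae (k t : R) (M N : R -> R) : 0 <= k -> 0 <= t ->
  measurable_fun `[0, t] M -> rintegrable mu `[0, t] N ->
  {ae mu, forall s, 0 <= s <= t -> M s = N s} ->
  (\int[mu]_(s in `[0%R, t]) (expR (k * s) * M s)%:E)%E =
  (\int[mu]_(s in `[0, t]) (expR (k * s) * N s))%:E.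
Proof.
move=> k0 t0 mM intN MN.
have mE : measurable_fun `[0, t] (fun s => expR (k * s)).
  exact: rintegrable_measurable (ac_rint t0 (ac_expR k t0)).
have mN := rintegrable_measurable intN.
have intEN : rintegrable mu `[0, t] (fun s => expR (k * s) * N s).
  apply: (@le_rintegrable _ _ _ mu _ _ (fun s => expR (k * t) * `|N s|)) => //.
  - exact: measurable_funM.
  - move=> s; rewrite /= in_itv /= => /andP[s0 st]; rewrite normrM ger0_norm ?expR_ge0 //.
    by apply: ler_wpM2r => //; rewrite ler_expR ler_wpM2l.
  - by apply: rintegrableZ => //; exact: rintegrable_norm.
rewrite -EFin_Rintegral //; apply: ae_eq_integral => //.
- by apply/measurable_EFinP; exact: measurable_funM.
- by apply/measurable_EFinP; exact: measurable_funM.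
- by apply: (ae_imply MN) => s MNs; rewrite /= in_itv /= => /MNs ->.
Qed.

Lemma unweight (e x y c s z : R) : 0 < e -> e * x + y <= c * s * z ->
  x + e^-1 * y <= c * e^-1 * s * z.
Proof.
move=> e0 H; have -> : x + e^-1 * y = e^-1 * (e * x + y) by field; rewrite gt_eqF.
have -> : c * e^-1 * s * z = e^-1 * (c * s * z) by ring.
by rewrite ler_pM2l // invr_gt0.
Qed.

End weighted_time_integral.

Theorem lemma2p2 (R : realType) (nu rho delta c0 c1 wd alpha : R)
  (nu_gt0 : 0 < nu) (rho_gt0 : 0 < rho) (delta_gt0 : 0 < delta)
  (c0_gt0 : 0 < c0) (c1_gt0 : 0 < c1) (wd_ge0 : 0 <= wd)
  (alpha_ge0 : 0 <= alpha)
  (alpha_le : alpha <= 2^-1 * min4 nu delta (c0 + wd) (c1 + wd))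
  (beta_gt0 : 0 < min4 (nu - 2 * alpha) (delta - 2 * alpha)
                       (c0 + wd - 2 * alpha) (c1 + wd - 2 * alpha)) :
  exists2 C : R, 0 < C &
    forall (w0 : R -> R) (w : R -> R -> R),
      weak_solution nu rho delta c0 c1 wd w0 w ->
      assumption_A1 nu rho delta c0 c1 wd w0 w ->
      assumption_A2 nu rho delta c0 c1 wd w0 w ->
      forall t : R, 0 < t ->
        ((nu / 2 * L2norm (dx w t) ^+ 2 + boundary_energy c0 c1 wd w t)%:E
         + (expR (- (2 * alpha * t)))%:E *
           \int[lebesgue_measure]_(s in `[0%R, t])
             (expR (2 * alpha * s) * L2norm (dt w s) ^+ 2)%:E
         <= (C * expR (- (2 * alpha * t)) * sobolev_norm 1 w0 ^+ 2
             * expR (C * L2norm w0 ^+ 2))%:E)%E.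
Proof.
set beta := min4 _ _ _ _ in beta_gt0.
have [b1 b2 b3 b4] : [/\ beta <= nu - 2 * alpha, beta <= delta - 2 * alpha,
    beta <= c0 + wd - 2 * alpha & beta <= c1 + wd - 2 * alpha].
  by rewrite /beta /min4; split; rewrite !ge_min lexx ?orbT.
set C := decay_constant nu rho delta c0 c1 wd alpha beta.
exists C; first exact: decay_constant_gt0.
move=> w0 w ws _ [_ _ _ Ldt _] t t_gt0; have t0 := ltW t_gt0.
have [N [intN NE est]] := solution_decay nu_gt0 rho_gt0 delta_gt0 c0_gt0 c1_gt0 wd_ge0
  alpha_ge0 beta_gt0 b1 b2 b3 b4 t0 ws Ldt.
have [_ tw _ w00] := ws; have [mdt _ _] := tw.
have L2w0 : L2norm (w 0) = L2norm w0.
  by apply: eq_L2norm => x; rewrite /= in_itv /= => /andP[x0 x1]; apply: w00; rewrite !ltW.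
have L2dw0 : L2norm (derive1 (w 0)) = L2norm (derive1 w0).
  by apply: eq_L2norm => x Ix; exact: eq_derive1_itv w00 x Ix.
have k0 : 0 <= 2 * alpha by rewrite mulr_ge0.
have mL := @measurable_L2norm_sq_cc _ (dt w) t mdt.
have intE := weighted_integral_ae k0 t0 mL intN NE.
rewrite intE {intE mL NE intN tw ws mdt}.
rewrite -EFinM -EFinD lee_fin sobolev_norm1_sqE -L2w0 -L2dw0 -sobolev_norm1_sqE expRN.
exact: unweight (expR_gt0 _) est.
Qed.
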